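(* Let $\alpha\ge 0$, put $T_*=\frac{2\ln 2}{3}$ and $C_0=\left(e^{-\frac32 T_* 2^5}\,2^{-10}\right)^{-1}$. There exist constants $\Lambda\ge 1$ and $C_1>0$ (big enough, depending at most on $\alpha$) such that the following holds. Let $s>-1$, and let $\eta>0$ satisfy $$\eta^2\ge \Lambda\, 2^{1-2s}C_0 \ \text{ if } -1<s<\tfrac12,\qquad \eta^2\ge \Lambda\, C_0\ \text{ if } s\ge \tfrac12 .$$ Let $u_0$ be the initial datum defined by $$\widehat{u_0}(\xi)=\eta\,\mathbf 1_{\{|\xi-3/2|<1/2\}}(\xi),\qquad \xi\in\mathbb R .$$ Let $\gamma_1,\gamma_2\in\mathbb R$ satisfy $\gamma_2\ne\frac{\gamma_1}{2}$, $\gamma_2\neq 0$, and moreover $$\gamma_2<0<\gamma_1,\qquad \frac{C_1}{2}\le \gamma_1-\gamma_2 .$$ Then the solution $u(t,x)$ of $$\partial_t u+\partial_x^2u+\alpha(-\partial_x^2)^{\frac32}u+\partial_x^4u=\gamma_1\Big((-\partial_x^2)^{\frac12}u\Big)^2+\gamma_2\,u\,\partial_x^2u$$ arising from $u_0$ blows up at the time $T_*=\frac{2\ln 2}{3}$, in the sense that $\|u(T_*,\cdot)\|_{\dot H^s}=+\infty$.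
   Context: For $\sigma\in\mathbb R$, $(-\partial_x^2)^{\sigma/2}$ is the operator on $\mathbb R$ with Fourier symbol $|\xi|^\sigma$. The Fourier transform in $x$ is denoted by a hat and normalized so that $\partial_x$ has symbol $i\xi$ and products become convolutions, $\widehat{fg}=\widehat f*\widehat g$ (e.g. $\widehat f(\xi)=\frac1{2\pi}\int_{\mathbb R} e^{-ix\xi}f(x)\,dx$). $\|f\|_{\dot H^s}^2=\int_{\mathbb R}|\xi|^{2s}|\widehat f(\xi)|^2d\xi$. Functions may be complex-valued (the datum $u_0$ has a non-symmetric Fourier transform). ''Solution'' means mild solution: in Fourier variables, $$\widehat u(t,\xi)=e^{-t(-\xi^2+\alpha|\xi|^3+\xi^4)}\widehat{u_0}(\xi)+\int_0^t e^{-(t-\tau)(-\xi^2+\alpha|\xi|^3+\xi^4)}\Big(\gamma_1(|\xi|\widehat u*|\xi|\widehat u)-\gamma_2\,\widehat u*(\xi^2\widehat u)\Big)(\tau,\xi)\,d\tau .$$ For $u_0\in H^s(\mathbb R)$, $s>-1$, there is a time $T_0>0$ (depending on $\|u_0\|_{H^s}$ and $s$) and a unique solution $u$, obtained as the limit of the Picard iterates, in the space $X^s_{T_0}$ of $u\in\mathcal C([0,T_0],H^s(\mathbb R))$ with $$\sup_{0\le t\le T_0}\|u(t,\cdot)\|_{H^s}+\sup_{0<t\le T_0}t^{\frac{|s|}4}\|u(t,\cdot)\|_{L^2}+\sup_{0<t\le T_0}t^{\frac{|s|+1}4}\|\partial_xu(t,\cdot)\|_{L^2}<+\infty .$$ 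*)

(* Defs.v *)
From HB Require Import structures.
From mathcomp Require Import all_boot all_order all_algebra.
From mathcomp Require Import all_classical all_reals all_analysis.
From mathcomp Require Import complex.

Set Implicit Arguments.
Unset Strict Implicit.
Unset Printing Implicit Defensive.
Import Order.TTheory GRing.Theory Num.Theory.
Import numFieldNormedType.Exports.
Import ComplexField.Normc.

Local Open Scope classical_set_scope.
Local Open Scope ring_scope.
Local Open Scope complex_scope.

(* A (complex-valued) function or distribution f in H^s(R), s > -1, is
   represented by its Fourier transform, a measurable function R -> R[i]; a
   space-time function u by u t xi = the Fourier transform of u(t, .) at xi.
   The Fourier transform is normalized so that d/dx has symbol i * xi and
   products become convolutions. *)

Section Defs.
Variable R : realType.
Notation C := (R[i]).
Notation mu := (@lebesgue_measure R).

Definition measurable_fun_C d (T : measurableType d) (D : set T) (f : T -> C) :=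
  measurable_fun D (fun x => complex.Re (f x)) /\
  measurable_fun D (fun x => complex.Im (f x)).

Definition integrable_C (D : set R) (f : R -> C) :=
  mu.-integrable D (fun x => (complex.Re (f x))%:E) /\
  mu.-integrable D (fun x => (complex.Im (f x))%:E).

Definition integral_C (D : set R) (f : R -> C) : C :=
  (\int[mu]_(x in D) complex.Re (f x))%R
    +i* (\int[mu]_(x in D) complex.Im (f x))%R.

Definition conv (f g : R -> C) (xi : R) : C :=
  integral_C setT (fun zeta => f (xi - zeta) * g zeta).

Definition conv_defined (f g : R -> C) (xi : R) :=
  integrable_C setT (fun zeta => f (xi - zeta) * g zeta).

(* Norms, with values in [0, +oo].  By Plancherel, [L2_norm f] is the norm of
   the function represented by f up to the constant factor (2 pi)^(1/2). *)

Definition Hs_norm (s : R) (f : R -> C) : \bar R :=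
  sqrte (\int[mu]_xi ((1 + xi ^+ 2) `^ s * normc (f xi) ^+ 2)%:E)%E.

Definition Hdot_norm (s : R) (f : R -> C) : \bar R :=
  sqrte (\int[mu]_xi (`|xi| `^ (2 * s) * normc (f xi) ^+ 2)%:E)%E.

Definition L2_norm (f : R -> C) : \bar R :=
  sqrte (\int[mu]_xi (normc (f xi) ^+ 2)%:E)%E.

Definition mul_dx (f : R -> C) : R -> C := fun xi => (0 +i* xi) * f xi.
Definition mul_abs (f : R -> C) : R -> C := fun xi => `|xi|%:C * f xi.
Definition mul_sq (f : R -> C) : R -> C := fun xi => (xi ^+ 2)%:C * f xi.

(* The equation
     u_t + u_xx + alpha (-d_x^2)^(3/2) u + u_xxxx
       = gamma1 ((-d_x^2)^(1/2) u)^2 + gamma2 u u_xx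
   in Fourier variables. *)

Definition symb (alpha xi : R) : R :=
  - xi ^+ 2 + alpha * `|xi| ^+ 3 + xi ^+ 4.

Definition nonlin (gamma1 gamma2 : R) (f : R -> C) (xi : R) : C :=
  gamma1%:C * conv (mul_abs f) (mul_abs f) xi
  - gamma2%:C * conv f (mul_sq f) xi.

Definition nonlin_defined (f : R -> C) (xi : R) :=
  conv_defined (mul_abs f) (mul_abs f) xi /\ conv_defined f (mul_sq f) xi.

Definition duhamel_integrand (alpha gamma1 gamma2 : R) (u : R -> R -> C)
    (t xi tau : R) : C :=
  (expR (- ((t - tau) * symb alpha xi)))%:C * nonlin gamma1 gamma2 (u tau) xi.

Definition duhamel (alpha gamma1 gamma2 : R) (u0 : R -> C) (u : R -> R -> C)
    (t xi : R) : C :=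
  (expR (- (t * symb alpha xi)))%:C * u0 xi
  + integral_C `[0, t] (duhamel_integrand alpha gamma1 gamma2 u t xi).

Definition picard (alpha gamma1 gamma2 : R) (u0 : R -> C) (n : nat) :
    R -> R -> C :=
  iter n (duhamel alpha gamma1 gamma2 u0) (fun _ _ => 0).

(* The Duhamel formula on [0, T].  Convergence of the integrals is required
   explicitly, as the Lebesgue integral of the library is total. *)
Definition mild (alpha gamma1 gamma2 : R) (u0 : R -> C) (T : R)
    (u : R -> R -> C) :=
  forall t : R, 0 <= t <= T ->
    {ae mu, forall xi,
      [/\ forall tau : R, 0 < tau <= t -> nonlin_defined (u tau) xi,
          integrable_C `[0, t] (duhamel_integrand alpha gamma1 gamma2 u t xi)
        & u t xi = duhamel alpha gamma1 gamma2 u0 u t xi]}.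

Definition cont_Hs (s T : R) (u : R -> R -> C) :=
  forall t : R, 0 <= t <= T -> (Hs_norm s (u t) < +oo)%E /\
    forall e : R, 0 < e -> exists2 delta : R, 0 < delta &
      forall t' : R, 0 <= t' <= T -> `|t' - t| < delta ->
        (Hs_norm s (fun xi => u t' xi - u t xi)%R < e%:E)%E.

Definition X_norm (s T : R) (u : R -> R -> C) : \bar R :=
  (ereal_sup [set Hs_norm s (u t) | t in `[0%R, T]]
   + ereal_sup [set (t `^ (`|s| / 4))%:E * L2_norm (u t) | t in `]0%R, T]]
   + ereal_sup [set (t `^ ((`|s| + 1) / 4))%:E * L2_norm (mul_dx (u t))
               | t in `]0%R, T]])%E.

(* Elements of C([0, T], H^s) are represented by jointly measurable functions
   of (t, xi); such a representative always exists. *)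
Definition in_X (s T : R) (u : R -> R -> C) :=
  [/\ measurable_fun_C (`[0, T] `*` setT) (fun z : R * R => u z.1 z.2),
      cont_Hs s T u
    & (X_norm s T u < +oo)%E].

Definition X_solution (alpha gamma1 gamma2 s : R) (u0 : R -> C) (T : R)
    (u : R -> R -> C) :=
  [/\ 0 < T, in_X s T u & mild alpha gamma1 gamma2 u0 T u].

(* u is "the" solution arising from u0: the limit of the Picard iterates.  It
   is a solution in the class X^s_T for some T > 0, and every solution in X^s_T,
   for any T > 0, coincides with it on [0, T].  The Duhamel formula and the
   Picard limit give a meaning to u t also for the times t at which u t is no
   longer in H^s, so that its norm can be +oo. *)
Definition is_the_solution (alpha gamma1 gamma2 s : R) (u0 : R -> C)
    (u : R -> R -> C) :=
  [/\ forall t xi : R, 0 <= t ->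
        normc (picard alpha gamma1 gamma2 u0 n t xi - u t xi) @[n --> \oo]
          --> (0 : R),
      forall T : R, 0 < T -> mild alpha gamma1 gamma2 u0 T u,
      exists T0, X_solution alpha gamma1 gamma2 s u0 T0 u
    & forall T v, X_solution alpha gamma1 gamma2 s u0 T v ->
        forall t : R, 0 <= t <= T -> {ae mu, forall xi, v t xi = u t xi}].

Definition Tstar : R := 2 * ln 2 / 3.

Definition C0 : R := (expR (- (3 / 2 * Tstar * 2 ^+ 5)) * 2 ^- 10)^-1.

Definition datum (eta : R) : R -> C :=
  fun xi => if `|xi - 3 / 2| < 1 / 2 then eta%:C else 0.

End Defs.

Arguments Tstar R : clear implicits.
Arguments C0 R : clear implicits.

(* Main.v *)
Require Import Defs.
From HB Require Import structures.
From mathcomp Require Import all_boot all_order all_algebra.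
From mathcomp Require Import all_classical all_reals all_analysis.
From mathcomp Require Import measurable_realfun complex.
From mathcomp Require Import ring lra.

Set Implicit Arguments.
Unset Strict Implicit.
Unset Printing Implicit Defensive.
Import Order.TTheory GRing.Theory Num.Theory.
Import numFieldNormedType.Exports.
Local Open Scope classical_set_scope.
Local Open Scope ring_scope.

(** Fourier side: the datum is nonnegative and supported in (1, 2), and since
    gamma2 < 0 < gamma1 all terms of the Duhamel formula are nonnegative.  At
    frequency xi the convolutions only see frequencies in (1, xi - 1), so the
    Picard iterates are nonnegative and stationary at xi from the step n >= xi
    on; their limit satisfies the Duhamel formula at every time.

    For a short time the bound A exp(-xi) propagates along the iterates: the
    convolutions cost a factor xi^3, and integrating the heat kernel in time
    gains t^(1/4) xi^(-3).  Hence the limit is in X^s.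

    Uniqueness: if two frequencies add up to at most 1, one of them is at most 1.
    So the part of a solution at frequencies <= 1 satisfies a homogeneous
    estimate, and vanishes by a contraction argument on time steps of fixed
    length.  The solution is then determined frequency by frequency by the
    Duhamel formula, as above; no bound on the blowing-up limit is involved.

    Blow-up: on the interval of length one around 3/2 * 2^k and at the times in
    [(1 - 2^-k) T, T], the transform is at least a_k, where
    a_(k+1) = c 4^(-k) a_k^2 and c is proportional to gamma1 - gamma2.  For c
    large this gives a_k >= (4/c) 4^k 2^(2^k), which beats every power of
    the frequency. *)

(** * Integrals over the line *)

(** With all frequencies above 1, the integrals at a fixed frequency run over a bounded range and
    involve bounded functions. This gives the limit a meaning at times when its norms are infinite.
    A solution of the class X^s is not known to have this support, nor to be nonnegative: this is
    the obstacle to uniqueness. At frequencies at most 1 the nonlinearity is bounded by products of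
    the full solution with its own low part. The estimate is thus linear in the low part, and short
    time steps give a contraction without any smallness of the solution.

    In the lower bound, 4^(-k) is the balance of 4^k, from two derivatives at frequencies of order
    2^k, and 16^(-k), the order of the time during which the heat kernel at such frequencies stays
    above exp (-1). These windows fit into the gaps T 2^(-k-1) between consecutive time ranges as
    soon as T >= 1/16. The lower bound on gamma1 - gamma2 depends on alpha alone, through the heat
    decay of the datum up to the time T and through the growth of the symbol. *)

Section Reflection.
Variable R : realType.
Notation mu := (@lebesgue_measure R).

Lemma measurable_reflect (c : R) : measurable_fun setT (fun x : R => c - x).
Proof. exact: measurable_funB. Qed.

(** Uniqueness of Lebesgue measure: it is enough to compare on the intervals []a, b]], whose
    preimages [[c - b, c - a[] have the same length. *)
Lemma lebesgue_measure_reflect (c : R) (A : set R) : measurable A ->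
  pushforward mu (fun x : R => c - x) A = mu A.
Proof.
move=> mA; apply/esym.
pose phi := fun x : measurableTypeR R => (c - x : measurableTypeR R).
have mphi : measurable_fun setT phi by exact: measurable_reflect.
pose mphi_mixin := isMeasurableFun.Build _ _ _ _ phi mphi.
pose mphi_pack : {mfun _ >-> _} := HB.pack phi mphi_mixin.
apply: (@lebesgue_measure_unique R (pushforward mu mphi_pack)) => //.
move=> X [[a b] /= ab <-].
rewrite /pushforward [X in _ = mu X](_ : _ = `[c - b, c - a[%classic).
  rewrite !lebesgue_measure_itv/= !lte_fin ltrD2l ltrN2.
  by case: ifPn => // ?; rewrite -!EFinB; congr EFin; lra.
by apply/seteqP; split => x /=; rewrite !in_itv/= /phi => /andP[? ?]; apply/andP; split; lra.
Qed.

Lemma ge0_integral_reflect (c : R) (f : R -> \bar R) :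
  measurable_fun setT f -> (forall x, 0 <= f x)%E ->
  (\int[mu]_x f (c - x)%R = \int[mu]_x f x)%E.
Proof.
move=> mf f0.
pose phi := fun x : measurableTypeR R => (c - x : measurableTypeR R).
have mphi : measurable_fun setT phi by exact: measurable_reflect.
rewrite -[LHS](@ge0_integral_pushforward _ _ _ _ R phi mphi mu setT f)//.
apply: eq_measure_integral => A mA _; exact: lebesgue_measure_reflect.
Qed.

(** Needed for the factor taken at [x - z] in a convolution, when the functions are only known
    almost everywhere. *)
Lemma ae_reflect (c : R) (P : R -> Prop) :
  {ae mu, forall x, P x} -> {ae mu, forall x, P (c - x)}.
Proof.
move=> [A [mA A0 PA]].
exists ((fun x => c - x) @^-1` A); split.
- by rewrite -[X in measurable X]setTI; apply: measurable_reflect.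
- by rewrite -A0 -[RHS](lebesgue_measure_reflect c mA).
- by move=> x /= Px; apply: PA.
Qed.

End Reflection.

Section CauchySchwarz.
Variable R : realType.
Notation mu := (@lebesgue_measure R).

Lemma cauchy_schwarz_bound (f g : R -> R) (A B : R) :
  measurable_fun setT f -> measurable_fun setT g ->
  0 <= A -> 0 <= B ->
  (\int[mu]_x (f x ^+ 2)%:E <= (A ^+ 2)%:E)%E ->
  (\int[mu]_x (g x ^+ 2)%:E <= (B ^+ 2)%:E)%E ->
  (\int[mu]_x (`|f x * g x|)%:E <= (A * B)%:E)%E.
Proof.
move=> mf mg A0 B0 fA gB.
have L2 (h : R -> R) C : 0 <= C -> (\int[mu]_x (h x ^+ 2)%:E <= (C ^+ 2)%:E)%E ->
    ('N[mu]_2%:E[EFin \o h] <= C%:E)%E.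
  move=> C0 hC; rewrite unlock /=.
  rewrite -[leRHS](_ : ((C ^+ 2)%:E `^ 2^-1 = C%:E)%E); last first.
    by rewrite poweR_EFin -powR_mulrn// -powRrM mulfV// powRr1.
  apply: gt0_ler_poweR; rewrite ?in_itv/= ?leey ?andbT ?invr_ge0 ?lee_fin ?sqr_ge0//.
    by apply: integral_ge0 => x _; rewrite lee_fin powR_ge0.
  apply: le_trans hC; rewrite le_eqVlt; apply/orP; left; apply/eqP.
  by apply: eq_integral => x _; rewrite powR_mulrn// real_normK ?num_real.
have := @hoelder _ _ _ mu f g 2 2 mf mg.
move=> /(_ ltac:(lra) ltac:(lra) ltac:(lra)).
rewrite Lnorm1 => /le_trans; apply.
by rewrite EFinM; apply: lee_pmul; rewrite ?Lnorm_ge0//; apply: L2.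
Qed.

End CauchySchwarz.

Section OneDsqr.
Variable R : realType.
Notation mu := (@lebesgue_measure R).

Lemma measurable_oneDsqrV : measurable_fun setT (fun x : R => (1 + x ^+ 2)^-1).
Proof. by apply: continuous_measurable_fun; exact: continuous_oneDsqrV. Qed.

Lemma integral_oneDsqrV_le : (\int[mu]_x ((1 + x ^+ 2)^-1)%:E <= pi%:E)%E.
Proof.
have ge0 x : (0 <= ((1 + x ^+ 2)^-1)%:E :> \bar R)%E.
  by rewrite lee_fin invr_ge0 addr_ge0// sqr_ge0.
have mf : measurable_fun setT (fun x : R => ((1 + x ^+ 2)^-1)%:E).
  by apply/measurable_EFinP; exact: measurable_oneDsqrV.
have h0 : (\int[mu]_(x in `[0%R, +oo[) ((1 + x ^+ 2)^-1)%:E = (pi / 2)%:E)%E.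
  exact: integral0y_oneDsqr.
have half (A : set R) : measurable A -> A `<=` `[0%R, +oo[ ->
    (\int[mu]_(x in A) ((1 + x ^+ 2)^-1)%:E <= (pi / 2)%:E)%E.
  by move=> mA A0; rewrite -h0; apply: ge0_subset_integral => //; exact: measurable_funS mf.
rewrite -(setUv `[0%R, +oo[) ge0_integral_setU//=; first last.
- exact/disj_setPCl.
- exact: measurable_funS mf.
- exact: measurableC.
rewrite h0 [leRHS](_ : _ = (pi / 2)%:E + (pi / 2)%:E)%E; last first.
  by rewrite -EFinD; congr EFin; lra.
(* The negative half-line is reflected onto []0, +oo[], where the integral is at most [pi / 2]. *)
rewrite leeD2l// integral_mkcond -(@ge0_integral_reflect _ 0)/=; last 2 first.
- by apply/(measurable_restrictT _ _).1 => //; [exact: measurableC|exact: measurable_funS mf].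
- by move=> x; exact: erestrict_ge0.
apply: le_trans (half `]0%R, +oo[%classic _ _) => //; last first.
  by move=> x /=; rewrite !in_itv/= !andbT => /ltW.
rewrite [leRHS]integral_mkcond/=; rewrite le_eqVlt; apply/orP; left; apply/eqP.
apply: eq_integral => x _.
rewrite !patchE sub0r sqrrN.
have -> : (- x \in ~` `[0, +oo[) = (x \in `]0, +oo[%classic); last by [].
by rewrite in_setC !mem_setE !in_itv/= !andbT oppr_ge0 -ltNge.
Qed.
End OneDsqr.

(** * Singular power integrals and elementary exponential bounds *)

Section PowerIntegrals.
Variable R : realType.
Notation mu := (@lebesgue_measure R).
Implicit Types (a x y L th : R).

Lemma continuous_powR_gt0 a x : 0 < x -> {for x, continuous (fun z : R => z `^ a)}.
Proof.
move=> x0; apply: differentiable_continuous; apply/derivable1_diffP.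
by apply: derivable_powR; rewrite in_itv/= x0.
Qed.

(** The integrand is singular at 0, so the fundamental theorem of calculus is applied on compact
    intervals that exhaust []0, L]]. The value of the primitive at the left endpoint is nonnegative
    and is dropped before passing to the limit. *)
Lemma integral_powR_le a L : a < 1 -> 0 < L ->
  (\int[mu]_(x in `]0%R, L]) (x `^ (- a))%:E <= (L `^ (1 - a) / (1 - a))%:E)%E.
Proof.
move=> a1 L0; have a10 : 0 < 1 - a by lra.
(* With [i.+2] the left endpoint stays strictly below [L], even for [i = 0]. *)
pose F (i : nat) := `[L / i.+2%:R, L]%classic.
have LS i : 0 < L / i.+2%:R by rewrite divr_gt0.
have mpow D : measurable_fun D (fun x => (x `^ (- a))%:E).
  by apply/measurable_EFinP; apply: (measurable_funS measurableT) => //; exact: measurable_powR.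
have -> : `]0%R, L]%classic = \bigcup_i F i.
  apply/seteqP; split => [x /=|x [i _] /=]; rewrite !in_itv/=.
    move=> /andP[x0 xL].
    have [i Li] : exists i : nat, L / x <= i%:R.
      by exists (Num.bound (L / x)); apply/ltW/archi_boundP; rewrite divr_ge0 ?ltW.
    exists i => //=; rewrite /F/= in_itv/= xL andbT ler_pdivrMr//.
    rewrite -ler_pdivrMl// mulrC (le_trans Li)// ler_nat.
    by rewrite -addn2 leq_addr.
  by rewrite /F/= in_itv/= => /andP[h ->]; rewrite andbT (lt_le_trans _ h).
have cvgF : (\int[mu]_(x in F i) (x `^ (- a))%:E @[i --> \oo] -->
    \int[mu]_(x in \bigcup_i F i) (x `^ (- a))%:E)%E.
  apply: ge0_nondecreasing_set_cvg_integral => //.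
  - apply/nondecreasing_seqP => n; rewrite subsetEset => x; rewrite /F/= !in_itv/=.
    move=> /andP[h ->]; rewrite andbT (le_trans _ h)// ler_pM2l// lef_pV2 ?posrE//.
    by rewrite ler_nat.
  - by move=> i; rewrite /F; exact: measurable_itv.
  - by move=> i; exact: mpow.
  - by move=> i x _; rewrite lee_fin powR_ge0.
rewrite -(cvg_lim _ cvgF)//; apply: lime_le; first by apply/cvg_ex; eexists; exact: cvgF.
apply: nearW => i; rewrite /F.
rewrite (@continuous_FTC2 _ _ (fun z => z `^ (1 - a) / (1 - a))).
- rewrite -EFinB lee_fin lerBlDr lerDl divr_ge0 ?powR_ge0// ltW//.
- by rewrite ltr_pdivrMr// ltr_pMr// ltr1n.
- apply: continuous_in_subspaceT => x; rewrite inE/= in_itv/= => /andP[h _].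
  by apply: continuous_powR_gt0; exact: lt_le_trans h.
- have dF x : 0 < x -> derivable (fun z => z `^ (1 - a) / (1 - a)) x 1.
    by move=> x0; apply: derivableM => //; apply: derivable_powR; rewrite in_itv/= x0.
  have cF x : 0 < x -> {for x, continuous (fun z => z `^ (1 - a) / (1 - a))}.
    by move=> /dF ?; apply: differentiable_continuous; exact/derivable1_diffP.
  split.
  + move=> x; rewrite in_itv/= => /andP[h _]; apply: dF; exact: lt_trans h.
  + by apply: cvg_at_right_filter; exact: cF.
  + by apply: cvg_at_left_filter; exact: cF.
- move=> x; rewrite in_itv/= => /andP[h _].
  have x0 : 0 < x by exact: lt_trans h.
  rewrite derive1E deriveM//; last by apply: derivable_powR; rewrite in_itv/= x0.
  rewrite derive_cst scaler0 add0r -derive1E powR_derive1 ?in_itv/= ?x0//.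
  rewrite /GRing.scale/= mulrA mulVf ?gt_eqF// mul1r; congr powR; lra.
Qed.

Lemma integral_powR_right_le a x y : a < 1 -> x < y ->
  (\int[mu]_(t in `]x, y[) ((y - t) `^ (- a))%:E <= ((y - x) `^ (1 - a) / (1 - a))%:E)%E.
Proof.
move=> a1 xy; apply: le_trans (integral_powR_le a1 _); last by rewrite subr_gt0.
have mpow D : measurable_fun D (fun x => (x `^ (- a))%:E).
  by apply/measurable_EFinP; apply: (measurable_funS measurableT) => //; exact: measurable_powR.
rewrite [leRHS]integral_mkcond -(@ge0_integral_reflect _ y)/=; last 2 first.
- by apply/(measurable_restrictT _ _).1.
- by move=> z; apply: erestrict_ge0 => ? _; rewrite lee_fin powR_ge0.
rewrite integral_mkcond/=; apply: ge0_le_integral => //=.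
- by move=> z _; apply: erestrict_ge0 => ? _; rewrite lee_fin powR_ge0.
- apply/(measurable_restrictT _ _).1 => //; apply/measurable_EFinP.
  by apply: (measurableT_comp (measurable_powR _)) => //; exact: measurable_funB.
- have mg : measurable_fun setT ((fun z => (z `^ (- a))%:E) \_ `]0, y - x]).
    by apply/(measurable_restrictT _ _).1.
  exact: (measurableT_comp mg (measurable_reflect y)).
- move=> z _; rewrite !patchE !mem_setE !in_itv/=.
  have [h|h] := boolP (x < z < y); last first.
    by case: ifP => // _; rewrite lee_fin powR_ge0.
  by rewrite ifT//; apply/andP; split; lra.
Qed.

Lemma integral_powR_left_le a x y : a < 1 -> x < y ->
  (\int[mu]_(t in `]x, y[) ((t - x) `^ (- a))%:E <= ((y - x) `^ (1 - a) / (1 - a))%:E)%E.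
Proof.
move=> a1 xy; apply: le_trans (integral_powR_right_le a1 xy).
rewrite [leRHS]integral_mkcond -(@ge0_integral_reflect _ (x + y))/=; last 2 first.
- apply/(measurable_restrictT _ _).1 => //; apply/measurable_EFinP.
  by apply: (measurableT_comp (measurable_powR _)) => //; exact: measurable_funB.
- by move=> z; apply: erestrict_ge0 => ? _; rewrite lee_fin powR_ge0.
rewrite integral_mkcond/= le_eqVlt; apply/orP; left; apply/eqP; apply: eq_integral => z _.
rewrite !patchE !mem_setE !in_itv/=.
rewrite (_ : (x < x + y - z < y) = (x < z < y)); last first.
  by apply/idP/idP => ?; apply/andP; split; lra.
by case: ifP => // _; congr (_ `^ _)%:E; lra.
Qed.

(* One of [p], [q] is at least their mean. *)
Lemma powR_mul_le_sum th a p q : 0 <= th -> 0 <= a -> 0 < p -> 0 < q ->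
  p `^ (- th) * q `^ (- a) <=
  ((p + q) / 2) `^ (- th) * q `^ (- a) + ((p + q) / 2) `^ (- a) * p `^ (- th).
Proof.
move=> th0 a0 p0 q0.
have anti b u v : 0 <= b -> 0 < u -> u <= v -> v `^ (- b) <= u `^ (- b).
  move=> b0 u0 uv; rewrite !powRN lef_pV2 ?posrE ?powR_gt0//; last lra.
  by apply: ge0_ler_powR; rewrite ?nnegrE//; lra.
have [pq|pq] := leP p q.
  rewrite ler_wpDl ?mulr_ge0 ?powR_ge0// mulrC ler_wpM2r ?powR_ge0// anti//; lra.
rewrite ler_wpDr ?mulr_ge0 ?powR_ge0// ler_wpM2r ?powR_ge0// anti//; lra.
Qed.

(** An elementary upper bound for Euler's Beta function at (1 - th, 1 - a), which is the exact
    constant in [integral_beta_le]. *)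
Definition beta_cst th a : R := 2 `^ th / (1 - a) + 2 `^ a / (1 - th).

Lemma integral_beta_le th a x y : 0 <= th < 1 -> 0 <= a < 1 -> x < y ->
  (\int[mu]_(t in `]x, y[) ((y - t) `^ (- th) * (t - x) `^ (- a))%:E
    <= (beta_cst th a * (y - x) `^ (1 - th - a))%:E)%E.
Proof.
move=> /andP[th0 th1] /andP[a0 a1] xy.
have mr D b : measurable D -> measurable_fun D (fun z : R => ((y - z) `^ (- b))).
  move=> mD; apply: (measurable_funS measurableT) => //.
  by apply: (measurableT_comp (measurable_powR _)) => //; exact: measurable_funB.
have ml D b : measurable D -> measurable_fun D (fun z : R => ((z - x) `^ (- b))).
  move=> mD; apply: (measurable_funS measurableT) => //.
  by apply: (measurableT_comp (measurable_powR _)) => //; exact: measurable_funB.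
pose M := (y - x) / 2.
have M0 : 0 < M by rewrite /M; lra.
apply: (@le_trans _ _ (\int[mu]_(t in `]x, y[)
   ((M `^ (- th))%:E * ((t - x) `^ (- a))%:E + (M `^ (- a))%:E * ((y - t) `^ (- th))%:E))%E).
  apply: ge0_le_integral => //=.
  - by move=> t _; rewrite lee_fin mulr_ge0 ?powR_ge0.
  - by apply/measurable_EFinP; apply: measurable_funM; [exact: mr|exact: ml].
  - apply: emeasurable_funD; apply/measurable_EFinP; apply: measurable_funM => //.
    + exact: ml.
    + exact: mr.
  - move=> t; rewrite in_itv/= => /andP[xt ty]; rewrite -!EFinM -EFinD lee_fin.
    have := @powR_mul_le_sum th a (y - t) (t - x) th0 a0.
    by rewrite !subr_gt0 addrA subrK => /(_ ty xt).
rewrite ge0_integralD//=; first last.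
- by apply/measurable_EFinP; apply: measurable_funM => //; exact: mr.
- by move=> t _; rewrite lee_fin mulr_ge0 ?powR_ge0.
- by apply/measurable_EFinP; apply: measurable_funM => //; exact: ml.
- by move=> t _; rewrite lee_fin mulr_ge0 ?powR_ge0.
rewrite !ge0_integralZl_EFin ?powR_ge0//=; first last.
- by apply/measurable_EFinP; exact: ml.
- by move=> t _; rewrite lee_fin powR_ge0.
- by apply/measurable_EFinP; exact: mr.
- by move=> t _; rewrite lee_fin powR_ge0.
apply: (@le_trans _ _ ((M `^ (- th))%:E * ((y - x) `^ (1 - a) / (1 - a))%:E +
   (M `^ (- a))%:E * ((y - x) `^ (1 - th) / (1 - th))%:E)%E).
  by apply: leeD; apply: lee_wpmul2l; rewrite ?lee_fin ?powR_ge0//;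
    [exact: integral_powR_left_le|exact: integral_powR_right_le].
have yx0 : 0 < y - x by lra.
have half b : M `^ (- b) = 2 `^ b * (y - x) `^ (- b).
  by rewrite /M powRM ?invr_ge0//; [rewrite mulrC -powR_inv1// -powRrM mulrN mulN1r opprK|lra].
have split b c : (y - x) `^ (1 - b - c) = (y - x) `^ (- b) * (y - x) `^ (1 - c).
  by rewrite -powRD ?(gt_eqF yx0) ?implybT//; congr (_ `^ _); lra.
rewrite -!EFinM -EFinD lee_fin !half /beta_cst mulrDl.
rewrite {1}(split th a) (_ : 1 - th - a = 1 - a - th); last lra.
rewrite (split a th) le_eqVlt; apply/orP; left; apply/eqP; ring.
Qed.

(** Applied to a time multiplied by the symbol, this trades part of the heat decay for a negative
    power of the frequency, at the price of an integrable singularity in time. *)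
Lemma expRN_le_powR th x : 0 <= th <= 1 -> 0 < x -> expR (- x) <= x `^ (- th).
Proof.
move=> /andP[th0 th1] x0; rewrite expRN powRN lef_pV2 ?posrE ?powR_gt0 ?expR_gt0//.
have e1 := expR_ge1Dx x.
have [x1|x1] := leP x 1.
  apply: (@le_trans _ _ 1); last lra.
  have -> : 1 = 1 `^ th :> R by rewrite powR1.
  by rewrite ge0_ler_powR ?nnegrE//; lra.
apply: (@le_trans _ _ x); last lra.
by apply: ler1_powR => //; lra.
Qed.

(** Write [expR x] as the power [n.+1] of [expR (x / n.+1%:R)] and use exp y >= 1 + y for each
    factor. *)
Lemma exprn_expRN_le (n : nat) x : 0 <= x -> (1 + x) ^+ n.+1 * expR (- x) <= n.+1%:R ^+ n.+1.
Proof.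
move=> x0; rewrite expRN ler_pdivrMr ?expR_gt0//.
rewrite [expR x](_ : _ = expR (x / n.+1%:R) ^+ n.+1); last first.
  by rewrite -expRM_natl mulrC divfK// pnatr_eq0.
rewrite -exprMn lerXn2r ?nnegrE ?mulr_ge0 ?addr_ge0 ?expR_ge0//.
apply: (@le_trans _ _ (n.+1%:R * (1 + x / n.+1%:R))); last first.
  by rewrite ler_pM2l// expR_ge1Dx.
by rewrite mulrDr mulr1 mulrCA divff ?pnatr_eq0// mulr1 lerD2r ler1n.
Qed.

End PowerIntegrals.

(** * Real-valued integrals: bounds, and measurability in a parameter *)

Section RintegralBounds.
Variable R : realType.
Notation mu := (@lebesgue_measure R).

Lemma le_integrable_bounded (D : set R) (f : R -> R) (B : R) :
  measurable D -> (mu D < +oo)%E -> measurable_fun D f ->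
  (forall x, D x -> `|f x| <= B) -> mu.-integrable D (EFin \o f).
Proof.
move=> mD muD mf fB; apply: measurable_bounded_integrable => //.
exists B; split; first exact: num_real.
by move=> M BM x Dx; apply: le_trans (ltW BM); exact: fB.
Qed.

Lemma lebesgue_measure_itvcc_lty (a b : R) : (mu `[a, b] < +oo)%E.
Proof. by rewrite lebesgue_measure_itv/=; case: ifPn => // _; rewrite -EFinB ltry. Qed.

Lemma lebesgue_measure_itvcc (a b : R) : a <= b -> mu `[a, b] = (b - a)%:E.
Proof.
rewrite le_eqVlt => /predU1P[->|ab].
  by rewrite set_itv1 lebesgue_measure_set1 subrr.
by rewrite lebesgue_measure_itv/= lte_fin ab EFinB.
Qed.

Lemma Rintegral_le_cst (a b B : R) (f : R -> R) : a <= b ->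
  measurable_fun `[a, b] f -> (forall x, a <= x <= b -> 0 <= f x <= B) ->
  \int[mu]_(x in `[a, b]) f x <= B * (b - a).
Proof.
move=> ab mf fB.
have iB (g : R -> R) : measurable_fun `[a, b] g ->
    (forall x, a <= x <= b -> 0 <= g x <= B) -> mu.-integrable `[a, b] (EFin \o g).
  move=> mg gB; apply: (@le_integrable_bounded _ _ B) => //.
    exact: lebesgue_measure_itvcc_lty.
  by move=> x /=; rewrite in_itv/= => /gB/andP[g0 gb]; rewrite ger0_norm.
apply: (@le_trans _ _ (\int[mu]_(x in `[a, b]) B)).
  apply: le_Rintegral => //.
  - exact: iB.
  - apply: (@le_integrable_bounded _ _ `|B|) => //; exact: lebesgue_measure_itvcc_lty.
  - by move=> x /=; rewrite in_itv/= => /fB/andP[].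
by rewrite (Rintegral_cst mu)//= lebesgue_measure_itvcc.
Qed.

Lemma Rintegral_ge_cst (D : set R) (a b c : R) (f : R -> R) : a <= b -> 0 <= c ->
  measurable D -> mu.-integrable D (EFin \o f) -> `[a, b] `<=` D ->
  (forall x, D x -> 0 <= f x) -> (forall x, a <= x <= b -> c <= f x) ->
  c * (b - a) <= \int[mu]_(x in D) f x.
Proof.
move=> ab c0 mD fi abD f0 cf.
have -> : c * (b - a) = \int[mu]_(x in D) (cst c \_ `[a, b]) x.
  rewrite -Rintegral_mkcondr setIidr// (Rintegral_cst mu)//=.
  by rewrite lebesgue_measure_itvcc.
apply: le_Rintegral => //.
  rewrite -restrict_EFin; apply/integrable_restrict => //=.
  rewrite setIidr//; apply: (@le_integrable_bounded _ _ `|c|) => //.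
  exact: lebesgue_measure_itvcc_lty.
move=> x Dx; rewrite patchE; case: ifPn => [|_]; last exact: f0.
by rewrite mem_setE in_itv/=; exact: cf.
Qed.

Lemma Rintegral_setT_supp (D : set R) (f : R -> R) :
  (forall x, ~ D x -> f x = 0) -> \int[mu]_x f x = \int[mu]_(x in D) f x.
Proof.
move=> fD; rewrite [RHS]Rintegral_mkcond; apply: eq_Rintegral => x _.
by rewrite patchE; case: ifPn => // /negP; rewrite inE => /fD.
Qed.

Lemma measurable_Rintegral_param d (T : measurableType d) (f : T * R -> R) :
  measurable_fun setT f -> (forall z, 0 <= f z) ->
  measurable_fun setT (fun x : T => \int[mu]_y f (x, y)).
Proof.
move=> mf f0.
have mF : measurable_fun setT (fubini_F mu (EFin \o f)).
  apply: measurable_fun_fubini_tonelli_F; first exact/measurable_EFinP.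
  by move=> z; rewrite lee_fin.
exact: (measurableT_comp (fine_measurable measurableT) mF).
Qed.

Lemma le_integral_norm_le (D : set R) (f : R -> R) (B : R) : measurable D ->
  measurable_fun D f -> (\int[mu]_(x in D) (`|f x|)%:E <= B%:E)%E ->
  `|\int[mu]_(x in D) f x| <= B.
Proof.
move=> mD mf fB.
have fi : mu.-integrable D (EFin \o f).
  apply/integrableP; split; first exact/measurable_EFinP.
  exact: le_lt_trans fB (ltry _).
by rewrite -lee_fin EFin_normr_Rintegral//; apply: le_trans fB;
  apply: le_abse_integral => //; exact/measurable_EFinP.
Qed.

End RintegralBounds.

(** * Nonnegative Picard iterates *)

Section Slice.
Variable R : realType.
Notation mu := (@lebesgue_measure R).
Variables (g1 g2 : R).
Implicit Types (h k : R -> R) (x z : R).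
Hypothesis (g1_gt0 : 0 < g1) (g2_lt0 : g2 < 0).

(** Bounds are asked on half-lines [x <= X] only, so [h] may grow without restriction at high
    frequencies. Together with the support condition they turn each convolution into the integral of
    a bounded function over a bounded interval. *)
Definition slice_adm (h : R -> R) :=
  [/\ measurable_fun setT h, forall x, 0 <= h x, forall x, x <= 1 -> h x = 0
    & forall X, exists B, forall x, x <= X -> h x <= B].

Definition abs_kernel (h : R -> R) (x z : R) := (`|x - z| * h (x - z)) * (`|z| * h z).
Definition sq_kernel (h : R -> R) (x z : R) := h (x - z) * (z ^+ 2 * h z).

Definition rnonlin (h : R -> R) (x : R) :=
  g1 * (\int[mu]_z abs_kernel h x z) - g2 * (\int[mu]_z sq_kernel h x z).

Lemma abs_kernel_ge0 h x z : (forall x, 0 <= h x) -> 0 <= abs_kernel h x z.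
Proof. by move=> h0; rewrite !mulr_ge0. Qed.

Lemma sq_kernel_ge0 h x z : (forall x, 0 <= h x) -> 0 <= sq_kernel h x z.
Proof. by move=> h0; apply: mulr_ge0 => //; apply: mulr_ge0 => //; exact: sqr_ge0. Qed.

(* Outside [1 < z < x - 1], one of the two frequencies is at most 1. *)
Lemma kernel_supp h x z : (forall x, x <= 1 -> h x = 0) ->
  ~ (1 < z < x - 1) -> h (x - z) = 0 \/ h z = 0.
Proof.
move=> h1 nz; have [z1|z1] := leP z 1; first by right; exact: h1.
by left; apply: h1; rewrite leNgt; apply/negP => zx; apply: nz; apply/andP; split; lra.
Qed.

Lemma abs_kernel_supp h x z : (forall x, x <= 1 -> h x = 0) ->
  ~ (1 < z < x - 1) -> abs_kernel h x z = 0.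
Proof. by move=> h1 /(kernel_supp h1)[] e; rewrite /abs_kernel e !(mulr0, mul0r). Qed.

Lemma sq_kernel_supp h x z : (forall x, x <= 1 -> h x = 0) ->
  ~ (1 < z < x - 1) -> sq_kernel h x z = 0.
Proof. by move=> h1 /(kernel_supp h1)[] e; rewrite /sq_kernel e !(mulr0, mul0r). Qed.

Lemma measurable_abs_kernel h x : measurable_fun setT h -> measurable_fun setT (abs_kernel h x).
Proof.
move=> mh; apply: measurable_funM; apply: measurable_funM => //.
- by apply: measurableT_comp => //; exact: measurable_reflect.
- exact: (measurableT_comp mh (measurable_reflect x)).
Qed.

Lemma measurable_sq_kernel h x : measurable_fun setT h -> measurable_fun setT (sq_kernel h x).
Proof.
move=> mh; apply: measurable_funM; last exact: measurable_funM.
exact: (measurableT_comp mh (measurable_reflect x)).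
Qed.

Lemma abs_kernel_le h x z P : 0 <= z <= x -> 0 <= h (x - z) * h z <= P ->
  abs_kernel h x z <= x ^+ 2 * P.
Proof.
move=> /andP[z0 zx] /andP[p0 pP].
rewrite /abs_kernel [leLHS](_ : _ = (`|x - z| * `|z|) * (h (x - z) * h z)); last by ring.
rewrite ler_pM// !ger0_norm//; try lra.
by rewrite expr2 ler_pM//; lra.
Qed.

Lemma sq_kernel_le h x z P : 0 <= z <= x -> 0 <= h (x - z) * h z <= P ->
  sq_kernel h x z <= x ^+ 2 * P.
Proof.
move=> /andP[z0 zx] /andP[p0 pP].
rewrite /sq_kernel [leLHS](_ : _ = z ^+ 2 * (h (x - z) * h z)); last by ring.
by rewrite ler_pM ?sqr_ge0// lerXn2r ?nnegrE//; lra.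
Qed.

Lemma slice_product_bound h x : slice_adm h ->
  exists P, forall z, 0 <= z <= x -> 0 <= h (x - z) * h z <= P.
Proof.
move=> [_ h0 _ /(_ x)[B hB]]; exists (B * B) => z zx.
by rewrite mulr_ge0//= ler_pM// hB//; lra.
Qed.

Lemma integrable_abs_kernel h x : slice_adm h ->
  mu.-integrable setT (EFin \o abs_kernel h x).
Proof.
move=> hadm; have [mh h0 h1 _] := hadm.
have [P hP] := slice_product_bound x hadm.
have -> : abs_kernel h x = (abs_kernel h x) \_ `[0, x].
  apply/funext => z; rewrite patchE; case: ifPn => // /negP.
  rewrite mem_setE in_itv/= => zx; apply: abs_kernel_supp => // H; apply: zx.
  by apply/andP; split; lra.
rewrite -restrict_EFin; apply/integrable_restrict => //; rewrite setTI.
apply: (@le_integrable_bounded _ _ _ (x ^+ 2 * P)) => //.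
- exact: lebesgue_measure_itvcc_lty.
- by apply: (measurable_funS measurableT) => //; exact: measurable_abs_kernel.
- move=> z /=; rewrite in_itv/= => zx.
  by rewrite ger0_norm ?abs_kernel_ge0// abs_kernel_le// hP.
Qed.

Lemma integrable_sq_kernel h x : slice_adm h ->
  mu.-integrable setT (EFin \o sq_kernel h x).
Proof.
move=> hadm; have [mh h0 h1 _] := hadm.
have [P hP] := slice_product_bound x hadm.
have -> : sq_kernel h x = (sq_kernel h x) \_ `[0, x].
  apply/funext => z; rewrite patchE; case: ifPn => // /negP.
  rewrite mem_setE in_itv/= => zx; apply: sq_kernel_supp => // H; apply: zx.
  by apply/andP; split; lra.
rewrite -restrict_EFin; apply/integrable_restrict => //; rewrite setTI.
apply: (@le_integrable_bounded _ _ _ (x ^+ 2 * P)) => //.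
- exact: lebesgue_measure_itvcc_lty.
- by apply: (measurable_funS measurableT) => //; exact: measurable_sq_kernel.
- move=> z /=; rewrite in_itv/= => zx.
  by rewrite ger0_norm ?sq_kernel_ge0// sq_kernel_le// hP.
Qed.

Lemma rnonlin_ge0 h x : (forall x, 0 <= h x) -> 0 <= rnonlin h x.
Proof.
move=> h0; rewrite /rnonlin -mulNr.
have A : 0 <= \int[mu]_z abs_kernel h x z by apply: Rintegral_ge0 => z _; exact: abs_kernel_ge0.
have B : 0 <= \int[mu]_z sq_kernel h x z by apply: Rintegral_ge0 => z _; exact: sq_kernel_ge0.
by apply: addr_ge0; apply: mulr_ge0 => //; rewrite ?oppr_ge0; apply: ltW.
Qed.

(** Two frequencies above 1 add up to more than 2. *)
Lemma rnonlin_eq0 h x : (forall x, x <= 1 -> h x = 0) -> x <= 2 -> rnonlin h x = 0.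
Proof.
move=> h1 x2; rewrite /rnonlin.
have nz z : ~ (1 < z < x - 1) by lra.
under eq_Rintegral do rewrite abs_kernel_supp//.
under [X in _ - _ * X]eq_Rintegral do rewrite sq_kernel_supp//.
by rewrite Rintegral_cst// mul0r !mulr0 subrr.
Qed.

(** Two of the three powers of [x] bound the multipliers; the third one is the length of the
    interval [[0, x]]. *)
Lemma rnonlin_le h x P : slice_adm h -> 0 <= x ->
  (forall z, 0 <= z <= x -> h (x - z) * h z <= P) ->
  rnonlin h x <= (g1 - g2) * (x ^+ 3 * P).
Proof.
move=> hadm x0 hP; have [mh h0 h1 _] := hadm.
have hP' z : 0 <= z <= x -> 0 <= h (x - z) * h z <= P by move=> ?; rewrite mulr_ge0//= hP.
have E : x ^+ 3 * P = x ^+ 2 * P * (x - 0) by ring.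
have supp z : ~ `[0, x]%classic z -> ~ (1 < z < x - 1).
  by move=> /=; rewrite in_itv/= => H K; apply: H; apply/andP; split; lra.
rewrite /rnonlin mulrBl; apply: lerB.
  rewrite ler_pM2l// E (@Rintegral_setT_supp _ `[0, x]); last first.
    by move=> z /supp; exact: abs_kernel_supp.
  apply: Rintegral_le_cst => //.
    by apply: (measurable_funS measurableT) => //; exact: measurable_abs_kernel.
  by move=> z zx; rewrite abs_kernel_ge0//= abs_kernel_le// hP'.
rewrite ler_nM2l// E (@Rintegral_setT_supp _ `[0, x]); last first.
  by move=> z /supp; exact: sq_kernel_supp.
apply: Rintegral_le_cst => //.
  by apply: (measurable_funS measurableT) => //; exact: measurable_sq_kernel.
by move=> z zx; rewrite sq_kernel_ge0//= sq_kernel_le// hP'.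
Qed.

(** Both convolutions obey the same lower bound and, as [g2 < 0 < g1], their contributions add up:
    hence the factor [g1 - g2]. *)
Lemma rnonlin_ge h x a b m c : slice_adm h -> a <= b -> 0 <= m -> 0 <= c ->
  (forall z, a <= z <= b -> [/\ m <= z, m <= x - z, c <= h z & c <= h (x - z)]) ->
  (g1 - g2) * (m ^+ 2 * c ^+ 2 * (b - a)) <= rnonlin h x.
Proof.
move=> hadm ab m0 c0 hm; have [mh h0 h1 _] := hadm.
have mc0 : 0 <= m ^+ 2 * c ^+ 2 by rewrite mulr_ge0 ?sqr_ge0.
rewrite /rnonlin mulrBl; apply: lerB.
  rewrite ler_pM2l//; apply: Rintegral_ge_cst => //.
  - exact: integrable_abs_kernel.
  - by move=> z _; exact: abs_kernel_ge0.
  - move=> z /hm[mz mxz cz cxz].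
    rewrite /abs_kernel [leRHS](_ : _ = (`|x - z| * `|z|) * (h (x - z) * h z)); last by ring.
    by rewrite !ger0_norm; [rewrite !expr2 ler_pM ?mulr_ge0// ler_pM|lra|lra].
rewrite ler_nM2l//; apply: Rintegral_ge_cst => //.
- exact: integrable_sq_kernel.
- by move=> z _; exact: sq_kernel_ge0.
- move=> z /hm[mz mxz cz cxz].
  rewrite /sq_kernel [leRHS](_ : _ = z ^+ 2 * (h (x - z) * h z)); last by ring.
  by rewrite !expr2 ler_pM ?mulr_ge0// ler_pM.
Qed.

Lemma eq_rnonlin h k x y : (forall x, x <= 1 -> h x = 0) -> (forall x, x <= 1 -> k x = 0) ->
  (forall z, z <= y -> h z = k z) -> x <= y + 1 -> rnonlin h x = rnonlin k x.
Proof.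
move=> h1 k1 hk xy; rewrite /rnonlin; congr (_ * _ - _ * _); apply: eq_Rintegral => z _.
  have [/andP[z1 zx]|nz] := boolP (1 < z < x - 1).
    by rewrite /abs_kernel !hk//; lra.
  by rewrite !abs_kernel_supp//; exact/negP.
have [/andP[z1 zx]|nz] := boolP (1 < z < x - 1).
  by rewrite /sq_kernel !hk//; lra.
by rewrite !sq_kernel_supp//; exact/negP.
Qed.

(** The frequency may depend on the parameter, so that the Duhamel integrand is covered jointly in
    both times and the frequency. *)
Lemma measurable_rnonlin d (T : measurableType d) (f : T -> R -> R) (x : T -> R) :
  measurable_fun setT (fun z : T * R => f z.1 z.2) ->
  (forall t x, 0 <= f t x) -> measurable_fun setT x ->
  measurable_fun setT (fun t => rnonlin (f t) (x t)).
Proof.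
move=> mf f0 mx.
have mx1 : measurable_fun setT (fun z : T * R => x z.1).
  exact: (measurableT_comp mx measurable_fst).
have mxz : measurable_fun setT (fun z : T * R => x z.1 - z.2).
  by apply: measurable_funB => //; exact: measurable_snd.
have mfxz : measurable_fun setT (fun z : T * R => f z.1 (x z.1 - z.2)).
  apply: (measurableT_comp mf (measurable_fun_pair _ mxz)); exact: measurable_fst.
have msnd : measurable_fun setT (fun z : T * R => z.2) by exact: measurable_snd.
apply: measurable_funB; apply: measurable_funM => //.
- apply: (@measurable_Rintegral_param _ _ _ (fun z : T * R => abs_kernel (f z.1) (x z.1) z.2)).
    apply: measurable_funM; apply: measurable_funM => //; exact: measurableT_comp.
  by move=> z; exact: abs_kernel_ge0.
- apply: (@measurable_Rintegral_param _ _ _ (fun z : T * R => sq_kernel (f z.1) (x z.1) z.2)).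
    by apply: measurable_funM => //; apply: measurable_funM => //; exact: measurable_funX.
  by move=> z; exact: sq_kernel_ge0.
Qed.

End Slice.

(** * The Duhamel map on nonnegative functions *)

Section Iterates.
Variable R : realType.
Notation mu := (@lebesgue_measure R).
Variables (alpha g1 g2 eta : R) (d : R -> R).
Hypothesis (alpha_ge0 : 0 <= alpha) (g1_gt0 : 0 < g1) (g2_lt0 : g2 < 0).
Hypothesis (md : measurable_fun setT d) (d_ge0 : forall x, 0 <= d x)
  (d_le : forall x, d x <= eta) (d_eq0 : forall x, x <= 1 -> d x = 0).
Implicit Types (f : R -> R -> R) (t x tau : R).

Notation N := (rnonlin g1 g2).
Notation phi := (symb alpha).

Lemma symb_ge0 x : 1 <= x -> 0 <= phi x.
Proof.
move=> x1; rewrite /symb addrAC.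
have x0 : 0 <= x by lra.
have a : 0 <= alpha * `|x| ^+ 3 by rewrite mulr_ge0// exprn_ge0.
suff : 0 <= - x ^+ 2 + x ^+ 4 by lra.
rewrite [_ + _](_ : _ = x ^+ 2 * (x - 1) * (x + 1)); last by ring.
by rewrite !mulr_ge0 ?sqr_ge0//; lra.
Qed.

Lemma measurable_symb : measurable_fun setT phi.
Proof.
apply: measurable_funD; last exact: measurable_funX.
apply: measurable_funD; first by apply: measurable_funN; exact: measurable_funX.
by apply: measurable_funM => //; apply: measurable_funX; exact: normr_measurable.
Qed.

(** At a negative time the interval of integration in [rduhamel] is empty and only the heat term
    remains. Measurability, sign and support persist there, whereas the bound is asked for
    [0 <= t <= T] only. *)
Definition adm f :=
  [/\ measurable_fun setT (fun z : R * R => f z.1 z.2),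
      forall t x, 0 <= f t x, forall t x, x <= 1 -> f t x = 0
    & forall T X : R, exists B, forall t x, 0 <= t <= T -> x <= X -> f t x <= B].

Definition rintegrand f t x tau := expR (- ((t - tau) * phi x)) * N (f tau) x.

Definition rduhamel f t x :=
  expR (- (t * phi x)) * d x + \int[mu]_(tau in `[0, t]) rintegrand f t x tau.

Lemma adm_slice f t : adm f -> 0 <= t -> slice_adm (f t).
Proof.
move=> [mf f0 f1 fB] t0; split => //.
- by apply: (measurable_fun_pair2 _ mf).
- by move=> x; exact: f1.
- by move=> X; have [B hB] := fB t X; exists B => x; apply: hB; rewrite t0 lexx.
Qed.

Lemma rnonlin_adm_le f T X : adm f ->
  exists2 B, 0 <= B & forall t x, 0 <= t <= T -> x <= X -> N (f t) x <= B.
Proof.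
move=> af; have [_ f0 f1 /(_ T X)[B hB]] := af.
have G0 : 0 <= g1 - g2 by rewrite subr_ge0 ltW// (lt_trans g2_lt0).
have C0 : 0 <= (g1 - g2) * (`|X| ^+ 3 * B ^+ 2).
  by apply: mulr_ge0 => //; apply: mulr_ge0; [exact: exprn_ge0|exact: sqr_ge0].
exists ((g1 - g2) * (`|X| ^+ 3 * B ^+ 2)) => //.
move=> t x tT xX; have [x0|x0] := leP 0 x; last first.
  by rewrite rnonlin_eq0//; [exact: f1|lra].
apply: (@le_trans _ _ ((g1 - g2) * (x ^+ 3 * B ^+ 2))).
  apply: rnonlin_le => //; first by apply: adm_slice => //; case/andP: tT.
  by move=> z zx; rewrite expr2 ler_pM// hB//; lra.
rewrite ler_wpM2l// ler_wpM2r ?sqr_ge0// lerXn2r ?nnegrE//.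
by rewrite (le_trans xX)// ler_norm.
Qed.

Lemma rintegrand_ge0 f t x tau : (forall t x, 0 <= f t x) -> 0 <= rintegrand f t x tau.
Proof. by move=> f0; rewrite mulr_ge0 ?expR_ge0// rnonlin_ge0. Qed.

Lemma rintegrand_eq0 f t x tau : (forall t x, x <= 1 -> f t x = 0) -> x <= 2 ->
  rintegrand f t x tau = 0.
Proof. by move=> f1 x2; rewrite /rintegrand rnonlin_eq0 ?mulr0// => ?; exact: f1. Qed.

Lemma expRN_symb_le1 t x : 0 <= t -> 1 <= x -> expR (- (t * phi x)) <= 1.
Proof. by move=> t0 x1; rewrite -expR0 ler_expR oppr_le0 mulr_ge0 ?symb_ge0. Qed.

Lemma rintegrand_le f t x tau : adm f -> tau <= t -> rintegrand f t x tau <= N (f tau) x.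
Proof.
move=> af tt; have [_ f0 f1 _] := af.
(* The symbol can be negative at frequencies below 1, but the nonlinearity vanishes up to frequency
   2. *)
have [x2|x2] := leP x 2; first by rewrite rintegrand_eq0// rnonlin_ge0.
by rewrite ler_piMl ?rnonlin_ge0// expRN_symb_le1//; lra.
Qed.

Lemma measurable_rintegrand_joint f : adm f ->
  measurable_fun setT (fun z : (R * R) * R => rintegrand f z.1.1 z.1.2 z.2).
Proof.
move=> [mf f0 f1 _].
have m1 : measurable_fun setT (fun z : (R * R) * R => z.1.1).
  exact: (measurableT_comp measurable_fst measurable_fst).
have m2 : measurable_fun setT (fun z : (R * R) * R => z.1.2).
  exact: (measurableT_comp measurable_snd measurable_fst).
have m3 : measurable_fun setT (fun z : (R * R) * R => z.2) by exact: measurable_snd.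
apply: measurable_funM.
  apply: measurableT_comp; first exact: measurable_expR.
  apply: measurable_funN; apply: measurable_funM; first exact: measurable_funB.
  exact: (measurableT_comp measurable_symb m2).
apply: (@measurable_rnonlin _ _ _ _ _ (fun z => f z.2) (fun z => z.1.2)) => //.
apply: (measurableT_comp mf (measurable_fun_pair _ _)).
  exact: (measurableT_comp m3 measurable_fst).
exact: measurable_snd.
Qed.

Lemma measurable_rintegrand f t x : adm f -> measurable_fun setT (rintegrand f t x).
Proof.
move=> af; have := measurable_fun_pair2 (t, x) (measurable_rintegrand_joint af).
exact.
Qed.

Lemma integrable_rintegrand f t x a b : adm f -> 0 <= a -> b <= t ->
  mu.-integrable `[a, b] (EFin \o rintegrand f t x).
Proof.
move=> af a0 bt; have [_ f0 _ _] := af.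
have [B _ hB] := rnonlin_adm_le t x af.
apply: (@le_integrable_bounded _ _ _ B) => //.
- exact: lebesgue_measure_itvcc_lty.
- by apply: (measurable_funS measurableT) => //; exact: measurable_rintegrand.
- move=> tau /=; rewrite in_itv/= => tt; rewrite ger0_norm ?rintegrand_ge0//.
  by apply: le_trans (rintegrand_le _ af _) (hB _ _ _ _); lra.
Qed.

Lemma rduhamel_ge0 f t x : (forall t x, 0 <= f t x) -> 0 <= rduhamel f t x.
Proof.
move=> f0; rewrite addr_ge0 ?mulr_ge0 ?expR_ge0//.
by apply: Rintegral_ge0 => tau _; exact: rintegrand_ge0.
Qed.

Lemma rduhamel_eq0 f t x : (forall t x, x <= 1 -> f t x = 0) -> x <= 1 -> rduhamel f t x = 0.
Proof.
move=> f1 x1; rewrite /rduhamel d_eq0// mulr0 add0r.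
have x2 : x <= 2 by lra.
under eq_Rintegral do rewrite rintegrand_eq0//.
by rewrite (Rintegral_cst mu)// mul0r.
Qed.

Lemma rduhamel_le f t x B : adm f -> 0 <= t ->
  (forall tau, 0 <= tau <= t -> N (f tau) x <= B) -> rduhamel f t x <= d x + B * t.
Proof.
move=> af t0 hB; have [_ f0 f1 _] := af.
have B0 : 0 <= B by apply: le_trans (hB 0 _); rewrite ?rnonlin_ge0 ?lexx.
have [x1|x1] := leP x 1.
  by rewrite rduhamel_eq0// addr_ge0 ?mulr_ge0.
rewrite /rduhamel lerD//.
  by rewrite ler_piMl// expRN_symb_le1// ltW.
rewrite -[X in _ * X]subr0; apply: Rintegral_le_cst => //.
  by apply: (measurable_funS measurableT) => //; exact: measurable_rintegrand.
move=> tau tt; rewrite rintegrand_ge0//=.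
by apply: le_trans (rintegrand_le _ af _) (hB _ _); lra.
Qed.

Lemma measurable_rduhamel f : adm f -> measurable_fun setT (fun z : R * R => rduhamel f z.1 z.2).
Proof.
move=> af; have [_ f0 _ _] := af.
apply: measurable_funD.
  apply: measurable_funM; last exact: (measurableT_comp md measurable_snd).
  apply: measurableT_comp; first exact: measurable_expR.
  apply: measurable_funN; apply: measurable_funM; first exact: measurable_fst.
  exact: (measurableT_comp measurable_symb measurable_snd).
(* The interval of integration depends on the parameter. It is absorbed into the integrand as a
   restriction to [S], so that Tonelli applies on a fixed domain. *)
pose S := [set z : (R * R) * R | 0 <= z.2 <= z.1.1].
have mS : measurable S.
  rewrite (_ : S = [set z | 0 <= z.2] `&` [set z | z.2 <= z.1.1]); last first.
    by apply/seteqP; split => z; rewrite /S/=; [by move/andP|by move=> [-> ->]].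
  apply: measurableI.
    rewrite -[X in measurable X]setTI; apply: measurable_fun_le => //; exact: measurable_snd.
  have m11 : measurable_fun setT (fun z : (R * R) * R => z.1.1).
    exact: (measurableT_comp measurable_fst measurable_fst).
  have m2 : measurable_fun setT (fun z : (R * R) * R => z.2) by exact: measurable_snd.
  by rewrite -[X in measurable X]setTI; exact: measurable_fun_le m2 m11.
rewrite (_ : (fun z => _) = fun z => \int[mu]_tau
    ((fun w : (R * R) * R => rintegrand f w.1.1 w.1.2 w.2) \_ S) (z, tau)).
  apply: measurable_Rintegral_param.
    have mr : measurable_fun S (fun w : (R * R) * R => rintegrand f w.1.1 w.1.2 w.2).
      exact: measurable_funTS (measurable_rintegrand_joint af).
    exact: (measurable_restrictT _ mS).1 mr.
  by move=> z; rewrite patchE; case: ifP => // _; exact: rintegrand_ge0.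
apply/funext => z; rewrite Rintegral_mkcond; apply: eq_Rintegral => tau _.
rewrite !patchE mem_setE in_itv/=; congr (if _ then _ else _).
by apply/idP/idP => h; [rewrite inE|rewrite inE in h].
Qed.

Lemma adm_rduhamel f : adm f -> adm (rduhamel f).
Proof.
move=> af; have [mf f0 f1 fB] := af; split.
- exact: measurable_rduhamel.
- by move=> t x; exact: rduhamel_ge0.
- by move=> t x; exact: rduhamel_eq0.
- move=> T X; have [B B0 hB] := rnonlin_adm_le T X af.
  exists (eta + B * T) => t x /andP[t0 tT] xX.
  apply: (@le_trans _ _ (d x + B * t)).
    by apply: rduhamel_le => // tau tt; apply: hB => //; lra.
  by rewrite lerD// ler_wpM2l.
Qed.

Lemma eq_rduhamel f h t x y : (forall t x, x <= 1 -> f t x = 0) ->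
  (forall t x, x <= 1 -> h t x = 0) -> (forall t z, z <= y -> f t z = h t z) ->
  x <= y + 1 -> rduhamel f t x = rduhamel h t x.
Proof.
move=> f1 h1 fh xy; rewrite /rduhamel; congr (_ + _); apply: eq_Rintegral => tau _.
rewrite /rintegrand; congr (_ * _); apply: (@eq_rnonlin _ _ _ _ _ _ y) => //.
- exact: f1.
- exact: h1.
- by move=> z; exact: fh.
Qed.

Definition rpicard n : R -> R -> R := iter n rduhamel (fun _ _ => 0).

Lemma rpicardS n : rpicard n.+1 = rduhamel (rpicard n).
Proof. by []. Qed.

Lemma adm_rpicard n : adm (rpicard n).
Proof.
elim: n => [|n IH]; last by rewrite rpicardS; exact: adm_rduhamel.
by split => //= T X; exists 0.
Qed.

Lemma rpicard_stable n m t x : x <= n%:R -> (n <= m)%N -> rpicard m t x = rpicard n t x.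
Proof.
elim: n m t x => [|n IH] m t x xn nm.
  have [_ _ h _] := adm_rpicard m; have [_ _ h' _] := adm_rpicard 0.
  by rewrite h ?h'//; apply: le_trans xn _.
case: m nm => [//|m] nm; rewrite !rpicardS.
have [_ _ h _] := adm_rpicard m; have [_ _ h' _] := adm_rpicard n.
apply: (@eq_rduhamel (rpicard m) (rpicard n) t x n%:R h h'); last by rewrite natr1.
by move=> t' z zn; exact: IH.
Qed.

Lemma le_archi_bound x : x <= (Num.bound x)%:R.
Proof. by have [x0|/ltW x0] := leP 0 x; [exact/ltW/archi_boundP|exact: le_trans x0 _]. Qed.

(* At frequency [x] the iterates are stationary from any step [n >= x] on. *)
Definition rsol t x := rpicard (Num.bound x) t x.

Lemma rsolE n t x : x <= n%:R -> rsol t x = rpicard n t x.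
Proof.
move=> xn; rewrite /rsol.
have xb : x <= (Num.bound x)%:R by exact: le_archi_bound.
have [nb|bn] := leqP n (Num.bound x); first exact: rpicard_stable.
by apply/esym/rpicard_stable => //; exact: ltnW.
Qed.

Lemma adm_rsol : adm rsol.
Proof.
split.
- apply: (@measurable_fun_cvg _ _ _ _ (fun n (z : R * R) => rpicard n z.1 z.2)) => //.
    by move=> n; have [] := adm_rpicard n.
  move=> [t x] _ /=; apply: cvg_near_cst; exists (Num.bound x) => // n /= bn.
  have xb : x <= (Num.bound x)%:R by exact: le_archi_bound.
  by rewrite (@rsolE n)//; apply: le_trans xb _; rewrite ler_nat.
- by move=> t x; rewrite /rsol; have [_ ->] := adm_rpicard (Num.bound x).
- by move=> t x x1; rewrite /rsol; have [_ _ ->] := adm_rpicard (Num.bound x).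
(* On the half-line [x <= X] the limit is one single iterate and inherits its bound. *)
- move=> T X; have [_ _ _ /(_ T X)[B hB]] := adm_rpicard (Num.bound X).
  have xb : X <= (Num.bound X)%:R by exact: le_archi_bound.
  by exists B => t x tT xX; rewrite (@rsolE (Num.bound X)) ?hB//; exact: le_trans xb.
Qed.

(** Stationarity makes this exact: at frequency [x] the Duhamel map sees the limit only where it
    equals an iterate, so no integral has to pass to a limit. *)
Lemma rsol_fixpoint t x : rsol t x = rduhamel rsol t x.
Proof.
have xb : x <= (Num.bound x)%:R by exact: le_archi_bound.
rewrite (@rsolE (Num.bound x).+1); last by rewrite (le_trans xb)// ler_nat.
have [_ _ h _] := adm_rpicard (Num.bound x); have [_ _ h' _] := adm_rsol.
rewrite rpicardS; apply: (@eq_rduhamel (rpicard (Num.bound x)) rsol t x (Num.bound x)%:R h h').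
  by move=> t' z zn; rewrite (rsolE _ zn).
by rewrite (le_trans xb)// lerDl.
Qed.

End Iterates.

(** * Exponential decay for a short time *)

Section HeatIntegral.
Variable R : realType.
Notation mu := (@lebesgue_measure R).
Implicit Types (t p x : R).

Lemma measurable_heat t p : measurable_fun setT (fun tau : R => expR (- ((t - tau) * p))).
Proof.
apply: measurableT_comp; first exact: measurable_expR.
apply: measurable_funN; apply: measurable_funM => //; exact: measurable_reflect.
Qed.

(** The power 3/4 is dictated by the nonlinearity: for [p] of order x^4, the factor p^(-3/4) cancels
    x^3 exactly, and t^(1/4) remains to be made small. *)
Lemma heat_integral_le t p : 0 < t -> 0 < p ->
  \int[mu]_(tau in `[0, t]) expR (- ((t - tau) * p)) <= 4 * t `^ (1 / 4) * p `^ (- (3 / 4)).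
Proof.
move=> t0 p0.
have H : (\int[mu]_(tau in `[0%R, t]) (expR (- ((t - tau) * p)))%:E <=
    (4 * t `^ (1 / 4) * p `^ (- (3 / 4)))%:E)%E.
  rewrite integral_itv_bndoo; last first.
    by apply/measurable_EFinP; apply: measurable_funTS; exact: measurable_heat.
  have a1 : 3 / 4 < 1 :> R by lra.
  apply: (@le_trans _ _ (\int[mu]_(tau in `]0%R, t[)
      ((p `^ (- (3 / 4)))%:E * ((t - tau) `^ (- (3 / 4)))%:E))%E).
    apply: ge0_le_integral => //=.
    - by apply/measurable_EFinP; apply: measurable_funTS; exact: measurable_heat.
    - apply/measurable_EFinP; apply: measurable_funM => //; apply: measurable_funTS.
      by apply: (measurableT_comp (measurable_powR _)); exact: measurable_reflect.
    - move=> tau; rewrite in_itv/= => /andP[t1 t2]; rewrite lee_fin.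
      rewrite -powRM; [|lra|lra]; rewrite [in leRHS]mulrC.
      by apply: expRN_le_powR; [apply/andP; split; lra|rewrite mulr_gt0//; lra].
  rewrite ge0_integralZl_EFin ?powR_ge0//=; first last.
  - apply/measurable_EFinP; apply: measurable_funTS.
    by apply: (measurableT_comp (measurable_powR _)); exact: measurable_reflect.
  - by move=> tau _; rewrite lee_fin powR_ge0.
  apply: (@le_trans _ _ ((p `^ (- (3 / 4)))%:E * ((t - 0) `^ (1 - 3 / 4) / (1 - 3 / 4))%:E)%E).
    by apply: lee_wpmul2l; [rewrite lee_fin powR_ge0|exact: integral_powR_right_le].
  rewrite -EFinM lee_fin subr0 [X in t `^ X](_ : _ = 1 / 4); last by lra.
  by rewrite le_eqVlt; apply/orP; left; apply/eqP; field.
rewrite -lee_fin /Rintegral fineK//.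
rewrite ge0_fin_numE; first exact: le_lt_trans H (ltry _).
by apply: integral_ge0 => tau _; rewrite lee_fin expR_ge0.
Qed.

End HeatIntegral.

Section Decay.
Variable R : realType.
Notation mu := (@lebesgue_measure R).
Variables (alpha g1 g2 eta : R) (d : R -> R).
Hypothesis (alpha_ge0 : 0 <= alpha) (g1_gt0 : 0 < g1) (g2_lt0 : g2 < 0).
Hypothesis (md : measurable_fun setT d) (d_ge0 : forall x, 0 <= d x)
  (d_le : forall x, d x <= eta) (d_eq0 : forall x, x <= 1 -> d x = 0)
  (d_eq0' : forall x, 2 <= x -> d x = 0).
Implicit Types (f : R -> R -> R) (t x tau : R).

Notation N := (rnonlin g1 g2).
Notation phi := (symb alpha).
Notation sol := (rsol alpha g1 g2 d).
Notation duh := (rduhamel alpha g1 g2 d).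
Notation integrand := (rintegrand alpha g1 g2).

(* [decay_amp] is twice what the datum requires, and [decay_time] makes the
   Duhamel term at most half of the bound. *)
Definition decay_amp := 2 * (eta + 1) * expR 2.
Definition decay_rate := (1 + 16 * (g1 - g2) * decay_amp)^-1.
Definition decay_time := decay_rate ^+ 4.

Local Notation Gam := (g1 - g2).
Local Notation A := decay_amp.
Local Notation r := decay_rate.

Lemma coupling_gt0 : 0 < Gam. Proof. by rewrite subr_gt0 (lt_trans g2_lt0). Qed.
Lemma datum_sup_ge0 : 0 <= eta. Proof. exact: le_trans (d_ge0 0) (d_le 0). Qed.
Lemma decay_amp_gt0 : 0 < A. Proof. by rewrite /decay_amp !mulr_gt0 ?expR_gt0// ltr_wpDl// datum_sup_ge0. Qed.
Lemma decay_rate_gt0 : 0 < r. Proof.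
have a0 := decay_amp_gt0; have G0 := coupling_gt0.
by rewrite invr_gt0 ltr_wpDr// ltW// mulr_gt0// mulr_gt0.
Qed.

Lemma decay_time_gt0 : 0 < decay_time. Proof. by rewrite exprn_gt0// decay_rate_gt0. Qed.

Lemma decay_time_le1 : decay_time <= 1.
Proof.
have a0 := decay_amp_gt0; have G0 := coupling_gt0; have r0 := decay_rate_gt0.
have D1 : 1 <= 1 + 16 * Gam * A by rewrite lerDl ltW// mulr_gt0// mulr_gt0.
apply: exprn_ile1; first exact: ltW.
by rewrite invf_le1// (lt_le_trans ltr01).
Qed.

Lemma symb_ge x : 2 <= x -> x ^+ 4 / 2 <= phi x.
Proof.
move=> x2; have x0 : 0 <= x by lra.
have a : 0 <= alpha * `|x| ^+ 3 by rewrite mulr_ge0// exprn_ge0.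
have : 0 <= x ^+ 2 * (x ^+ 2 - 2).
  have h : 0 <= (x - 2) * (x + 2) by rewrite mulr_ge0//; lra.
  by apply: mulr_ge0; [exact: sqr_ge0|rewrite [leRHS](_ : _ = (x - 2) * (x + 2) + 2); [lra|ring]].
rewrite /symb; have -> : x ^+ 4 = x ^+ 2 * x ^+ 2 by ring.
lra.
Qed.

Lemma cube_powR_symb_le x : 2 <= x -> x ^+ 3 * phi x `^ (- (3 / 4)) <= 2.
Proof.
move=> x2; have x0 : 0 < x by lra.
have h := symb_ge x2.
have x40 : 0 < x ^+ 4 / 2 by rewrite divr_gt0 ?exprn_gt0.
have p0 : 0 < phi x by exact: lt_le_trans h.
rewrite powRN ler_pdivrMr ?powR_gt0//.
apply: (@le_trans _ _ (2 * (x ^+ 4 / 2) `^ (3 / 4))); last first.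
  rewrite ler_pM2l//; by apply: ge0_ler_powR; rewrite ?nnegrE ?(ltW x40) ?(ltW p0).
rewrite powRM ?exprn_ge0 ?invr_ge0 ?(ltW x0)//.
have -> : (x ^+ 4) `^ (3 / 4) = x ^+ 3.
  rewrite -(powR_mulrn 4 (ltW x0)) -powRrM -(powR_mulrn 3 (ltW x0)); congr (_ `^ _); lra.
rewrite mulrCA ler_peMr ?exprn_ge0 ?(ltW x0)//.
have : 2^-1 <= 2^-1 `^ (3 / 4) :> R by apply: ger1_powR; [apply/andP; split; lra|lra].
lra.
Qed.

Definition decaying f := forall t x, 0 <= t <= decay_time -> f t x <= A * expR (- x).

(** The exponential weight is multiplicative: [expR (- (x - z)) * expR (- z)] does not depend on
    [z], so convolution reproduces it. *)
Lemma rnonlin_decay f t x : adm f -> decaying f -> 0 <= t <= decay_time -> 0 <= x ->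
  N (f t) x <= Gam * (x ^+ 3 * (A ^+ 2 * expR (- x))).
Proof.
move=> af fd tT x0; have [_ f0 _ _] := af.
apply: rnonlin_le => //; first by apply: adm_slice => //; case/andP: tT.
move=> z _; apply: (@le_trans _ _ ((A * expR (- (x - z))) * (A * expR (- z)))).
  by rewrite ler_pM// fd.
rewrite (_ : - x = - (x - z) + - z); last by ring.
by rewrite expRD le_eqVlt; apply/orP; left; apply/eqP; ring.
Qed.

Lemma decaying_rduhamel f : adm f -> decaying f -> decaying (duh f).
Proof.
move=> af fd t x tT; have [_ f0 f1 _] := af; have /andP[t0 tT'] := tT.
have E0 := expR_gt0 (- x); have A_gt0 := decay_amp_gt0; have G_gt0 := coupling_gt0.
have r_gt0 := decay_rate_gt0; have e_ge0 := datum_sup_ge0.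
have [x1|x1] := leP x 1; first by rewrite rduhamel_eq0// mulr_ge0 ?ltW.
have AE : A * expR (- x) = A * expR (- x) / 2 + A * expR (- x) / 2 by lra.
rewrite AE /rduhamel lerD//.
  apply: (@le_trans _ _ (d x)); first by rewrite ler_piMl// expRN_symb_le1// ltW.
  have [x2|x2] := leP 2 x; first by rewrite d_eq0'// divr_ge0// mulr_ge0 ?ltW.
  (* The factor [expR 2] of the amplitude compensates the weight up to frequency 2, where the
     support of the datum ends. *)
  have -> : A * expR (- x) / 2 = (eta + 1) * expR (2 - x) by rewrite expRD /A; field.
  apply: (le_trans (d_le x)); apply: (@le_trans _ _ ((eta + 1) * 1)); first lra.
  by rewrite ler_wpM2l ?addr_ge0//; have := expR_ge1Dx (2 - x); lra.
have [x2|x2] := leP x 2.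
  under eq_Rintegral do rewrite rintegrand_eq0//.
  by rewrite (Rintegral_cst mu)// mul0r divr_ge0// mulr_ge0 ?ltW.
move: t0; rewrite le_eqVlt => /predU1P[<-|t0].
  by rewrite set_itv1 Rintegral_set1 divr_ge0// mulr_ge0 ?ltW.
have x0 : 0 < x by lra.
pose M := Gam * (x ^+ 3 * (A ^+ 2 * expR (- x))).
have M0 : 0 <= M.
  apply: mulr_ge0; first exact: ltW.
  apply: mulr_ge0; first by rewrite exprn_ge0// ltW.
  by apply: mulr_ge0; [exact: sqr_ge0|exact: ltW].
have p0 : 0 < phi x by apply: lt_le_trans (symb_ge (ltW x2)); rewrite divr_gt0 ?exprn_gt0.
have ih : mu.-integrable `[0, t] (EFin \o (fun tau => expR (- ((t - tau) * phi x)))).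
  apply: (@le_integrable_bounded _ _ _ 1) => //.
  - exact: lebesgue_measure_itvcc_lty.
  - by apply: measurable_funTS; exact: measurable_heat.
  - move=> tau /=; rewrite in_itv/= => tt; rewrite ger0_norm ?expR_ge0//.
    by rewrite expRN_symb_le1//; lra.
apply: (@le_trans _ _ (\int[mu]_(tau in `[0, t]) (M * expR (- ((t - tau) * phi x))))).
  apply: le_Rintegral => //.
  - exact: integrable_rintegrand.
  - under [X in mu.-integrable _ X]eq_fun do rewrite /= EFinM.
    exact: integrableZl.
  - move=> tau /=; rewrite in_itv/= => tt; rewrite /rintegrand mulrC; apply: ler_wpM2r.
      exact: expR_ge0.
    by apply: rnonlin_decay => //; lra.
rewrite RintegralZl//.
apply: (le_trans (ler_wpM2l M0 (heat_integral_le t0 p0))).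
(* Time enters through its fourth root, which is why [decay_time] is a fourth power. *)
have tr : t `^ (1 / 4) <= r.
  apply: (@le_trans _ _ (decay_time `^ (1 / 4))).
    by rewrite ge0_ler_powR ?nnegrE ?(ltW t0) ?(ltW decay_time_gt0).
  rewrite /decay_time -(powR_mulrn 4 (ltW r_gt0)) -powRrM [X in _ `^ X](_ : _ = 1); last lra.
  by rewrite powRr1// ltW.
have c2 := cube_powR_symb_le (ltW x2).
have rA : r * (16 * Gam * A) <= 1.
  rewrite /r mulrC ler_pdivrMr ?mul1r; first lra.
  by rewrite -invr_gt0.
have -> : M * (4 * t `^ (1 / 4) * phi x `^ (- (3 / 4))) =
   (t `^ (1 / 4) * (x ^+ 3 * phi x `^ (- (3 / 4)))) * (4 * Gam * A) * (A * expR (- x)).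
  by rewrite /M; ring.
rewrite [leRHS]mulrC; apply: ler_wpM2r; first by rewrite mulr_ge0 ?ltW.
(* The bound is [8 * r * Gam * A]; the 16 in [decay_rate] makes it at most 1/2. *)
apply: (@le_trans _ _ (r * 2 * (4 * Gam * A))); last lra.
apply: ler_wpM2r; first by apply: mulr_ge0; [apply: mulr_ge0 => //|]; exact: ltW.
by apply: ler_pM => //; [exact: powR_ge0|rewrite mulr_ge0 ?powR_ge0 ?exprn_ge0 ?ltW].
Qed.

Lemma decaying_rsol : decaying sol.
Proof.
move=> t x; rewrite /rsol; move: (Num.bound x) => n; elim: n t x => [|n IH] t x tT.
  by rewrite /= mulr_ge0 ?expR_ge0// ltW// decay_amp_gt0.
by rewrite rpicardS; apply: decaying_rduhamel => //; exact: adm_rpicard.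
Qed.

Definition lipschitz_cst := (1 + alpha) * A + Gam * A ^+ 2.

(** Duhamel's formula is restarted at time [t]. The increment is the nonlinear contribution of
    [[t, t']] minus the damped part [(1 - e) * f t x], and both are of first order in [t' - t]. The
    losses, cubic from the nonlinearity and quartic from the symbol, are covered by [(1 + x) ^+ 4]
    and remain small against the exponential; this yields continuity in time with values in any
    H^s. *)
Lemma decaying_lipschitz f t t' x : adm f -> decaying f ->
  (forall t x, f t x = duh f t x) -> 0 <= t -> t <= t' -> t' <= decay_time -> 1 <= x ->
  `|f t' x - f t x| <= (t' - t) * (lipschitz_cst * ((1 + x) ^+ 4 * expR (- x))).
Proof.
move=> af fd ff t0 tt' t'T x1; have x0 : 0 <= x by lra.
have A_gt0 := decay_amp_gt0; have G_gt0 := coupling_gt0.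
have [_ f0 f1 _] := af.
have t'0 : 0 <= t' by lra.
have p0 : 0 <= phi x by exact: symb_ge0.
pose e := expR (- ((t' - t) * phi x)).
have E : f t' x = e * f t x + \int[mu]_(tau in `[t, t']) integrand f t' x tau.
  rewrite !ff /rduhamel.
  rewrite [e * (_ + _)]mulrDr [e * (expR _ * _)]mulrA /e -expRD.
  rewrite [- _ - t * phi x](_ : _ = - (t' * phi x)); last by ring.
  rewrite -addrA; congr (_ + _).
  have i1 : mu.-integrable `[0, t'] (EFin \o integrand f t' x).
    exact: integrable_rintegrand.
  have := @Rintegral_itvB _ (integrand f t' x) (BLeft 0) (BRight t') t i1.
  rewrite !bnd_simp => /(_ t0 tt').
  rewrite (Rintegral_itv_obnd_cbnd (r := t)); last first.
    apply: integrableS i1 => //; apply: subset_itvScc => //; by rewrite bnd_simp.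
  move=> <-; rewrite [RHS]addrC.
  rewrite -RintegralZl//; last exact: integrable_rintegrand.
  rewrite [X in _ = _ - _ + X](_ : _ = \int[mu]_(tau in `[0, t]) integrand f t' x tau).
    by rewrite subrK.
  apply: eq_Rintegral => tau _; rewrite /rintegrand mulrA -expRD; congr (expR _ * _); ring.
pose I := \int[mu]_(tau in `[t, t']) integrand f t' x tau.
pose E1 := (1 + x) ^+ 4 * expR (- x).
have x4 (k : nat) : (k <= 4)%N -> x ^+ k <= (1 + x) ^+ 4.
  move=> k4; apply: (@le_trans _ _ ((1 + x) ^+ k)).
    by rewrite lerXn2r ?nnegrE//; lra.
  by apply: ler_weXn2l => //; lra.
have I0 : 0 <= I by apply: Rintegral_ge0 => tau _; exact: rintegrand_ge0.
have IB : I <= (t' - t) * (Gam * A ^+ 2 * E1).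
  rewrite mulrC; apply: Rintegral_le_cst => //.
    by apply: measurable_funTS; exact: measurable_rintegrand.
  move=> tau tt; rewrite rintegrand_ge0//=.
  apply: (@le_trans _ _ (N (f tau) x)).
    by apply: rintegrand_le => //; case/andP: tt.
  have tauT : 0 <= tau <= decay_time by apply/andP; split; lra.
  apply: (le_trans (rnonlin_decay af fd tauT x0)).
  rewrite [leRHS](_ : _ = Gam * ((1 + x) ^+ 4 * (A ^+ 2 * expR (- x)))); last by rewrite /E1; ring.
  apply: ler_wpM2l; first exact: ltW.
  by apply: ler_wpM2r; [apply: mulr_ge0; [exact: sqr_ge0|exact: expR_ge0]|exact: x4].
have pB : phi x <= (1 + alpha) * (1 + x) ^+ 4.
  have h3 := x4 3 isT; have h4 := x4 4 isT; have s2 := sqr_ge0 x.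
  rewrite /symb ger0_norm//.
  have := ler_wpM2l alpha_ge0 h3; lra.
have fB : f t x <= A * expR (- x) by apply: fd; apply/andP; split; lra.
have e1 : 1 - e <= (t' - t) * phi x by have := expR_ge1Dx (- ((t' - t) * phi x)); rewrite -/e; lra.
have e0 : 0 <= 1 - e by rewrite subr_ge0 expRN_symb_le1//; lra.
have D1 : (1 - e) * f t x <= (t' - t) * ((1 + alpha) * A * E1).
  apply: (@le_trans _ _ (((t' - t) * ((1 + alpha) * (1 + x) ^+ 4)) * (A * expR (- x)))).
    apply: ler_pM => //; apply: le_trans e1 _; apply: ler_wpM2l => //; lra.
  by rewrite le_eqVlt; apply/orP; left; apply/eqP; rewrite /E1; ring.
have D0 : 0 <= (1 - e) * f t x by rewrite mulr_ge0.
have H1 : 0 <= (t' - t) * (Gam * A ^+ 2 * E1) by apply: le_trans IB.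
have H2 : 0 <= (t' - t) * ((1 + alpha) * A * E1) by apply: le_trans D1.
have -> : f t' x - f t x = I - (1 - e) * f t x by rewrite E -/I; ring.
have -> : (t' - t) * (lipschitz_cst * E1) =
  (t' - t) * ((1 + alpha) * A * E1) + (t' - t) * (Gam * A ^+ 2 * E1).
  by rewrite /lipschitz_cst; ring.
by rewrite ler_norml; apply/andP; split; lra.
Qed.

End Decay.

(** * Lower bound *)

Section LowerBound.
Variable R : realType.
Notation mu := (@lebesgue_measure R).
Variables (alpha g1 g2 eta T : R) (d : R -> R) (f : R -> R -> R).
Hypothesis (alpha_ge0 : 0 <= alpha) (g1_gt0 : 0 < g1) (g2_lt0 : g2 < 0).
Hypothesis (d_ge0 : forall x, 0 <= d x) (d_eta : forall x, `|x - 3 / 2| < 1 / 2 -> d x = eta).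
Hypothesis (af : adm f) (f_fix : forall t x, f t x = rduhamel alpha g1 g2 d f t x).

Notation N := (rnonlin g1 g2).
Notation phi := (symb alpha).

(* Factors of [c]: the heat kernel is at least [exp (-1)] on a time interval of
   length [1 / ((1 + alpha) 16^(k+2))], and the convolution of the two unit
   intervals is bounded below on frequencies [z] in an interval of length 1/4. *)
Definition growth_cst := (g1 - g2) * expR (- 1) / (4 ^+ 5 * (1 + alpha)).

Hypothesis (T16 : 1 <= 16 * T)
  (eta_large : 8 <= eta * expR (- (T * (16 * (1 + alpha)))) * growth_cst).

Lemma symb_le (k : nat) (x : R) : 1 <= x <= 2 ^+ k.+1 -> phi x <= (1 + alpha) * 16 ^+ k.+1.
Proof.
move=> /andP[x1 xk]; have x0 : 0 <= x by lra.
have x4 : x ^+ 4 <= 16 ^+ k.+1.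
  have -> : 16 ^+ k.+1 = (2 ^+ k.+1) ^+ 4 :> R.
    by rewrite -exprM mulnC exprM; congr (_ ^+ _); ring.
  by rewrite lerXn2r ?nnegrE// exprn_ge0.
have x34 : x ^+ 3 <= x ^+ 4 by rewrite [leRHS]exprSr ler_peMr// exprn_ge0.
have sq := sqr_ge0 x.
rewrite /symb ger0_norm// mulrDl mul1r.
have : alpha * x ^+ 3 <= alpha * 16 ^+ k.+1 by rewrite ler_wpM2l// (le_trans x34).
lra.
Qed.

Lemma growth_cst_gt0 : 0 < growth_cst.
Proof.
have G0 : 0 < g1 - g2 by rewrite subr_gt0 (lt_trans g2_lt0).
by rewrite divr_gt0 ?mulr_gt0 ?expR_gt0 ?exprn_gt0// ltr_wpDr.
Qed.

(** The sequence [4 / growth_cst * 4 ^+ k] already solves the quadratic recursion [lowerS]. Any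
    other positive solution is this one times a factor that is squared at each step; here that
    factor starts at 2. *)
Definition lower (k : nat) := 4 / growth_cst * 4 ^+ k * 2 ^+ (2 ^ k)%N.

Lemma lowerS k : lower k.+1 = growth_cst * lower k ^+ 2 / 4 ^+ k.
Proof.
have c0 := growth_cst_gt0.
have k0 : (4 ^+ k : R) != 0 by rewrite expf_neq0// pnatr_eq0.
rewrite /lower exprS expnS mulnC exprM; field.
by rewrite k0 gt_eqF.
Qed.

Lemma f_lower (k : nat) t x : T * (1 - 2^-1 ^+ k) <= t <= T ->
  `|x - 3 / 2 * 2 ^+ k| < 1 / 2 -> lower k <= f t x.
Proof.
have [_ f0 _ _] := af; have c0 := growth_cst_gt0.
have G0 : 0 < g1 - g2 by rewrite subr_gt0 (lt_trans g2_lt0).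
elim: k t x => [|k IH] t x /andP[t1 tT] xk.
  rewrite expr0 mulr1 in xk; rewrite expr0 subrr mulr0 in t1.
  have x12 : 1 <= x <= 2 ^+ 1.
    by move: xk; rewrite ltr_norml expr1 => /andP[? ?]; apply/andP; split; lra.
  have ph := symb_le x12.
  rewrite /lower !expr0 mulr1 expn0 expr1 f_fix /rduhamel d_eta//.
  apply: ler_wpDr; first by apply: Rintegral_ge0 => tau _; exact: rintegrand_ge0.
  have e0 : 0 <= eta.
    have := d_ge0 (3 / 2); rewrite d_eta// subrr normr0; lra.
  (* [lower 0] equals [8 / growth_cst], which is the origin of the 8 in [eta_large]. *)
  apply: (@le_trans _ _ (eta * expR (- (T * (16 * (1 + alpha)))))).
    rewrite -(ler_pM2r c0); apply: le_trans eta_large.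
    rewrite le_eqVlt; apply/orP; left; apply/eqP; field.
    by rewrite gt_eqF.
  rewrite mulrC ler_wpM2r// ler_expR lerN2.
  apply: (@le_trans _ _ (t * (16 * (1 + alpha)))).
    by rewrite ler_wpM2l//; move: ph; rewrite expr1 mulrC.
  by rewrite ler_wpM2r// mulr_ge0// addr_ge0.
pose D : R := 2 ^+ k; pose b := (1 + alpha) * 16 ^+ k.+1.+1.
have D0 : 0 < D by rewrite exprn_gt0.
have D1 : 1 <= D by rewrite exprn_ege1//; lra.
have b0 : 0 < b by rewrite mulr_gt0 ?exprn_gt0// ltr_wpDr.
have bD : b = (1 + alpha) * 256 * D ^+ 4.
  rewrite /b /D !exprS -mulrA; congr (_ * _).
  have -> : 16 ^+ k = (2 ^+ k) ^+ 4 :> R.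
    by rewrite -exprM mulnC exprM; congr (_ ^+ _); ring.
  ring.
have Dk : 2^-1 ^+ k = D^-1 by rewrite exprVn.
have D4 : D <= D ^+ 4 by rewrite -[leLHS]expr1 ler_weXn2l.
(* The time range for [k.+1] starts later than the one for [k] by [T * (D^-1 / 2)]. Hence the window
   [[t - b^-1, t]], on which the heat kernel is at least [expR (- 1)], stays in the range of the
   induction hypothesis. *)
have bT : b^-1 <= T * (D^-1 / 2).
  have Tb : 16 * D ^+ 4 <= T * b.
    rewrite bD (_ : T * _ = (16 * T) * (1 + alpha) * (16 * D ^+ 4)); last by ring.
    apply: ler_peMl; first by rewrite mulr_ge0 ?exprn_ge0// ltW.
    by apply: mulr_ege1 => //; rewrite lerDl.
  rewrite (_ : T * (D^-1 / 2) = T * b / (2 * D) / b); last by field; rewrite !gt_eqF.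
  rewrite ler_pdivlMr// mulVf ?gt_eqF// ler_pdivlMr ?mulr_gt0// mul1r.
  by apply: le_trans Tb; lra.
have [xl xr] : 3 * D - 1 / 2 < x /\ x < 3 * D + 1 / 2.
  move: xk; rewrite exprS -/D ltr_norml => /andP[? ?]; split; lra.
have tD : T * (1 - D^-1) <= t - b^-1.
  by move: t1; rewrite exprS Dk => t1; lra.
have T0 : 0 < T by move: T16; lra.
have tb0 : 0 <= t - b^-1.
  by apply: le_trans tD; rewrite mulr_ge0 ?(ltW T0)// subr_ge0 invf_le1.
have bi0 : 0 < b^-1 by rewrite invr_gt0.
have t0 : 0 <= t by lra.
have ph : phi x <= b.
  apply: symb_le; rewrite !exprS -/D; apply/andP; split; lra.
rewrite f_fix /rduhamel; apply: ler_wpDl; first by rewrite mulr_ge0 ?expR_ge0.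
(* The multipliers contribute [D ^+ 2], the frequency interval 1/4 and the time window [b^-1], where
   [b] is [(1 + alpha) * 256 * D ^+ 4]. The powers of [D] leave [4 ^- k], and 4 * 256 is the
   [4 ^+ 5] of [growth_cst]. *)
have G : lower k.+1 = expR (- 1) * ((g1 - g2) * (D ^+ 2 * lower k ^+ 2 * (1 / 4))) * (t - (t - b^-1)).
  rewrite lowerS /growth_cst [t - _](_ : _ = b^-1); last by ring.
  have -> : 4 ^+ k = D ^+ 2 :> R by rewrite /D -exprM mulnC exprM; congr (_ ^+ _); ring.
  have a0 : 1 + alpha != 0 by rewrite gt_eqF// ltr_wpDr.
  by rewrite bD; field; rewrite a0 (gt_eqF D0).
have l0 : 0 <= lower k.
  by rewrite /lower !mulr_ge0 ?exprn_ge0// invr_ge0 ltW.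
have W0 : 0 <= (g1 - g2) * (D ^+ 2 * lower k ^+ 2 * (1 / 4)).
  apply: mulr_ge0; first exact: ltW.
  by apply: mulr_ge0; [apply: mulr_ge0; exact: sqr_ge0|rewrite divr_ge0].
rewrite G; apply: Rintegral_ge_cst => //.
- lra.
- by rewrite mulr_ge0 ?expR_ge0.
- exact: integrable_rintegrand.
- by apply: subset_itvScc; rewrite bnd_simp.
- by move=> tau _; exact: rintegrand_ge0.
- move=> tau /andP[tau1 tau2]; apply: ler_pM.
  + exact: expR_ge0.
  + exact: W0.
  + rewrite ler_expR lerN2.
    apply: (@le_trans _ _ ((t - tau) * b)); first by rewrite ler_wpM2l//; lra.
    by rewrite -ler_pdivlMr// div1r; lra.
  (* The interval of length 1/4 is centred at [x / 2], which is within 1/4 of [3 / 2 * D]. So [z]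
     and [x - z] are both within 3/8 < 1/2 of [3 / 2 * D], and at least [D] because [1 <= D]. *)
  + pose a := x / 2 - 1 / 8.
    rewrite (_ : 1 / 4 = (a + 1 / 4) - a); last by ring.
    apply: (rnonlin_ge g1_gt0 g2_lt0) => //.
    * by apply: adm_slice => //; lra.
    * lra.
    * exact: ltW.
    * move=> z; rewrite /a => /andP[za zb].
      have In w : 3 / 2 * D - 1 / 2 < w -> w < 3 / 2 * D + 1 / 2 -> lower k <= f tau w.
        move=> w1 w2; apply: IH; first by rewrite Dk; apply/andP; split; lra.
        by rewrite -/D ltr_norml; apply/andP; split; lra.
      by split; [lra|lra|apply: In; lra|apply: In; lra].
Qed.

(** This growth is enough for the norm: its square is of order 16^k, while for [s > -1] the weight
    |x|^(2 s) at frequencies of order 2^k is at least of order 4^(-k). *)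
Lemma lower_ge (k : nat) : 4 / growth_cst * 4 ^+ k <= lower k.
Proof.
have c0 := growth_cst_gt0.
by rewrite ler_peMr ?exprn_ege1 ?mulr_ge0 ?exprn_ge0 ?invr_ge0 ?(ltW c0)//; lra.
Qed.

Lemma Hdot_norm_eqy (s : R) : -1 < s -> Hdot_norm s (fun x => (f T x)%:C%C) = +oo%E.
Proof.
move=> s1; have c0 := growth_cst_gt0.
have [mf f0 _ _] := af.
have T0 : 0 < T by move: T16; lra.
rewrite /Hdot_norm [X in sqrte X](_ : _ = +oo)%E//; apply/eqyP => A A0.
pose g x := `|x| `^ (2 * s) * f T x ^+ 2.
have -> : (\int[mu]_x (`|x| `^ (2 * s) * ComplexField.Normc.normc (f T x)%:C%C ^+ 2)%:E =
    \int[mu]_x (g x)%:E)%E.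
  by apply: eq_integral => x _; rewrite /= expr0n/= addr0 sqrtr_sqr real_normK ?num_real.
have mg : measurable_fun setT (fun x => (g x)%:E).
  apply/measurable_EFinP; apply: measurable_funM.
    by apply: (measurableT_comp (measurable_powR _)); exact: normr_measurable.
  by apply: measurable_funX; exact: (measurable_fun_pair2 T mf).
have g0 x : (0 <= (g x)%:E)%E by rewrite lee_fin mulr_ge0 ?powR_ge0 ?sqr_ge0.
(* The integrand will be at least [4 ^+ k / (growth_cst ^+ 2 / 4)] on an interval of length one; [k]
   is chosen to make this exceed [A]. *)
pose B := A * growth_cst ^+ 2 / 4.
pose k := Num.bound B.
have Bk : B <= 4 ^+ k.
  apply: (@le_trans _ _ k%:R); first exact: le_archi_bound.
  by rewrite -natrX ler_nat ltnW// ltn_expl.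
pose D : R := 2 ^+ k.
have D1 : 1 <= D by rewrite exprn_ege1//; lra.
pose I : set R := `]3 / 2 * D - 1 / 2, 3 / 2 * D + 1 / 2[%classic.
have muI : mu I = 1%:E.
  rewrite /I lebesgue_measure_itv/= lte_fin ifT; last lra.
  by rewrite -EFinB; congr EFin; lra.
apply: (@le_trans _ _ (\int[mu]_(x in I) (g x)%:E)%E); last first.
  by apply: ge0_subset_integral => //; exact: measurable_itv.
have mI : measurable I by exact: measurable_itv.
apply: (@le_trans _ _ (\int[mu]_(x in I) (cst A%:E x))%E).
  by rewrite (integral_cst mu)// [X in (_ * X)%E](_ : _ = 1%:E) ?mule1//; exact: muI.
apply: ge0_le_integral => //=.
- by move=> x _; rewrite lee_fin ltW.
- exact: measurable_funTS.
move=> x; rewrite /I/= in_itv/= => /andP[x1 x2]; rewrite lee_fin.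
(* The time [T] belongs to the time ranges of all [k]. *)
have lk : lower k <= f T x.
  apply: f_lower; last by rewrite -/D ltr_norml; apply/andP; split; lra.
  rewrite lexx andbT ler_piMr ?(ltW T0)// lerBlDr lerDl exprn_ge0//; lra.
have xp : (4 * 4 ^+ k)^-1 <= `|x| `^ (2 * s).
  have x0 : 0 < x by lra.
  have x2D : x <= 2 * D by lra.
  rewrite (ger0_norm (ltW x0)); apply: (@le_trans _ _ (x `^ (- 2%:R))); last first.
    by apply: ler_powR; [lra|lra].
  rewrite powR_invn ?(ltW x0)// lef_pV2 ?posrE ?exprn_gt0 ?mulr_gt0 ?exprn_gt0//.
  have -> : 4 * 4 ^+ k = (2 * D) ^+ 2 :> R.
    have -> : 4 ^+ k = D ^+ 2 :> R by rewrite /D -exprM mulnC exprM; congr (_ ^+ _); ring.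
    ring.
  by rewrite lerXn2r ?nnegrE//; lra.
have gk := lower_ge k.
have f2 : (4 / growth_cst * 4 ^+ k) ^+ 2 <= f T x ^+ 2.
  have h0 : 0 <= 4 / growth_cst * 4 ^+ k by rewrite mulr_ge0 ?exprn_ge0// divr_ge0// ltW.
  by rewrite lerXn2r ?nnegrE//; lra.
apply: (@le_trans _ _ ((4 * 4 ^+ k)^-1 * (4 / growth_cst * 4 ^+ k) ^+ 2)); last first.
  by apply: ler_pM; [rewrite invr_ge0 mulr_ge0// exprn_ge0|exact: sqr_ge0|exact: xp|exact: f2].
have k0 : (4 ^+ k : R) != 0 by rewrite expf_neq0// pnatr_eq0.
rewrite [leRHS](_ : _ = 4 ^+ k / (growth_cst ^+ 2 / 4)); last first.
  by field; rewrite k0 gt_eqF.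
by rewrite ler_pdivlMr ?divr_gt0 ?exprn_gt0//; apply: le_trans Bk; rewrite /B mulrA.
Qed.
End LowerBound.

(** * Complex-valued functions and norms *)

Section RealData.
Local Open Scope complex_scope.
Variable R : realType.
Notation mu := (@lebesgue_measure R).
Variables (alpha g1 g2 : R).

Lemma integral_C_real (D : set R) (g : R -> R) :
  integral_C D (fun x => (g x)%:C) = (\int[mu]_(x in D) g x)%:C.
Proof.
rewrite /integral_C /=; congr (_ +i* _).
by rewrite /Rintegral; under eq_integral do rewrite /=; rewrite integral0.
Qed.

Lemma conv_abs_real (h : R -> R) x :
  Defs.conv (mul_abs (fun y => (h y)%:C)) (mul_abs (fun y => (h y)%:C)) x =
  (\int[mu]_z abs_kernel h x z)%:C.
Proof.
rewrite /Defs.conv -integral_C_real; congr integral_C; apply/funext => z.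
by rewrite /mul_abs -!rmorphM.
Qed.

Lemma conv_sq_real (h : R -> R) x :
  Defs.conv (fun y => (h y)%:C) (mul_sq (fun y => (h y)%:C)) x = (\int[mu]_z sq_kernel h x z)%:C.
Proof.
rewrite /Defs.conv -integral_C_real; congr integral_C; apply/funext => z.
by rewrite /mul_sq -!rmorphM.
Qed.

Lemma nonlin_real (h : R -> R) x :
  nonlin g1 g2 (fun y => (h y)%:C) x = (rnonlin g1 g2 h x)%:C.
Proof. by rewrite /nonlin conv_abs_real conv_sq_real -!rmorphM -rmorphB. Qed.

Lemma duhamel_integrand_real (f : R -> R -> R) t x tau :
  duhamel_integrand alpha g1 g2 (fun t x => (f t x)%:C) t x tau =
  (rintegrand alpha g1 g2 f t x tau)%:C.
Proof. by rewrite /duhamel_integrand nonlin_real -rmorphM. Qed.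

Lemma duhamel_real (d : R -> R) (f : R -> R -> R) t x :
  duhamel alpha g1 g2 (fun x => (d x)%:C) (fun t x => (f t x)%:C) t x =
  (rduhamel alpha g1 g2 d f t x)%:C.
Proof.
rewrite /duhamel /rduhamel rmorphD rmorphM; congr (_ + _).
apply: etrans (integral_C_real _ _); congr integral_C; apply/funext => tau.
exact: duhamel_integrand_real.
Qed.

Lemma picard_real (d : R -> R) n :
  picard alpha g1 g2 (fun x => (d x)%:C) n = (fun t x => (rpicard alpha g1 g2 d n t x)%:C).
Proof.
elim: n => [|n IH]; first by [].
rewrite [LHS](_ : _ = duhamel alpha g1 g2 (fun x => (d x)%:C)
  (picard alpha g1 g2 (fun x => (d x)%:C) n)); last by [].
by rewrite IH rpicardS; apply/funext => t; apply/funext => x; rewrite duhamel_real.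
Qed.

Lemma integrable_C_real (D : set R) (g : R -> R) : measurable D ->
  mu.-integrable D (EFin \o g) -> integrable_C D (fun x => (g x)%:C).
Proof.
by move=> mD ig; split => //=; exact: integrable0.
Qed.

Lemma nonlin_defined_real (h : R -> R) x : slice_adm h ->
  nonlin_defined (fun y => (h y)%:C) x.
Proof.
move=> hadm; split.
  rewrite /conv_defined (_ : (fun z => _) = (fun z => (abs_kernel h x z)%:C)).
    by apply: integrable_C_real => //; exact: integrable_abs_kernel.
  by apply/funext => z; rewrite /mul_abs -!rmorphM.
rewrite /conv_defined (_ : (fun z => _) = (fun z => (sq_kernel h x z)%:C)).
  by apply: integrable_C_real => //; exact: integrable_sq_kernel.
by apply/funext => z; rewrite /mul_sq -!rmorphM.
Qed.

(** The final time [T] is arbitrary: convergence of the integrals is a matter of one frequency at a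
    time and survives the blow-up of the norms. *)
Lemma mild_real (d : R -> R) (f : R -> R -> R) (T : R) : 0 <= alpha -> 0 < g1 -> g2 < 0 ->
  adm f -> (forall t x, f t x = rduhamel alpha g1 g2 d f t x) ->
  mild alpha g1 g2 (fun x => (d x)%:C) T (fun t x => (f t x)%:C).
Proof.
move=> a0 g10 g20 af ff t /andP[t0 tT]; apply: aeW => x; split.
- by move=> tau /andP[tau0 _]; apply: nonlin_defined_real; apply: adm_slice => //; exact: ltW.
- rewrite (_ : duhamel_integrand _ _ _ _ _ _ = fun tau => (rintegrand alpha g1 g2 f t x tau)%:C).
    by apply: integrable_C_real => //; exact: integrable_rintegrand.
  by apply/funext => tau; exact: duhamel_integrand_real.
- by rewrite duhamel_real -ff.
Qed.

End RealData.

(** * Sobolev norms of exponentially decaying functions *)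

Section Norms.
Local Open Scope complex_scope.
Variable R : realType.
Notation mu := (@lebesgue_measure R).
Implicit Types (s x t : R) (g : R -> R).

(** The exponent collects [m + m] from the Sobolev weight, 8 from the square of (1 + x)^4 and 2 from
    a factor 1 + x^2 set aside for integrability; [pi] bounds the integral of 1 / (1 + x^2). *)
Definition Hs_bound s : R :=
  let m := Num.bound s in Num.sqrt ((m + m + 10)%:R ^+ (m + m + 10) * pi).

Lemma measurable_Hs_weight s : measurable_fun setT (fun x : R => (1 + x ^+ 2) `^ s).
Proof.
apply: (measurableT_comp (measurable_powR s)).
by apply: measurable_funD => //; exact: measurable_funX.
Qed.

Lemma normc_real (a : R) : ComplexField.Normc.normc a%:C = `|a|.
Proof. by rewrite /= expr0n/= addr0 sqrtr_sqr. Qed.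

Lemma Hs_weight_le s x : 1 < x ->
  (1 + x ^+ 2) `^ s * ((1 + x) ^+ 4 * expR (- x)) ^+ 2 <=
  ((Num.bound s + Num.bound s + 10)%:R ^+ (Num.bound s + Num.bound s + 10))
    * (1 + x ^+ 2)^-1.
Proof.
move=> x1; set m := Num.bound s; have x0 : 0 <= x by lra.
have Y1 : 1 <= 1 + x ^+ 2 by rewrite lerDl sqr_ge0.
have Y0 : 0 < 1 + x ^+ 2 by lra.
have E0 := expR_gt0 (- x).
have E1 : expR (- x) <= 1 by rewrite -expR0 ler_expR; lra.
have sm : s <= m%:R by exact: le_archi_bound.
have w : (1 + x ^+ 2) `^ s <= (1 + x) ^+ (m + m).
  apply: (@le_trans _ _ ((1 + x ^+ 2) `^ m%:R)); first exact: ler_powR.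
  rewrite powR_mulrn ?(ltW Y0)// addnn -mul2n exprM.
  apply: lerXn2r; rewrite ?nnegrE ?exprn_ge0 ?addr_ge0 ?sqr_ge0//.
  by rewrite sqrrD; lra.
rewrite ler_pdivlMr//.
apply: (@le_trans _ _ ((1 + x) ^+ (m + m + 10) * expR (- x))); last first.
  by have := exprn_expRN_le (m + m + 9) x0; rewrite -addnS.
rewrite [leRHS](_ : _ = (1 + x) ^+ (m + m) * ((1 + x) ^+ 8 * expR (- x)) * (1 + x) ^+ 2); last first.
  by rewrite !exprD; ring.
apply: ler_pM.
- by rewrite mulr_ge0 ?powR_ge0 ?sqr_ge0.
- exact: ltW.
- apply: ler_pM => //; first exact: powR_ge0; first exact: sqr_ge0.
  rewrite exprMn -exprM; apply: ler_wpM2l; first by rewrite exprn_ge0//; lra.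
  by rewrite expr2 ler_piMl// ltW.
- by rewrite sqrrD; lra.
Qed.

Lemma Hs_norm_real s g :
  Hs_norm s (fun x => (g x)%:C) = sqrte (\int[mu]_x ((1 + x ^+ 2) `^ s * g x ^+ 2)%:E)%E.
Proof.
congr sqrte; apply: eq_integral => x _.
by rewrite normc_real real_normK ?num_real.
Qed.

Lemma Hs_norm_le s g (C : R) : 0 <= C -> measurable_fun setT g ->
  (forall x, x <= 1 -> g x = 0) ->
  (forall x, 1 < x -> `|g x| <= C * ((1 + x) ^+ 4 * expR (- x))) ->
  (Hs_norm s (fun x => (g x)%:C) <= (C * Hs_bound s)%:E)%E.
Proof.
move=> C0 mg g1 gC; rewrite Hs_norm_real.
pose m := Num.bound s; pose K : R := (m + m + 10)%:R ^+ (m + m + 10).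
have K0 : 0 <= K by rewrite exprn_ge0.
have HB : Hs_bound s = Num.sqrt (K * pi) by [].
have H : (\int[mu]_x ((1 + x ^+ 2) `^ s * g x ^+ 2)%:E <= ((C * Hs_bound s) ^+ 2)%:E)%E.
  rewrite HB exprMn sqr_sqrtr ?mulr_ge0 ?pi_ge0//.
  apply: (@le_trans _ _ (\int[mu]_x ((C ^+ 2 * K)%:E * ((1 + x ^+ 2)^-1)%:E))%E).
    apply: ge0_le_integral => //=.
    - by move=> x _; rewrite lee_fin mulr_ge0 ?powR_ge0 ?sqr_ge0.
    - apply/measurable_EFinP; apply: measurable_funM; first exact: measurable_Hs_weight.
      exact: measurable_funX.
    - apply/measurable_EFinP; apply: measurable_funM => //; exact: measurable_oneDsqrV.
    - move=> x _; rewrite lee_fin.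
      have Y0 : 0 <= (1 + x ^+ 2)^-1 by rewrite invr_ge0 addr_ge0// sqr_ge0.
      have C2 := sqr_ge0 C.
      have [x1|x1] := leP x 1.
        rewrite g1// expr0n/= mulr0; apply: mulr_ge0 => //; exact: mulr_ge0.
      apply: (@le_trans _ _ ((1 + x ^+ 2) `^ s * (C * ((1 + x) ^+ 4 * expR (- x))) ^+ 2)).
        apply: ler_wpM2l; first exact: powR_ge0.
        rewrite -[leLHS]real_normK ?num_real//.
        by apply: lerXn2r; rewrite ?nnegrE ?gC//; apply: le_trans (gC _ x1).
      rewrite exprMn mulrCA -[leRHS]mulrA; apply: ler_wpM2l => //; exact: Hs_weight_le.
  have C2 := sqr_ge0 C.
  rewrite ge0_integralZl_EFin//=; first last.
  - exact: mulr_ge0.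
  - by apply/measurable_EFinP; exact: measurable_oneDsqrV.
  - by move=> x _; rewrite lee_fin invr_ge0 addr_ge0// sqr_ge0.
  rewrite mulrA [leRHS]EFinM; apply: lee_wpmul2l; first by rewrite lee_fin mulr_ge0.
  exact: integral_oneDsqrV_le.
apply: (@le_trans _ _ (sqrte ((C * Hs_bound s) ^+ 2)%:E)).
  by rewrite lee_sqrt// lee_fin sqr_ge0.
by rewrite /= sqrtr_sqr ger0_norm// mulr_ge0// sqrtr_ge0.
Qed.

Lemma L2_norm_real g : L2_norm (fun x => (g x)%:C) = Hs_norm 0 (fun x => (g x)%:C).
Proof. by congr sqrte; apply: eq_integral => x _; rewrite powRr0 mul1r. Qed.

Lemma L2_norm_dx_real_le g : measurable_fun setT g ->
  (L2_norm (mul_dx (fun x => (g x)%:C)) <= Hs_norm 1 (fun x => (g x)%:C))%E.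
Proof.
move=> mg; rewrite Hs_norm_real /L2_norm.
have E x : ComplexField.Normc.normc (mul_dx (fun x => (g x)%:C) x) ^+ 2 = x ^+ 2 * g x ^+ 2.
  rewrite /mul_dx /= mul0r mulr0 !(subr0, sub0r, addr0, add0r, mul0r, oppr0, expr0n)/=.
  by rewrite sqrtr_sqr real_normK ?num_real// exprMn.
under eq_integral do rewrite E.
have g0 x : (0 <= ((1 + x ^+ 2) `^ 1 * g x ^+ 2)%:E)%E.
  by rewrite lee_fin mulr_ge0 ?powR_ge0 ?sqr_ge0.
rewrite lee_sqrt; last by apply: integral_ge0.
apply: ge0_le_integral => //=.
- by move=> x _; rewrite lee_fin mulr_ge0 ?sqr_ge0.
- by apply/measurable_EFinP; apply: measurable_funM; exact: measurable_funX.
- apply/measurable_EFinP; apply: measurable_funM; first exact: measurable_Hs_weight.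
  exact: measurable_funX.
- move=> x _; rewrite lee_fin; apply: ler_wpM2r; first exact: sqr_ge0.
  by rewrite powRr1 ?addr_ge0 ?sqr_ge0// lerDr.
Qed.

Lemma X_norm_real_lty s (T : R) (f : R -> R -> R) (C : R) : 0 <= C -> 0 < T -> T <= 1 ->
  (forall t, 0 <= t <= T -> measurable_fun setT (f t)) ->
  (forall t x, x <= 1 -> f t x = 0) ->
  (forall t x, 0 <= t <= T -> 1 < x -> `|f t x| <= C * ((1 + x) ^+ 4 * expR (- x))) ->
  (X_norm s T (fun t x => (f t x)%:C) < +oo)%E.
Proof.
move=> C0 T0 T1 mf f1 fC.
have H s' t : 0 <= t <= T -> (Hs_norm s' (fun x => (f t x)%:C) <= (C * Hs_bound s')%:E)%E.
  move=> tT; apply: Hs_norm_le => //; first exact: mf.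
    by move=> x; exact: f1.
  by move=> x x1; exact: fC.
have B0 s' : 0 <= Hs_bound s' by exact: sqrtr_ge0.
(* Since [T <= 1], the time weights are at most 1. *)
have W p t (N : \bar R) (K : R) : 0 <= K -> 0 <= p -> 0 < t <= T -> (0 <= N)%E -> (N <= K%:E)%E ->
    ((t `^ p)%:E * N <= K%:E)%E.
  move=> K0 p0 /andP[t0 tT] N0 NK; rewrite -[leRHS]mul1e; apply: lee_pmul => //.
    by rewrite lee_fin powR_ge0.
  rewrite lee_fin.
  have -> : 1 = 1 `^ p :> R by rewrite powR1.
  by apply: ge0_ler_powR; rewrite ?nnegrE//; lra.
rewrite /X_norm; apply: lte_add_pinfty; first apply: lte_add_pinfty.
- apply: (@le_lt_trans _ _ (C * Hs_bound s)%:E); last exact: ltry.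
  by apply: ge_ereal_sup => _ [t /= tT <-]; apply: H; move: tT; rewrite in_itv.
- apply: (@le_lt_trans _ _ (C * Hs_bound 0)%:E); last exact: ltry.
  apply: ge_ereal_sup => y [t /=]; rewrite in_itv/= => /andP[t0 tT] <-.
  apply: W; rewrite ?mulr_ge0 ?divr_ge0 ?t0 ?sqrte_ge0//.
  by rewrite L2_norm_real; apply: H; rewrite ltW.
- apply: (@le_lt_trans _ _ (C * Hs_bound 1)%:E); last exact: ltry.
  apply: ge_ereal_sup => y [t /=]; rewrite in_itv/= => /andP[t0 tT] <-.
  apply: W; rewrite ?mulr_ge0 ?divr_ge0 ?addr_ge0 ?t0 ?sqrte_ge0//.
  have tT' : 0 <= t <= T by rewrite ltW.
  by apply: le_trans (L2_norm_dx_real_le (mf t tT')) (H _ _ tT').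
Qed.

Lemma cont_Hs_real s (T : R) (f : R -> R -> R) (C : R) : 0 <= C ->
  (forall t, 0 <= t <= T -> measurable_fun setT (f t)) ->
  (forall t x, x <= 1 -> f t x = 0) ->
  (forall t x, 0 <= t <= T -> 1 < x -> `|f t x| <= C * ((1 + x) ^+ 4 * expR (- x))) ->
  (forall t t' x, 0 <= t -> t <= t' -> t' <= T -> 1 < x ->
    `|f t' x - f t x| <= (t' - t) * (C * ((1 + x) ^+ 4 * expR (- x)))) ->
  cont_Hs s T (fun t x => (f t x)%:C).
Proof.
move=> C0 mf f1 fC fL t tT; split.
  apply: (@le_lt_trans _ _ (C * Hs_bound s)%:E); last exact: ltry.
  apply: Hs_norm_le => //; first exact: mf.
    by move=> x; exact: f1.
  by move=> x x1; exact: fC.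
move=> e e0; have B0 : 0 <= Hs_bound s by exact: sqrtr_ge0.
have K0 : 0 < C * Hs_bound s + 1 by rewrite ltr_wpDl// mulr_ge0.
exists (e / (C * Hs_bound s + 1)); first exact: divr_gt0.
move=> t' t'T tt'.
have fL' x : 1 < x -> `|f t' x - f t x| <= `|t' - t| * C * ((1 + x) ^+ 4 * expR (- x)).
  move=> x1; rewrite -mulrA; have [h|/ltW h] := leP t t'.
    by rewrite [`|t' - t|]ger0_norm ?subr_ge0// fL//; [case/andP: tT|case/andP: t'T].
  rewrite distrC [`|t' - t|]distrC [`|t - t'|]ger0_norm ?subr_ge0// fL//.
    by case/andP: t'T.
  by case/andP: tT.
apply: (@le_lt_trans _ _ (`|t' - t| * C * Hs_bound s)%:E).
  rewrite (_ : (fun x => _) = (fun x => (f t' x - f t x)%:C)); last first.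
    by apply/funext => x; rewrite rmorphB.
  apply: Hs_norm_le => //; first by rewrite mulr_ge0.
    by apply: measurable_funB; exact: mf.
  by move=> x x1; rewrite !f1// subrr.
rewrite lte_fin -mulrA; apply: (@le_lt_trans _ _ (`|t' - t| * (C * Hs_bound s + 1))).
  by apply: ler_wpM2l => //; rewrite lerDl.
by rewrite -ltr_pdivlMr.
Qed.

End Norms.

(** * Moduli and integrals of complex-valued functions *)

Section ComplexKit.
Local Open Scope complex_scope.
Variable R : realType.
Notation mu := (@lebesgue_measure R).
Notation normc := ComplexField.Normc.normc.
Implicit Types (z : R[i]).

Lemma normc_sqrtE z : normc z = Num.sqrt (complex.Re z ^+ 2 + complex.Im z ^+ 2).
Proof. by case: z. Qed.

Lemma normc_ge0 z : 0 <= normc z.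
Proof. by rewrite normc_sqrtE sqrtr_ge0. Qed.

Lemma normc_Re_le z : `|complex.Re z| <= normc z.
Proof. by rewrite normc_sqrtE -sqrtr_sqr ler_wsqrtr// lerDl sqr_ge0. Qed.

Lemma normc_Im_le z : `|complex.Im z| <= normc z.
Proof. by rewrite normc_sqrtE -sqrtr_sqr ler_wsqrtr// lerDr sqr_ge0. Qed.

Lemma normc_le_ReIm z : normc z <= `|complex.Re z| + `|complex.Im z|.
Proof.
rewrite normc_sqrtE -[leRHS]ger0_norm ?addr_ge0// -[leRHS]sqrtr_sqr ler_wsqrtr// sqrrD.
by rewrite !real_normK ?num_real// lerD2r lerDl mulrn_wge0// mulr_ge0.
Qed.

Lemma normc_realM (a : R) z : normc (a%:C * z) = `|a| * normc z.
Proof. by rewrite ComplexField.Normc.normcM /= expr0n/= addr0 sqrtr_sqr. Qed.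

Lemma normc_le_sub z z' : normc (z - z') <= normc z + normc z'.
Proof.
have -> : normc z' = normc (- z') by rewrite !normc_sqrtE; case: z' => a b /=; rewrite !sqrrN.
exact: le_normcD.
Qed.

Lemma normc_eq0 z : normc z = 0 -> z = 0.
Proof. exact: ComplexField.Normc.eq0_normc. Qed.

Lemma measurable_normc d (T : measurableType d) (D : set T) (f : T -> R[i]) :
  measurable_fun_C D f -> measurable_fun D (fun x => normc (f x)).
Proof.
move=> [mr mi]; under eq_fun do rewrite normc_sqrtE.
apply: (measurableT_comp (continuous_measurable_fun (@sqrt_continuous R))).
by apply: measurable_funD; exact: measurable_funX.
Qed.

Lemma measurable_CM d (T : measurableType d) (D : set T) (f g : T -> R[i]) :
  measurable_fun_C D f -> measurable_fun_C D g -> measurable_fun_C D (fun x => f x * g x).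
Proof.
move=> [fr fi] [gr gi]; split.
  rewrite (_ : (fun x => _) = fun x => complex.Re (f x) * complex.Re (g x) - complex.Im (f x) * complex.Im (g x)).
    by apply: measurable_funB; exact: measurable_funM.
  by apply/funext => x; case: (f x) => ? ?; case: (g x).
rewrite (_ : (fun x => _) = fun x => complex.Re (f x) * complex.Im (g x) + complex.Im (f x) * complex.Re (g x)).
  by apply: measurable_funD; exact: measurable_funM.
by apply/funext => x; case: (f x) => ? ?; case: (g x).
Qed.

Lemma measurable_C_real d (T : measurableType d) (D : set T) (f : T -> R) :
  measurable_fun D f -> measurable_fun_C D (fun x => (f x)%:C).
Proof. by move=> mf; split => //=; exact: measurable_cst. Qed.

Lemma measurable_C_reflect (f : R -> R[i]) (c : R) :
  measurable_fun_C setT f -> measurable_fun_C setT (fun x : R => f (c - x)).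
Proof.
by move=> [fr fi]; split;
  [exact: (measurableT_comp fr (measurable_reflect c))|exact: (measurableT_comp fi (measurable_reflect c))].
Qed.

(** Real and imaginary parts are estimated separately, hence the factor 2; it is absorbed in the
    choice of the time step. *)
Lemma normc_integral_C_le (D : set R) (f : R -> R[i]) (B : R) : measurable D ->
  measurable_fun_C D f -> (\int[mu]_(x in D) (normc (f x))%:E <= B%:E)%E ->
  normc (integral_C D f) <= 2 * B.
Proof.
move=> mD mf fB; have [fr fi] := mf; have mn := measurable_normc mf.
apply: (le_trans (normc_le_ReIm _)); rewrite mulr_natl mulr2n; apply: lerD => /=.
  apply: le_integral_norm_le => //; apply: le_trans fB.
  apply: ge0_le_integral => //.
  - by apply/measurable_EFinP; exact: measurableT_comp.
  - exact/measurable_EFinP.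
  - by move=> x _; rewrite lee_fin normc_Re_le.
apply: le_integral_norm_le => //; apply: le_trans fB.
apply: ge0_le_integral => //.
- by apply/measurable_EFinP; exact: measurableT_comp.
- exact/measurable_EFinP.
- by move=> x _; rewrite lee_fin normc_Im_le.
Qed.

Lemma ae_imp (P Q : R -> Prop) : (forall x, P x -> Q x) ->
  {ae mu, forall x, P x} -> {ae mu, forall x, Q x}.
Proof.
move=> PQ [A [mA A0 PA]]; exists A; split => // x /= nQ.
by apply: PA => /= /PQ.
Qed.

Lemma ae_eq_integral_C (D : set R) (f g : R -> R[i]) : measurable D ->
  measurable_fun_C D f -> measurable_fun_C D g ->
  {ae mu, forall x, D x -> f x = g x} -> integral_C D f = integral_C D g.
Proof.
move=> mD [fr fi] [gr gi] fg; rewrite /integral_C /Rintegral.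
congr (fine _ +i* fine _); apply: ae_eq_integral => //; try exact/measurable_EFinP.
  by apply: ae_imp fg => x /= fg Dx; rewrite fg.
by apply: ae_imp fg => x /= fg Dx; rewrite fg.
Qed.

End ComplexKit.

(** * Vanishing at low frequencies *)

Section LowFrequency.
Local Open Scope complex_scope.
Variable R : realType.
Notation mu := (@lebesgue_measure R).
Notation normc := ComplexField.Normc.normc.
Variables (g1 g2 : R).
Hypothesis (g1_gt0 : 0 < g1) (g2_lt0 : g2 < 0).
Implicit Types (x z : R) (a b : R -> R).

(** The cut keeps all negative frequencies too, since a solution of the class X^s may a priori carry
    them. *)
Definition low a x : R := if x <= 1 then a x else 0.

Lemma low_ge0 a x : (forall x, 0 <= a x) -> 0 <= low a x.
Proof. by move=> a0; rewrite /low; case: ifP. Qed.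

Lemma low_le a x : (forall x, 0 <= a x) -> low a x <= a x.
Proof. by move=> a0; rewrite /low; case: ifP. Qed.

Lemma measurable_low a : measurable_fun setT a -> measurable_fun setT (low a).
Proof.
move=> ma; apply: measurable_fun_if => //; last exact: measurable_funTS.
exact: measurable_fun_ler.
Qed.

Lemma low_product_le a x z : (forall x, 0 <= a x) -> x <= 2 ->
  a (x - z) * a z <= low a (x - z) * a z + a (x - z) * low a z.
Proof.
move=> a0 x2; rewrite /low; case: ifPn => h1; last first.
  by rewrite mul0r add0r ifT//; move: h1; rewrite -ltNge; lra.
by rewrite lerDl mulr_ge0//; case: ifP.
Qed.

Lemma conv_bound a b (A B x : R) : measurable_fun setT a -> measurable_fun setT b ->
  (forall x, 0 <= a x) -> (forall x, 0 <= b x) -> 0 <= A -> 0 <= B ->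
  (\int[mu]_x (a x ^+ 2)%:E <= (A ^+ 2)%:E)%E ->
  (\int[mu]_x (b x ^+ 2)%:E <= (B ^+ 2)%:E)%E ->
  (\int[mu]_z (a (x - z) * b z)%:E <= (A * B)%:E)%E.
Proof.
move=> ma mb a0 b0 A0 B0 aA bB.
apply: le_trans (@cauchy_schwarz_bound R (fun z => a (x - z)) b A B _ mb A0 B0 _ bB).
- rewrite le_eqVlt; apply/orP; left; apply/eqP; apply: eq_integral => z _.
  by rewrite ger0_norm// mulr_ge0.
- exact: (measurableT_comp ma (measurable_reflect x)).
- rewrite (@ge0_integral_reflect R x (fun z => (a z ^+ 2)%:E))//.
    by apply/measurable_EFinP; exact: measurable_funX.
  by move=> z; rewrite lee_fin sqr_ge0.
Qed.

(** Each product on the right has exactly one factor [W0] or [W1], a norm of the low part, by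
    [low_product_le]. No factor carries more than one derivative, because the class X^s controls
    only the first one in L^2. *)
Lemma nonlin_low_le (v : R -> R[i]) (x V0 V1 W0 W1 : R) :
  measurable_fun_C setT v -> x <= 1 ->
  0 <= V0 -> 0 <= V1 -> 0 <= W0 -> 0 <= W1 ->
  let a := fun x => normc (v x) in
  (\int[mu]_x (a x ^+ 2)%:E <= (V0 ^+ 2)%:E)%E ->
  (\int[mu]_x ((`|x| * a x) ^+ 2)%:E <= (V1 ^+ 2)%:E)%E ->
  (\int[mu]_x (low a x ^+ 2)%:E <= (W0 ^+ 2)%:E)%E ->
  (\int[mu]_x ((`|x| * low a x) ^+ 2)%:E <= (W1 ^+ 2)%:E)%E ->
  normc (nonlin g1 g2 v x) <=
    (g1 - g2) * (4 * (W1 * V1) + 2 * `|x| * (W0 * V1 + V0 * W1)).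
Proof.
move=> mv x1 V00 V10 W00 W10 a H0 H1 L0 L1.
have x2 : x <= 2 by lra.
have ma : measurable_fun setT a by exact: measurable_normc.
have a0 z : 0 <= a z by exact: normc_ge0.
have ml := measurable_low ma.
have l0 z := low_ge0 z a0.
pose da z := `|z| * a z; pose dl z := `|z| * low a z.
have mda : measurable_fun setT da by apply: measurable_funM => //; exact: normr_measurable.
have mdl : measurable_fun setT dl by apply: measurable_funM => //; exact: normr_measurable.
have da0 z : 0 <= da z by exact: mulr_ge0.
have dl0 z : 0 <= dl z by exact: mulr_ge0.
have mr b : measurable_fun setT b -> measurable_fun setT (fun z => b (x - z)).
  by move=> mb; exact: (measurableT_comp mb (measurable_reflect x)).
have mp b c : measurable_fun setT b -> measurable_fun setT c ->
    measurable_fun setT (fun z => (b (x - z) * c z)%:E).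
  by move=> mb mc; apply/measurable_EFinP; apply: measurable_funM => //; exact: mr.
have p0 b c : (forall z, 0 <= b z) -> (forall z, 0 <= c z) -> forall z, (0 <= (b (x - z) * c z)%:E)%E.
  by move=> b0 c0 z; rewrite lee_fin mulr_ge0.
have E1 : (\int[mu]_z (dl (x - z) * da z)%:E <= (W1 * V1)%:E)%E by exact: conv_bound.
have E2 : (\int[mu]_z (da (x - z) * dl z)%:E <= (V1 * W1)%:E)%E by exact: conv_bound.
have E3 : (\int[mu]_z (low a (x - z) * da z)%:E <= (W0 * V1)%:E)%E by exact: conv_bound.
have E4 : (\int[mu]_z (a (x - z) * dl z)%:E <= (V0 * W1)%:E)%E by exact: conv_bound.
have mabsC : measurable_fun_C setT (mul_abs v).
  by apply: measurable_CM => //; apply: measurable_C_real; exact: normr_measurable.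
have msqC : measurable_fun_C setT (mul_sq v).
  by apply: measurable_CM => //; apply: measurable_C_real; exact: measurable_funX.
have E12 : (\int[mu]_z (dl (x - z) * da z + da (x - z) * dl z)%:E <= (2 * (W1 * V1))%:E)%E.
  under eq_integral do rewrite EFinD.
  rewrite ge0_integralD//; [|by move=> z _; exact: p0|exact: mp|by move=> z _; exact: p0|exact: mp].
  by rewrite mulr_natl mulr2n EFinD; apply: leeD => //; rewrite [W1 * V1]mulrC.
have K1 : normc (Defs.conv (mul_abs v) (mul_abs v) x) <= 2 * (2 * (W1 * V1)).
  apply: normc_integral_C_le => //.
    by apply: measurable_CM => //; exact: measurable_C_reflect.
  apply: le_trans E12; apply: ge0_le_integral => //.
  - by move=> z _; rewrite lee_fin normc_ge0.
  - apply/measurable_EFinP; apply: measurable_normc.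
    by apply: measurable_CM => //; exact: measurable_C_reflect.
  - by apply/measurable_EFinP; apply: measurable_funD; apply: measurable_funM => //; exact: mr.
  - move=> z _; rewrite lee_fin ComplexField.Normc.normcM /mul_abs !normc_realM !normr_id.
    rewrite -/(a (x - z)) -/(a z) /da /dl.
    have := ler_wpM2l (mulr_ge0 (normr_ge0 (x - z)) (normr_ge0 z)) (low_product_le z a0 x2).
    by move=> h; rewrite (le_trans _ (le_trans h _)) // le_eqVlt; apply/orP; left; apply/eqP; ring.
have K2 : normc (Defs.conv v (mul_sq v) x) <= 2 * (2 * (W1 * V1) + `|x| * (W0 * V1 + V0 * W1)).
  apply: normc_integral_C_le => //.
    by apply: measurable_CM => //; exact: measurable_C_reflect.
  apply: (@le_trans _ _ (\int[mu]_z ((dl (x - z) * da z + da (x - z) * dl z)%:E +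
     (`|x|)%:E * (low a (x - z) * da z + a (x - z) * dl z)%:E))%E).
    apply: ge0_le_integral => //.
    - by move=> z _; rewrite lee_fin normc_ge0.
    - apply/measurable_EFinP; apply: measurable_normc.
      by apply: measurable_CM => //; exact: measurable_C_reflect.
    - apply/measurable_EFinP; apply: measurable_funD; last apply: measurable_funM => //;
        by apply: measurable_funD; apply: measurable_funM => //; exact: mr.
    - move=> z _; rewrite -EFinM -EFinD lee_fin ComplexField.Normc.normcM /mul_sq !normc_realM.
      rewrite -/(a (x - z)) -/(a z) /da /dl ger0_norm ?sqr_ge0//.
      (* One of the two derivatives is moved to the other factor, up to a multiple of the output
         frequency [x]. *)
      have zx : z ^+ 2 <= `|z| * (`|x| + `|x - z|).
        rewrite -real_normK ?num_real// expr2; apply: ler_wpM2l => //.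
        by have := ler_normB x (x - z); rewrite opprB addrC subrK.
      have h1 := low_product_le z a0 x2.
      have h2 : z ^+ 2 * (a (x - z) * a z) <= `|z| * (`|x| + `|x - z|) *
          (low a (x - z) * a z + a (x - z) * low a z).
        by apply: ler_pM => //; [exact: sqr_ge0|exact: mulr_ge0].
      by rewrite (le_trans _ (le_trans h2 _)) // le_eqVlt; apply/orP; left; apply/eqP; ring.
  rewrite ge0_integralD//=; first last.
  - apply/measurable_EFinP; apply: measurable_funM => //.
    by apply: measurable_funD; apply: measurable_funM => //; exact: mr.
  - by move=> z _; rewrite -EFinM lee_fin; apply: mulr_ge0 => //; apply: addr_ge0; apply: mulr_ge0.
  - by apply/measurable_EFinP; apply: measurable_funD; apply: measurable_funM => //; exact: mr.
  - by move=> z _; rewrite lee_fin; apply: addr_ge0; apply: mulr_ge0.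
  rewrite EFinD; apply: leeD => //.
  rewrite ge0_integralZl_EFin//=; first last.
  - by apply/measurable_EFinP; apply: measurable_funD; apply: measurable_funM => //; exact: mr.
  - by move=> z _; rewrite lee_fin; apply: addr_ge0; apply: mulr_ge0.
  rewrite EFinM; apply: lee_wpmul2l => //.
  under eq_integral do rewrite EFinD.
  rewrite ge0_integralD//; [|by move=> z _; exact: p0|exact: mp|by move=> z _; exact: p0|exact: mp].
  by rewrite EFinD; exact: leeD.
apply: (le_trans (normc_le_sub _ _)); rewrite !normc_realM.
rewrite (gtr0_norm g1_gt0) (ltr0_norm g2_lt0).
set P := W1 * V1 in K1 K2 *; set Q := W0 * V1 + V0 * W1 in K2 *.
have XQ : 0 <= `|x| * Q by rewrite mulr_ge0// addr_ge0// mulr_ge0.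
have G1 := ler_wpM2l (ltW g1_gt0) K1.
have G2 : - g2 * normc (Defs.conv v (mul_sq v) x) <= - g2 * (2 * (2 * P + `|x| * Q)).
  by apply: ler_wpM2l => //; rewrite oppr_ge0 ltW.
(* The term in [|x|] comes from the second convolution alone; adding it to the first as well gives
   the common factor [g1 - g2]. *)
have G3 : 0 <= g1 * (2 * (`|x| * Q)) by apply: mulr_ge0; [exact: ltW|exact: mulr_ge0].
rewrite (le_trans (lerD G1 G2))//.
by rewrite -subr_ge0; apply: le_trans G3 _; rewrite le_eqVlt; apply/orP; left; apply/eqP; ring.
Qed.

End LowFrequency.

(** * Heat kernel against singular weights in time *)

Section HeatKernel.
Variable R : realType.
Notation mu := (@lebesgue_measure R).
Variables (alpha : R).
Hypothesis (alpha_ge0 : 0 <= alpha).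
Implicit Types (x r t th a sigma : R).
Notation phi := (symb alpha).

(** The difference of the two sides is (x^2 - 2)^2 / 2 plus the term in [alpha]. The constant
    accounts for the frequencies at which the symbol is negative; over times at most 1 it costs a
    factor [expR (5 / 2)]. *)
Lemma symb_ge_sq x : (1 + x ^+ 2) ^+ 2 / 2 - 5 / 2 <= phi x.
Proof.
have a0 : 0 <= alpha * `|x| ^+ 3 by rewrite mulr_ge0// exprn_ge0.
have s0 := sqr_ge0 (x ^+ 2 - 2).
rewrite /symb -subr_ge0; apply: (@le_trans _ _ ((x ^+ 2 - 2) ^+ 2 / 2 + alpha * `|x| ^+ 3)); first lra.
by rewrite le_eqVlt; apply/orP; left; apply/eqP; field.
Qed.

(* [heat_le] combines [symb_ge_sq] with [exp (-x) <= x^(-th)]. *)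
Definition heat_cst : R := 2 * expR (5 / 2).

Lemma heat_cst_gt0 : 0 < heat_cst.
Proof. by rewrite mulr_gt0 ?expR_gt0. Qed.

Lemma heat_le th r x : 0 <= th <= 1 -> 0 < r <= 1 ->
  expR (- (r * phi x)) <= heat_cst * (1 + x ^+ 2) `^ (- (2 * th)) * r `^ (- th).
Proof.
move=> th01 /andP[r0 r1]; have /andP[th0 th1] := th01.
have Y0 : 0 < 1 + x ^+ 2 by rewrite ltr_wpDr ?sqr_ge0.
set Y := 1 + x ^+ 2 in Y0 *.
have h := symb_ge_sq x; rewrite -/Y in h.
have q0 : 0 < r * (Y ^+ 2 / 2) by rewrite mulr_gt0// divr_gt0// exprn_gt0.
apply: (@le_trans _ _ (expR (5 / 2) * expR (- (r * (Y ^+ 2 / 2))))).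
  rewrite -expRD ler_expR.
  have := ler_wpM2l (ltW r0) h; rewrite mulrBr; lra.
rewrite [leRHS](_ : _ = expR (5 / 2) * (2 * (Y `^ (- (2 * th)) * r `^ (- th)))); last first.
  by rewrite /heat_cst; ring.
apply: ler_wpM2l; first exact: expR_ge0.
apply: (le_trans (expRN_le_powR th01 q0)).
rewrite powRM ?divr_ge0 ?exprn_ge0 ?(ltW r0) ?(ltW Y0)//.
rewrite powRM ?invr_ge0 ?exprn_ge0 ?(ltW Y0)//.
have -> : (Y ^+ 2) `^ (- th) = Y `^ (- (2 * th)).
  by rewrite -(powR_mulrn 2 (ltW Y0)) -powRrM; congr (_ `^ _); ring.
have two : 2^-1 `^ (- th) <= 2 :> R.
  rewrite -powR_inv1// -powRrM mulN1r opprK; apply: ler1_powR => //; lra.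
rewrite [leLHS](_ : _ = 2^-1 `^ (- th) * (Y `^ (- (2 * th)) * r `^ (- th))); last by ring.
by apply: ler_wpM2r => //; rewrite mulr_ge0 ?powR_ge0.
Qed.

Lemma measurable_powR_left a t0 (D : set R) : measurable_fun D (fun tau : R => (tau - t0) `^ (- a)).
Proof.
apply: measurable_funTS; apply: (measurableT_comp (measurable_powR _)).
by apply: measurable_funB => //; exact: measurable_cst.
Qed.

Lemma measurable_powR_right a t (D : set R) : measurable_fun D (fun tau : R => (t - tau) `^ (- a)).
Proof.
by apply: measurable_funTS; apply: (measurableT_comp (measurable_powR _)); exact: measurable_reflect.
Qed.

Lemma measurable_heat_symb t x (D : set R) :
  measurable_fun D (fun tau : R => expR (- ((t - tau) * phi x))).
Proof.
apply: measurable_funTS; apply: measurableT_comp; first exact: measurable_expR.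
apply: measurable_funN; apply: measurable_funM => //; exact: measurable_reflect.
Qed.

Lemma heat_beta_le th a t0 t x : 0 <= th < 1 -> 0 <= a < 1 -> t0 < t <= t0 + 1 ->
  (\int[mu]_(tau in `]t0, t[) (expR (- ((t - tau) * phi x)) * (tau - t0) `^ (- a))%:E <=
  (heat_cst * beta_cst th a * (1 + x ^+ 2) `^ (- (2 * th)) * (t - t0) `^ (1 - th - a))%:E)%E.
Proof.
move=> th01 a01 /andP[t0t tt0].
have th01' : 0 <= th <= 1 by case/andP: th01 => -> /ltW ->.
have c0 := heat_cst_gt0.
pose K := heat_cst * (1 + x ^+ 2) `^ (- (2 * th)).
have K0 : 0 <= K by rewrite mulr_ge0 ?powR_ge0// ltW.
apply: (@le_trans _ _ (\int[mu]_(tau in `]t0, t[)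
    (K%:E * ((t - tau) `^ (- th) * (tau - t0) `^ (- a))%:E))%E).
  apply: ge0_le_integral => //=.
  - by move=> tau _; rewrite lee_fin mulr_ge0 ?expR_ge0 ?powR_ge0.
  - by apply/measurable_EFinP; apply: measurable_funM; [exact: measurable_heat_symb|exact: measurable_powR_left].
  - apply/measurable_EFinP; apply: measurable_funM => //.
    by apply: measurable_funM; [exact: measurable_powR_right|exact: measurable_powR_left].
  - move=> tau; rewrite in_itv/= => /andP[t1 t2]; rewrite lee_fin mulrA.
    apply: ler_wpM2r; first exact: powR_ge0.
    by apply: heat_le => //; apply/andP; split; lra.
rewrite ge0_integralZl_EFin//=; first last.
- apply/measurable_EFinP.
  by apply: measurable_funM; [exact: measurable_powR_right|exact: measurable_powR_left].
- by move=> tau _; rewrite lee_fin mulr_ge0 ?powR_ge0.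
rewrite [leRHS](_ : _ = K%:E * (beta_cst th a * (t - t0) `^ (1 - th - a))%:E)%E; last first.
  by rewrite -EFinM; congr EFin; rewrite /K; ring.
by apply: lee_wpmul2l => //; exact: integral_beta_le.
Qed.

Lemma absx_powR_le x b : `|x| * (1 + x ^+ 2) `^ (- b) <= (1 + x ^+ 2) `^ (2^-1 - b).
Proof.
have Y0 : 0 < 1 + x ^+ 2 by rewrite ltr_wpDr ?sqr_ge0.
rewrite [leRHS]powRD ?(gt_eqF Y0) ?implybT//; apply: ler_wpM2r; first exact: powR_ge0.
by rewrite powR12_sqrt ?(ltW Y0)// -sqrtr_sqr ler_wsqrtr// lerDr.
Qed.

Definition step_cst sigma : R := heat_cst *
  (beta_cst (1 / 4) ((sigma + 1) / 2) + beta_cst (1 / 2) ((2 * sigma + 1) / 4) +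
   beta_cst (1 / 2) ((sigma + 1) / 2) + beta_cst (3 / 4) ((2 * sigma + 1) / 4)).

Lemma beta_cst_ge0 th a : th < 1 -> a < 1 -> 0 <= beta_cst th a.
Proof. by move=> th1 a1; rewrite addr_ge0// divr_ge0 ?powR_ge0// subr_ge0 ltW. Qed.

Lemma step_cst_ge0 sigma : 0 <= sigma < 1 -> 0 <= step_cst sigma.
Proof.
move=> /andP[s0 s1]; rewrite mulr_ge0 ?(ltW heat_cst_gt0)//.
by apply: addr_ge0; [apply: addr_ge0; [apply: addr_ge0|]|]; apply: beta_cst_ge0; lra.
Qed.

(** The time singularities are products of the weights of the X^s norm: (sigma + 1)/4 twice for two
    differentiated factors, and sigma/4 with (sigma + 1)/4 when only one is differentiated. The
    first product is integrable exactly when [sigma < 1]. *)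
Definition kernel_integral sigma t0 t x : \bar R :=
  (\int[mu]_(tau in `]t0, t[) (expR (- ((t - tau) * phi x)) *
    ((tau - t0) `^ (- ((sigma + 1) / 2)) + `|x| * (tau - t0) `^ (- ((2 * sigma + 1) / 4))))%:E)%E.

Lemma kernel_integralE sigma t0 t x : kernel_integral sigma t0 t x =
  (\int[mu]_(tau in `]t0, t[) (expR (- ((t - tau) * phi x)) * (tau - t0) `^ (- ((sigma + 1) / 2)))%:E
  + (`|x|)%:E * \int[mu]_(tau in `]t0, t[)
     (expR (- ((t - tau) * phi x)) * (tau - t0) `^ (- ((2 * sigma + 1) / 4)))%:E)%E.
Proof.
have mE a : measurable_fun `]t0, t[
    (fun tau => (expR (- ((t - tau) * phi x)) * (tau - t0) `^ (- a))%:E).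
  by apply/measurable_EFinP; apply: measurable_funM; [exact: measurable_heat_symb|exact: measurable_powR_left].
have E0 a tau : (0 <= (expR (- ((t - tau) * phi x)) * (tau - t0) `^ (- a))%:E)%E.
  by rewrite lee_fin mulr_ge0 ?expR_ge0 ?powR_ge0.
have -> : ((`|x|)%:E * \int[mu]_(tau in `]t0, t[)
     (expR (- ((t - tau) * phi x)) * (tau - t0) `^ (- ((2 * sigma + 1) / 4)))%:E =
   \int[mu]_(tau in `]t0, t[) ((`|x|)%:E *
     (expR (- ((t - tau) * phi x)) * (tau - t0) `^ (- ((2 * sigma + 1) / 4)))%:E))%E.
  by rewrite ge0_integralZl_EFin//; exact: mE.
rewrite -ge0_integralD//.
- by apply: eq_integral => tau _; rewrite -EFinM -EFinD; congr EFin; ring.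
- exact: mE.
- by move=> tau _; apply: mule_ge0; [rewrite lee_fin|exact: E0].
- apply/measurable_EFinP; apply: measurable_funM => //.
  by apply: measurable_funM; [exact: measurable_heat_symb|exact: measurable_powR_left].
Qed.

(* The exponents [th] = 1/4, 1/2 (first bound) and 1/2, 3/4 (second bound) give
   the decay [(1 + x^2)^(-1/2)] in all four terms, just enough for L^2. *)
Lemma kernel_integral_le sigma t0 t x : 0 <= sigma < 1 -> t0 < t <= t0 + 1 ->
  (kernel_integral sigma t0 t x <=
    (step_cst sigma * (1 + x ^+ 2) `^ (- 2^-1) * (t - t0) `^ (1 / 4 - sigma / 2))%:E)%E /\
  ((`|x|)%:E * kernel_integral sigma t0 t x <=
    (step_cst sigma * (1 + x ^+ 2) `^ (- 2^-1) * (t - t0) `^ (- (sigma / 2)))%:E)%E.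
Proof.
move=> /andP[s0 s1] tt; rewrite kernel_integralE.
set a1 := (sigma + 1) / 2; set a2 := (2 * sigma + 1) / 4.
have a11 : 0 <= a1 < 1 by rewrite /a1; apply/andP; split; lra.
have a21 : 0 <= a2 < 1 by rewrite /a2; apply/andP; split; lra.
have c14 : 0 <= (1 / 4 : R) < 1 by apply/andP; split; lra.
have c12 : 0 <= (1 / 2 : R) < 1 by apply/andP; split; lra.
have c34 : 0 <= (3 / 4 : R) < 1 by apply/andP; split; lra.
have H1 := heat_beta_le x c14 a11 tt; have H2 := heat_beta_le x c12 a21 tt.
have H3 := heat_beta_le x c12 a11 tt; have H4 := heat_beta_le x c34 a21 tt.
have hc := ltW heat_cst_gt0.
set Y := 1 + x ^+ 2 in H1 H2 H3 H4 *; set L := t - t0 in H1 H2 H3 H4 *.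
have b14 : 0 <= beta_cst (1 / 4) a1 by apply: beta_cst_ge0; [case/andP: c14|case/andP: a11].
have b12 : 0 <= beta_cst (1 / 2) a2 by apply: beta_cst_ge0; [case/andP: c12|case/andP: a21].
have b12' : 0 <= beta_cst (1 / 2) a1 by apply: beta_cst_ge0; [case/andP: c12|case/andP: a11].
have b34 : 0 <= beta_cst (3 / 4) a2 by apply: beta_cst_ge0; [case/andP: c34|case/andP: a21].
have X1 : `|x| * Y `^ (- (2 * (1 / 2))) <= Y `^ (- 2^-1).
  by apply: (le_trans (absx_powR_le _ _)); rewrite le_eqVlt; apply/orP; left; apply/eqP; congr (_ `^ _); field.
have X2 : `|x| * (`|x| * Y `^ (- (2 * (3 / 4)))) <= Y `^ (- 2^-1).
  apply: (le_trans (ler_wpM2l (normr_ge0 x) (absx_powR_le _ _))).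
  rewrite (_ : 2^-1 - 2 * (3 / 4) = - 1); last by field.
  by apply: (le_trans (absx_powR_le _ _)); rewrite le_eqVlt; apply/orP; left; apply/eqP; congr (_ `^ _); field.
(* The resulting time exponents exceed those of the norm, - sigma/4 and - (sigma + 1)/4, by (1 -
   sigma)/4 in both bounds: this gain makes short steps contract. *)
have E1 : 1 - 1 / 4 - a1 = 1 / 4 - sigma / 2 by rewrite /a1; field.
have E2 : 1 - 1 / 2 - a2 = 1 / 4 - sigma / 2 by rewrite /a2; field.
have E3 : 1 - 1 / 2 - a1 = - (sigma / 2) by rewrite /a1; field.
have E4 : 1 - 3 / 4 - a2 = - (sigma / 2) by rewrite /a2; field.
have Q1 : - (2 * (1 / 4)) = - 2^-1 :> R by field.
rewrite E1 Q1 in H1; rewrite E2 in H2; rewrite E3 in H3; rewrite E4 in H4.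
have P0 := powR_ge0 L (1 / 4 - sigma / 2); have P1 := powR_ge0 L (- (sigma / 2)).
have YP := powR_ge0 Y (- 2^-1).
split.
  apply: (@le_trans _ _ ((heat_cst * beta_cst (1 / 4) a1 * Y `^ (- 2^-1) * L `^ (1 / 4 - sigma / 2))%:E
     + (`|x|)%:E * (heat_cst * beta_cst (1 / 2) a2 * Y `^ (- (2 * (1 / 2))) * L `^ (1 / 4 - sigma / 2))%:E)%E).
    by apply: leeD => //; apply: lee_wpmul2l.
  rewrite -EFinM -EFinD lee_fin /step_cst -/a1 -/a2.
  have h := ler_wpM2l (mulr_ge0 (mulr_ge0 hc b12) P0) X1.
  (* The constants of the other bound are added to reach the common [step_cst]. *)
  have h' : 0 <= heat_cst * (beta_cst (1 / 2) a1 + beta_cst (3 / 4) a2) * Y `^ (- 2^-1) * L `^ (1 / 4 - sigma / 2).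
    by rewrite mulr_ge0// mulr_ge0// mulr_ge0// addr_ge0.
  rewrite -subr_ge0; rewrite -subr_ge0 in h.
  apply: le_trans (addr_ge0 h h') _; rewrite le_eqVlt; apply/orP; left; apply/eqP; ring.
apply: (@le_trans _ _ ((`|x|)%:E * ((heat_cst * beta_cst (1 / 2) a1 * Y `^ (- (2 * (1 / 2))) * L `^ (- (sigma / 2)))%:E
     + (`|x|)%:E * (heat_cst * beta_cst (3 / 4) a2 * Y `^ (- (2 * (3 / 4))) * L `^ (- (sigma / 2)))%:E))%E).
  by apply: lee_wpmul2l => //; apply: leeD => //; apply: lee_wpmul2l.
pose P3 := heat_cst * beta_cst (1 / 2) a1 * Y `^ (- (2 * (1 / 2))) * L `^ (- (sigma / 2)).
pose P4 := heat_cst * beta_cst (3 / 4) a2 * Y `^ (- (2 * (3 / 4))) * L `^ (- (sigma / 2)).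
change ((`|x| * (P3 + `|x| * P4))%:E <=
  (step_cst sigma * Y `^ (- 2^-1) * L `^ (- (sigma / 2)))%:E)%E.
rewrite lee_fin /P3 /P4 /step_cst -/a1 -/a2.
have h1 := ler_wpM2l (mulr_ge0 (mulr_ge0 hc b12') P1) X1.
have h2 := ler_wpM2l (mulr_ge0 (mulr_ge0 hc b34) P1) X2.
have h' : 0 <= heat_cst * (beta_cst (1 / 4) a1 + beta_cst (1 / 2) a2) * Y `^ (- 2^-1) * L `^ (- (sigma / 2)).
  by rewrite mulr_ge0// mulr_ge0// mulr_ge0// addr_ge0.
rewrite -subr_ge0 in h1; rewrite -subr_ge0 in h2; rewrite -subr_ge0.
apply: le_trans (addr_ge0 (addr_ge0 h1 h2) h') _; rewrite le_eqVlt; apply/orP; left; apply/eqP; ring.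
Qed.

End HeatKernel.

(** * Contraction for the low frequencies on short time steps *)

Section LowFrequencyVanishing.
Local Open Scope complex_scope.
Variable R : realType.
Notation mu := (@lebesgue_measure R).
Notation normc := ComplexField.Normc.normc.
Variables (alpha g1 g2 T sigma M : R) (d : R -> R) (v : R -> R -> R[i]).
Hypothesis (alpha_ge0 : 0 <= alpha) (g1_gt0 : 0 < g1) (g2_lt0 : g2 < 0).
Hypothesis (d_eq0 : forall x, x <= 1 -> d x = 0).
Hypothesis (sigma01 : 0 <= sigma < 1) (M_gt0 : 0 < M).
Hypothesis (mv : forall t, 0 <= t <= T -> measurable_fun_C setT (v t)).
Hypothesis (v_L2 : forall t, 0 < t <= T ->
  (\int[mu]_x (normc (v t x) ^+ 2)%:E <= ((M * t `^ (- (sigma / 4))) ^+ 2)%:E)%E).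
Hypothesis (v_dx : forall t, 0 < t <= T ->
  (\int[mu]_x ((`|x| * normc (v t x)) ^+ 2)%:E <=
     ((M * t `^ (- ((sigma + 1) / 4))) ^+ 2)%:E)%E).
Hypothesis (v_mild : mild alpha g1 g2 (fun x => (d x)%:C) T v).
Implicit Types (t x tau h D : R).

Notation phi := (symb alpha).

Definition vlow t := low (fun x => normc (v t x)).

Lemma measurable_vnorm t : 0 <= t <= T -> measurable_fun setT (fun x => normc (v t x)).
Proof. by move=> /mv; exact: measurable_normc. Qed.

Lemma measurable_vlow t : 0 <= t <= T -> measurable_fun setT (vlow t).
Proof. by move=> tT; apply: measurable_low; exact: measurable_vnorm. Qed.

Lemma vlow_ge0 t x : 0 <= vlow t x.
Proof. by apply: low_ge0 => y; exact: normc_ge0. Qed.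

Lemma vlow_le t x : vlow t x <= normc (v t x).
Proof. by apply: (@low_le R (fun x => normc (v t x))) => y; exact: normc_ge0. Qed.

(* The weights of the norm of X^s, restarted at time [t0]. *)
Definition vlow_bounded t0 h D := forall t, t0 < t <= t0 + h -> t <= T ->
  (\int[mu]_x (vlow t x ^+ 2)%:E <= ((D * (t - t0) `^ (- (sigma / 4))) ^+ 2)%:E)%E /\
  (\int[mu]_x ((`|x| * vlow t x) ^+ 2)%:E <=
     ((D * (t - t0) `^ (- ((sigma + 1) / 4))) ^+ 2)%:E)%E.

Definition vlow_vanish t0 := forall t, 0 <= t <= T -> t <= t0 ->
  {ae mu, forall x, vlow t x = 0}.

(** Restarting at [t0] only enlarges the weights, so the a priori bounds persist with the same [M].
    Hence the time step need not shrink. *)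
Lemma powRN_shift_le t0 t p : 0 <= t0 < t -> 0 <= p -> t `^ (- p) <= (t - t0) `^ (- p).
Proof.
move=> /andP[t00 t0t] p0; rewrite !powRN lef_pV2 ?posrE ?powR_gt0//; try lra.
by apply: ge0_ler_powR; rewrite ?nnegrE//; lra.
Qed.

Lemma integral_sqr_le_shift (f k : R -> R) (A B : R) :
  measurable_fun setT f -> measurable_fun setT k -> (forall x, 0 <= f x <= k x) -> 0 <= A <= B ->
  (\int[mu]_x (k x ^+ 2)%:E <= (A ^+ 2)%:E)%E -> (\int[mu]_x (f x ^+ 2)%:E <= (B ^+ 2)%:E)%E.
Proof.
move=> mf mk fk /andP[A0 AB] kA.
apply: (@le_trans _ _ (A ^+ 2)%:E); last first.
  by rewrite lee_fin lerXn2r ?nnegrE// (le_trans A0).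
apply: le_trans kA; apply: ge0_le_integral => //.
- by move=> x _; rewrite lee_fin sqr_ge0.
- by apply/measurable_EFinP; exact: measurable_funX.
- by apply/measurable_EFinP; exact: measurable_funX.
- move=> x _; rewrite lee_fin; have /andP[f0 fkx] := fk x.
  by rewrite lerXn2r ?nnegrE// (le_trans f0).
Qed.

Lemma vlow_bounded_init t0 h : 0 <= t0 -> vlow_bounded t0 h M.
Proof.
move=> t00 t /andP[t0t th] tT.
have t0' : 0 < t by exact: le_lt_trans t0t.
have tT' : 0 <= t <= T by rewrite ltW.
have tT'' : 0 < t <= T by rewrite t0'.
have [s0 s1] := andP sigma01.
have mn : measurable_fun setT (fun x : R => `|x|) by exact: normr_measurable.
split.
  apply: (integral_sqr_le_shift (measurable_vlow tT') (measurable_vnorm tT') _ _ (v_L2 tT'')).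
    by move=> x; rewrite vlow_ge0 vlow_le.
  rewrite mulr_ge0 ?powR_ge0 ?(ltW M_gt0)//=; apply: ler_wpM2l; first exact: ltW.
  by apply: powRN_shift_le; [rewrite t00|rewrite divr_ge0].
apply: (integral_sqr_le_shift (measurable_funM mn (measurable_vlow tT'))
  (measurable_funM mn (measurable_vnorm tT')) _ _ (v_dx tT'')).
  by move=> x; rewrite mulr_ge0 ?vlow_ge0//= ler_wpM2l// vlow_le.
rewrite mulr_ge0 ?powR_ge0 ?(ltW M_gt0)//=; apply: ler_wpM2l; first exact: ltW.
by apply: powRN_shift_le; [rewrite t00|rewrite divr_ge0// addr_ge0].
Qed.

(** The 16 is the product of the 4 of the bilinear estimate, the 2 of the complex integral and the 2
    that bounds the L^2 norm of (1 + x^2)^(-1/2), as [pi <= 4]. *)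
Definition gain_cst := 16 * (g1 - g2) * M * step_cst sigma.

Lemma nonlin_vlow_le t0 h D t x : 0 <= t0 -> 0 <= D -> vlow_bounded t0 h D ->
  t0 < t <= t0 + h -> t <= T -> x <= 1 ->
  normc (nonlin g1 g2 (v t) x) <= (4 * (g1 - g2) * M * D) *
   ((t - t0) `^ (- ((sigma + 1) / 2)) + `|x| * (t - t0) `^ (- ((2 * sigma + 1) / 4))).
Proof.
move=> t00 D0 bd tt tT x1; have [t0t th] := andP tt.
have t0' : 0 < t by exact: le_lt_trans t0t.
have tT' : 0 <= t <= T by rewrite ltW.
have r0 : 0 < t - t0 by rewrite subr_gt0.
have [B0 B1] := bd t tt tT.
have [A0 A1] : (\int[mu]_x (normc (v t x) ^+ 2)%:E <=
       ((M * (t - t0) `^ (- (sigma / 4))) ^+ 2)%:E)%E /\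
    (\int[mu]_x ((`|x| * normc (v t x)) ^+ 2)%:E <=
       ((M * (t - t0) `^ (- ((sigma + 1) / 4))) ^+ 2)%:E)%E.
  have tT'' : 0 < t <= T by rewrite t0'.
  have [s0 s1] := andP sigma01.
  have mn : measurable_fun setT (fun x : R => `|x|) by exact: normr_measurable.
  have mM := measurable_vnorm tT'.
  split.
    apply: (integral_sqr_le_shift mM mM _ _ (v_L2 tT'')).
      by move=> y; rewrite normc_ge0/=.
    rewrite mulr_ge0 ?powR_ge0 ?(ltW M_gt0)//=; apply: ler_wpM2l; first exact: ltW.
    by apply: powRN_shift_le; [rewrite t00|rewrite divr_ge0].
  apply: (integral_sqr_le_shift (measurable_funM mn mM) (measurable_funM mn mM) _ _ (v_dx tT'')).
    by move=> y; rewrite mulr_ge0 ?normc_ge0/=.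
  rewrite mulr_ge0 ?powR_ge0 ?(ltW M_gt0)//=; apply: ler_wpM2l; first exact: ltW.
  by apply: powRN_shift_le; [rewrite t00|rewrite divr_ge0// addr_ge0].
have := nonlin_low_le g1_gt0 g2_lt0 (mv tT') x1 _ _ _ _ A0 A1 B0 B1.
have P0 := powR_ge0 (t - t0) (- (sigma / 4)).
have P1 := powR_ge0 (t - t0) (- ((sigma + 1) / 4)).
rewrite !mulr_ge0 ?(ltW M_gt0)// => /(_ isT isT isT isT) /le_trans; apply.
have E1 : (t - t0) `^ (- ((sigma + 1) / 4)) * (t - t0) `^ (- ((sigma + 1) / 4)) =
    (t - t0) `^ (- ((sigma + 1) / 2)).
  by rewrite -powRD ?(gt_eqF r0) ?implybT//; congr (_ `^ _); field.
have E2 : (t - t0) `^ (- (sigma / 4)) * (t - t0) `^ (- ((sigma + 1) / 4)) =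
    (t - t0) `^ (- ((2 * sigma + 1) / 4)).
  by rewrite -powRD ?(gt_eqF r0) ?implybT//; congr (_ `^ _); field.
by rewrite -E1 -E2 le_eqVlt; apply/orP; left; apply/eqP; ring.
Qed.

(** This moves the lower limit of the Duhamel integral from 0 to [t0], once the low part is known to
    vanish up to [t0]. *)
Lemma nonlin_vanish t x : 0 < t <= T -> x <= 1 -> {ae mu, forall x, vlow t x = 0} ->
  normc (nonlin g1 g2 (v t) x) = 0.
Proof.
move=> tT x1 v0; have [t0 tT'] := andP tT.
have tT'' : 0 <= t <= T by rewrite ltW.
have z (w : R -> R) : measurable_fun setT w -> (forall x, vlow t x = 0 -> w x = 0) ->
    (\int[mu]_x (w x ^+ 2)%:E <= (0 ^+ 2)%:E)%E.
  move=> mw wv; rewrite (ae_eq_integral (cst 0%E)) ?integral0 ?expr0n//=.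
    by apply/measurable_EFinP; exact: measurable_funX.
  by apply: ae_imp v0 => y /wv /= -> _; rewrite expr0n.
have L0 : (\int[mu]_x (vlow t x ^+ 2)%:E <= (0 ^+ 2)%:E)%E.
  by apply: z => //; exact: measurable_vlow.
have L1 : (\int[mu]_x ((`|x| * vlow t x) ^+ 2)%:E <= (0 ^+ 2)%:E)%E.
  apply: z; last by move=> y ->; rewrite mulr0.
  by apply: measurable_funM; [exact: normr_measurable|exact: measurable_vlow].
have := nonlin_low_le g1_gt0 g2_lt0 (mv tT'') x1 _ _ (lexx 0) (lexx 0) (v_L2 tT) (v_dx tT) L0 L1.
rewrite !mulr_ge0 ?powR_ge0 ?(ltW M_gt0)// => /(_ isT isT).
rewrite !(mul0r, mulr0, addr0) => h; apply: le_anti; apply/andP; split => //; exact: normc_ge0.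
Qed.

Lemma vlow_pointwise_le t0 h D t : 0 <= t0 -> 0 <= D -> vlow_vanish t0 -> vlow_bounded t0 h D ->
  t0 < t <= t0 + h -> t <= t0 + 1 -> t <= T ->
  {ae mu, forall x, ((vlow t x)%:E <= (8 * (g1 - g2) * M * D)%:E * kernel_integral alpha sigma t0 t x)%E}.
Proof.
move=> t00 D0 vn bd tt t1 tT; have [t0t th] := andP tt.
have t0' : 0 < t by exact: le_lt_trans t0t.
have tT' : 0 <= t <= T by rewrite ltW.
have G0 : 0 <= g1 - g2 by rewrite subr_ge0 ltW// (lt_trans g2_lt0).
have K0 x : (0 <= kernel_integral alpha sigma t0 t x)%E.
  apply: integral_ge0 => tau _; rewrite lee_fin mulr_ge0 ?expR_ge0//.
  by rewrite addr_ge0 ?mulr_ge0 ?powR_ge0.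
apply: ae_imp (v_mild tT') => x [_ [ir ii] vE].
have C0 : 0 <= 8 * (g1 - g2) * M * D by rewrite !mulr_ge0// ltW.
rewrite /vlow /low; case: ifPn => [x1|_]; last by rewrite mule_ge0// lee_fin.
pose f := duhamel_integrand alpha g1 g2 v t x.
have mf : measurable_fun_C `[0, t] f.
  by split; apply/measurable_EFinP; [case/integrableP: ir|case/integrableP: ii].
have mn := measurable_normc mf.
have C4 : 0 <= 4 * (g1 - g2) * M * D by rewrite !mulr_ge0// ltW.
have [s0 s1] := andP sigma01.
have [Kfin _] := kernel_integral_le alpha_ge0 x sigma01 (introT andP (conj t0t t1)).
have Kf : kernel_integral alpha sigma t0 t x \is a fin_num.
  by rewrite ge0_fin_numE//; exact: le_lt_trans Kfin (ltry _).
have H : (\int[mu]_(tau in `[0%R, t]) (normc (f tau))%:E <=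
    (4 * (g1 - g2) * M * D)%:E * kernel_integral alpha sigma t0 t x)%E.
  have mn' : measurable_fun `]0%R, t[ (fun tau => (normc (f tau))%:E).
    apply/measurable_EFinP; apply: measurable_funS mn => //.
    by apply: subset_itv; rewrite bnd_simp.
  have mk : measurable_fun `]t0, t[ (fun tau => (expR (- ((t - tau) * phi x)) *
    ((tau - t0) `^ (- ((sigma + 1) / 2)) + `|x| * (tau - t0) `^ (- ((2 * sigma + 1) / 4))))%:E).
    apply/measurable_EFinP; apply: measurable_funM; first exact: measurable_heat_symb.
    apply: measurable_funD; first exact: measurable_powR_left.
    by apply: measurable_funM => //; exact: measurable_powR_left.
  (* The endpoints are removed because the weighted bounds hold at positive times only and the
     kernel is singular at its endpoint. *)
  rewrite integral_itv_bndoo// /kernel_integral -ge0_integralZl_EFin//; last first.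
    by move=> tau _; rewrite lee_fin mulr_ge0 ?expR_ge0// addr_ge0 ?mulr_ge0 ?powR_ge0.
  rewrite (_ : `]t0, t[%classic = `]0, t[ `&` `]t0, t[); last first.
    by rewrite setIidr//; apply: subset_itvr; rewrite bnd_simp.
  rewrite [leRHS]integral_mkcondr; apply: ge0_le_integral => //.
  - by move=> tau _; rewrite lee_fin normc_ge0.
  - apply: measurable_funTS; apply/(measurable_restrictT _ _).1 => //.
    exact: measurable_funeM.
  - move=> tau tauI; have /andP[tau0 taut] : 0 < tau < t by move: tauI; rewrite /= in_itv.
    have tauT : tau <= T by lra.
    rewrite /f /duhamel_integrand normc_realM ger0_norm ?expR_ge0// patchE mem_setE.
    rewrite (_ : (tau \in `]t0, t[) = (t0 < tau)); last by rewrite in_itv/= taut andbT.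
    case: ifPn => [ht|]; last first.
      rewrite -leNgt => ht; rewrite nonlin_vanish ?mulr0//; first by rewrite tau0.
      by apply: vn => //; rewrite ltW.
    rewrite lee_fin mulrCA; apply: ler_wpM2l; first exact: expR_ge0.
    by apply: nonlin_vlow_le bd _ _ _ => //; rewrite ht/=; lra.
rewrite vE /duhamel d_eq0// mulr0 add0r.
rewrite -(fineK Kf) -EFinM lee_fin.
rewrite -(fineK Kf) -EFinM in H.
apply: (le_trans (normc_integral_C_le _ mf H)) => //.
by rewrite le_eqVlt; apply/orP; left; apply/eqP; ring.
Qed.

Lemma integral_sqr_oneDsqr_le (f : R -> R) (Q : R) : measurable_fun setT f -> (forall x, 0 <= f x) ->
  0 <= Q -> {ae mu, forall x, f x <= Q * (1 + x ^+ 2) `^ (- 2^-1)} ->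
  (\int[mu]_x (f x ^+ 2)%:E <= ((2 * Q) ^+ 2)%:E)%E.
Proof.
move=> mf f0 Q0 fQ.
apply: (@le_trans _ _ (\int[mu]_x ((Q ^+ 2)%:E * ((1 + x ^+ 2)^-1)%:E))%E).
  apply: ae_ge0_le_integral => //.
  - by move=> x _; rewrite lee_fin sqr_ge0.
  - by apply/measurable_EFinP; exact: measurable_funX.
  - by move=> x _; rewrite -EFinM lee_fin mulr_ge0 ?sqr_ge0// invr_ge0 addr_ge0// sqr_ge0.
  - by apply/measurable_EFinP; apply: measurable_funM => //; exact: measurable_oneDsqrV.
  - apply: ae_imp fQ => x fQ _; rewrite -EFinM lee_fin.
    have Y0 : 0 < 1 + x ^+ 2 by rewrite ltr_wpDr ?sqr_ge0.
    have -> : Q ^+ 2 / (1 + x ^+ 2) = (Q * (1 + x ^+ 2) `^ (- 2^-1)) ^+ 2.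
      rewrite exprMn; congr (_ * _).
      rewrite -(powR_mulrn 2 (powR_ge0 _ _)) -powRrM -powR_inv1 ?(ltW Y0)//; congr (_ `^ _); field => //.
    by rewrite lerXn2r ?nnegrE ?mulr_ge0 ?powR_ge0.
rewrite ge0_integralZl_EFin ?sqr_ge0//; first last.
- by apply/measurable_EFinP; exact: measurable_oneDsqrV.
- by move=> x _; rewrite lee_fin invr_ge0 addr_ge0// sqr_ge0.
apply: (@le_trans _ _ ((Q ^+ 2)%:E * pi%:E)%E).
  by apply: lee_wpmul2l; [rewrite lee_fin sqr_ge0|exact: integral_oneDsqrV_le].
rewrite -EFinM lee_fin exprMn mulrC; apply: ler_wpM2r; first exact: sqr_ge0.
have := pihalf_lt2 R; lra.
Qed.

(** The exponent inverts the time gain (1 - sigma)/4, so that the contraction factor is at most 1/2.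
    Adding 1 keeps the step at most 1, as the heat estimates require. Neither [t0] nor [D]
    enters. *)
Definition step_len := (2 * gain_cst + 1)^-1 `^ (4 / (1 - sigma)).

Lemma gain_cst_ge0 : 0 <= gain_cst.
Proof.
have G0 : 0 <= g1 - g2 by rewrite subr_ge0 ltW// (lt_trans g2_lt0).
by apply: mulr_ge0; [apply: mulr_ge0; [exact: mulr_ge0|exact: ltW]|exact: step_cst_ge0].
Qed.

Lemma step_len_gt0 : 0 < step_len.
Proof. by rewrite powR_gt0// invr_gt0; have := gain_cst_ge0; lra. Qed.

Lemma step_len_le1 : step_len <= 1.
Proof.
have g0 := gain_cst_ge0; have [s0 s1] := andP sigma01.
have -> : 1 = 1 `^ (4 / (1 - sigma)) :> R by rewrite powR1.
apply: ge0_ler_powR; rewrite ?nnegrE ?divr_ge0 ?invr_ge0//; try lra.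
by rewrite invf_le1; lra.
Qed.

Lemma gain_le L : 0 < L <= step_len -> gain_cst * L `^ ((1 - sigma) / 4) <= 1 / 2.
Proof.
move=> /andP[L0 Lh]; have g0 := gain_cst_ge0; have [s0 s1] := andP sigma01.
have c0 : 0 < 2 * gain_cst + 1 by lra.
have : L `^ ((1 - sigma) / 4) <= (2 * gain_cst + 1)^-1.
  apply: (@le_trans _ _ (step_len `^ ((1 - sigma) / 4))).
    by apply: ge0_ler_powR; rewrite ?nnegrE ?divr_ge0 ?(ltW L0) ?(ltW step_len_gt0)//; lra.
  rewrite /step_len -powRrM [X in _ `^ X](_ : _ = 1); last by field; lra.
  by rewrite powRr1// invr_ge0 ltW.
move=> /(ler_wpM2l g0) /le_trans; apply.
by rewrite ler_pdivrMr//; lra.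
Qed.

Lemma vlow_bounded_half t0 h D : 0 <= t0 -> 0 <= D -> h <= step_len -> vlow_vanish t0 ->
  vlow_bounded t0 h D -> vlow_bounded t0 h (D / 2).
Proof.
move=> t00 D0 hl vn bd t tt tT; have [t0t th] := andP tt.
have h1 := step_len_le1.
have t1 : t <= t0 + 1 by lra.
have t0' : 0 < t by exact: le_lt_trans t0t.
have tT' : 0 <= t <= T by rewrite ltW.
have L0 : 0 < t - t0 by rewrite subr_gt0.
have Lh : 0 < t - t0 <= step_len by rewrite L0/=; lra.
have gl := gain_le Lh.
have G0 : 0 <= g1 - g2 by rewrite subr_ge0 ltW// (lt_trans g2_lt0).
have S0 := step_cst_ge0 sigma01.
have P := vlow_pointwise_le t00 D0 vn bd tt t1 tT.
have KI x := kernel_integral_le alpha_ge0 x sigma01 (introT andP (conj t0t t1)).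
set C := 8 * (g1 - g2) * M * D in P.
have C0 : 0 <= C by rewrite /C !mulr_ge0// ltW.
have CE (p : R) : 2 * (C * step_cst sigma * p) = gain_cst * D * p by rewrite /C /gain_cst; ring.
have fin (p : R) (q : R) : q = - p + (1 - sigma) / 4 ->
    0 <= gain_cst * D * (t - t0) `^ q <= D / 2 * (t - t0) `^ (- p).
  move=> ->; rewrite powRD ?(gt_eqF L0) ?implybT//.
  have p0 := powR_ge0 (t - t0) (- p); have q0 := powR_ge0 (t - t0) ((1 - sigma) / 4).
  have g0 := gain_cst_ge0.
  apply/andP; split; first by apply: mulr_ge0; exact: mulr_ge0.
  have Dp : 0 <= D * (t - t0) `^ (- p) by exact: mulr_ge0.
  have := ler_wpM2r Dp gl; rewrite -subr_ge0 => h2.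
  rewrite -subr_ge0; apply: le_trans h2 _; rewrite le_eqVlt; apply/orP; left; apply/eqP; field => //.
have fin2 (I : \bar R) (p q : R) : q = - p + (1 - sigma) / 4 ->
    (I <= ((2 * (C * step_cst sigma * (t - t0) `^ q)) ^+ 2)%:E)%E ->
    (I <= ((D / 2 * (t - t0) `^ (- p)) ^+ 2)%:E)%E.
  move=> /fin; rewrite -CE => /andP[f0 f1] /le_trans; apply; rewrite lee_fin.
  by rewrite lerXn2r ?nnegrE// (le_trans f0).
split.
  apply: (fin2 _ (sigma / 4) (1 / 4 - sigma / 2)); first by field.
  apply: integral_sqr_oneDsqr_le.
  - exact: measurable_vlow.
  - by move=> x; exact: vlow_ge0.
  - by apply: mulr_ge0 (powR_ge0 _ _); exact: mulr_ge0.
  apply: ae_imp P => x P; have [K1 _] := KI x.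
  rewrite -lee_fin; apply: (le_trans P).
  apply: (le_trans (lee_wpmul2l _ K1)); first by rewrite lee_fin.
  by rewrite -EFinM lee_fin le_eqVlt; apply/orP; left; apply/eqP; ring.
apply: (fin2 _ ((sigma + 1) / 4) (- (sigma / 2))); first by field.
apply: integral_sqr_oneDsqr_le.
- by apply: measurable_funM; [exact: normr_measurable|exact: measurable_vlow].
- by move=> x; rewrite mulr_ge0// vlow_ge0.
- by apply: mulr_ge0 (powR_ge0 _ _); exact: mulr_ge0.
apply: ae_imp P => x P; have [_ K1] := KI x.
rewrite -lee_fin EFinM; apply: (le_trans (lee_wpmul2l _ P)); first by rewrite lee_fin.
rewrite muleCA; apply: (le_trans (lee_wpmul2l _ K1)); first by rewrite lee_fin.
by rewrite -EFinM lee_fin le_eqVlt; apply/orP; left; apply/eqP; ring.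
Qed.

Lemma vlow_vanish_step t0 : 0 <= t0 -> vlow_vanish t0 -> vlow_vanish (t0 + step_len).
Proof.
move=> t00 vn t tT tt; have [le|gt] := leP t t0; first exact: vn.
(* The a priori bound [M] is halved indefinitely on one and the same time step. *)
have bd n : vlow_bounded t0 step_len (M / 2 ^+ n).
  elim: n => [|n IH]; first by rewrite expr0 divr1; exact: vlow_bounded_init.
  rewrite exprSr invfM mulrA; apply: vlow_bounded_half => //.
  by rewrite divr_ge0 ?exprn_ge0// ltW.
have ttl : t0 < t <= t0 + step_len by rewrite gt.
have [_ tT'] := andP tT.
have I0 : (\int[mu]_x (vlow t x ^+ 2)%:E = 0)%E.
  apply/eqP; rewrite eq_le; apply/andP; split; last first.
    by apply: integral_ge0 => x _; rewrite lee_fin sqr_ge0.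
  apply/lee_addgt0Pr => e e0; rewrite add0e.
  pose A := M * (t - t0) `^ (- (sigma / 4)).
  have A0 : 0 <= A by rewrite mulr_ge0 ?powR_ge0// ltW.
  have [n k1] : exists n : nat, A ^+ 2 / e <= 2 ^+ n.
    exists (Num.bound (A ^+ 2 / e)).
    apply: (@le_trans _ _ (Num.bound (A ^+ 2 / e))%:R); last by rewrite -natrX ler_nat ltnW// ltn_expl.
    by apply/ltW/archi_boundP; rewrite divr_ge0 ?sqr_ge0// ltW.
  have [B _] := bd n t ttl tT'; apply: (le_trans B); rewrite lee_fin.
  rewrite ler_pdivrMr// in k1.
  have p1 : 1 <= 2 ^+ n :> R by rewrite exprn_ege1// ler1n.
  have p0 : 0 < 2 ^+ n :> R by exact: lt_le_trans p1.
  rewrite [X in X ^+ 2](_ : _ = A / 2 ^+ n); last by rewrite /A mulrAC.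
  rewrite expr_div_n ler_pdivrMr ?exprn_gt0//; apply: (le_trans k1).
  by rewrite mulrC; apply: ler_wpM2l; [exact: ltW|rewrite expr2 ler_peMr// ltW].
have m2 : measurable_fun setT (fun x => (vlow t x ^+ 2)%:E).
  by apply/measurable_EFinP; apply: measurable_funX; exact: measurable_vlow.
have := (ae_eq_integral_abs mu measurableT m2).1.
under eq_integral do rewrite gee0_abs ?lee_fin ?sqr_ge0//.
move=> /(_ I0); apply: ae_imp => x /(_ Logic.I) [] /eqP.
by rewrite sqrf_eq0 => /eqP.
Qed.

Lemma vlow_eq0 t : 0 <= t <= T -> {ae mu, forall x, vlow t x = 0}.
Proof.
have base : vlow_vanish 0.
  move=> t' /andP[t0 tT] t'0; have -> : t' = 0 by apply/eqP; rewrite eq_le t'0.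
  have TT : 0 <= (0 : R) <= T by rewrite lexx (le_trans t0).
  apply: ae_imp (v_mild TT) => x [_ _ vE].
  rewrite /vlow /low; case: ifPn => // x1; rewrite vE /duhamel d_eq0// mulr0 add0r.
  by rewrite set_itv1 /integral_C !Rintegral_set1 /= expr0n/= addr0 sqrtr0.
have all_steps n : vlow_vanish (step_len *+ n).
  elim: n => [|n IH]; first exact: base.
  rewrite mulrSr; apply: vlow_vanish_step => //.
  by rewrite mulrn_wge0// ltW// step_len_gt0.
move=> tT; have [t0 _] := andP tT.
apply: (all_steps (Num.bound (t / step_len))) => //.
rewrite -mulr_natr -ler_pdivrMl ?step_len_gt0// mulrC.
by apply/ltW/archi_boundP; rewrite divr_ge0// ltW// step_len_gt0.
Qed.

End LowFrequencyVanishing.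

(** * Uniqueness *)

Section Uniqueness.
Local Open Scope complex_scope.
Variable R : realType.
Notation mu := (@lebesgue_measure R).
Notation normc := ComplexField.Normc.normc.
Implicit Types (t x : R).

Lemma measurable_slice (T : R) (F : R * R -> R) t : 0 <= t <= T ->
  measurable_fun (`[0, T] `*` setT) F -> measurable_fun setT (fun x => F (t, x)).
Proof.
move=> tT mF; pose D : set (R * R) := `[0, T] `*` setT.
have mD : measurable D by apply: measurableX => //; exact: measurable_itv.
have := measurable_fun_pair2 t ((measurable_restrictT F mD).1 mF).
apply: eq_measurable_fun => x _; rewrite patchE ifT// inE /D; split => //=.
Qed.

Lemma measurable_C_slice (T : R) (v : R -> R -> R[i]) t : 0 <= t <= T ->
  measurable_fun_C (`[0, T] `*` setT) (fun z : R * R => v z.1 z.2) -> measurable_fun_C setT (v t).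
Proof. by move=> tT [mr mi]; split; [exact: (measurable_slice tT mr)|exact: (measurable_slice tT mi)]. Qed.

Lemma sqrte_le_sqr (I : \bar R) (a : R) : 0 <= a -> (sqrte I <= a%:E)%E -> (I <= (a ^+ 2)%:E)%E.
Proof.
move=> a0 h; rewrite -lee_sqrt ?lee_fin ?sqr_ge0//.
by rewrite /= sqrtr_sqr ger0_norm.
Qed.

Lemma weighted_norm_le (c M : R) (N : \bar R) : 0 < c -> (c%:E * N <= M%:E)%E -> (N <= (M * c^-1)%:E)%E.
Proof.
move=> c0 h; have ci : (0 <= (c^-1)%:E :> \bar R)%E by rewrite lee_fin invr_ge0 ltW.
have := lee_wpmul2l ci h.
by rewrite muleA -!EFinM mulVf ?gt_eqF// mul1e mulrC.
Qed.

Lemma normc_mul_dx (f : R -> R[i]) x : normc (mul_dx f x) = `|x| * normc (f x).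
Proof. by rewrite /mul_dx ComplexField.Normc.normcM /= expr0n/= add0r sqrtr_sqr. Qed.

(* [sigma] is [|s|] if [|s| < 1] and 0 if [s >= 1], where the time weights are not
   integrable but H^s is contained in H^1. *)
Lemma X_norm_bounds s (T : R) (v : R -> R -> R[i]) : -1 < s -> 0 < T ->
  (forall t, 0 <= t <= T -> measurable_fun_C setT (v t)) -> (X_norm s T v < +oo)%E ->
  exists sigma M, [/\ 0 <= sigma < 1, 0 < M,
    forall t, 0 < t <= T ->
      (\int[mu]_x (normc (v t x) ^+ 2)%:E <= ((M * t `^ (- (sigma / 4))) ^+ 2)%:E)%E
  & forall t, 0 < t <= T ->
      (\int[mu]_x ((`|x| * normc (v t x)) ^+ 2)%:E <=
        ((M * t `^ (- ((sigma + 1) / 4))) ^+ 2)%:E)%E].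
Proof.
move=> s1 T0 mv; rewrite /X_norm.
set A := ereal_sup _; set B := ereal_sup _; set C := ereal_sup _ => XT.
have TT : 0 < T <= T by rewrite T0 lexx.
have Ale t : 0 <= t <= T -> (Hs_norm s (v t) <= A)%E.
  by move=> tT; apply: ereal_sup_ubound; exists t => //=; rewrite in_itv.
have Ble t : 0 < t <= T -> ((t `^ (`|s| / 4))%:E * L2_norm (v t) <= B)%E.
  by move=> tT; apply: ereal_sup_ubound; exists t => //=; rewrite in_itv.
have Cle t : 0 < t <= T -> ((t `^ ((`|s| + 1) / 4))%:E * L2_norm (mul_dx (v t)) <= C)%E.
  by move=> tT; apply: ereal_sup_ubound; exists t => //=; rewrite in_itv.
have A0 : (0 <= A)%E.
  apply: le_trans (Ale T _); first exact: sqrte_ge0.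
  by rewrite (ltW T0) lexx.
have B0 : (0 <= B)%E.
  by apply: le_trans (Ble _ TT); rewrite mule_ge0 ?sqrte_ge0// lee_fin powR_ge0.
have C0 : (0 <= C)%E.
  by apply: le_trans (Cle _ TT); rewrite mule_ge0 ?sqrte_ge0// lee_fin powR_ge0.
have X0 : (0 <= A + B + C)%E by apply: adde_ge0 => //; exact: adde_ge0.
have [M0 XM] : exists M0, (A + B + C)%E = M0%:E.
  by exists (fine (A + B + C)%E); rewrite fineK// ge0_fin_numE.
have M00 : 0 <= M0 by rewrite -lee_fin -XM.
have AM : (A <= M0%:E)%E by rewrite -XM -addeA; apply: leeDl; exact: adde_ge0.
have BM : (B <= M0%:E)%E by rewrite -XM [(A + B)%E]addeC -addeA; apply: leeDl; exact: adde_ge0.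
have CM : (C <= M0%:E)%E by rewrite -XM; apply: leeDr; exact: adde_ge0.
have [sl1|sg1] := ltP `|s| 1.
  exists `|s|, (M0 + 1); split.
  - by rewrite normr_ge0.
  - by rewrite ltr_wpDl.
  - move=> t tT; have [t0 _] := andP tT.
    apply: sqrte_le_sqr; first by rewrite mulr_ge0 ?powR_ge0// addr_ge0.
    have := weighted_norm_le (powR_gt0 _ t0) (le_trans (Ble t tT) BM).
    rewrite -powRN => /le_trans; apply; rewrite lee_fin.
    by apply: ler_wpM2r; [exact: powR_ge0|rewrite lerDl].
  - move=> t tT; have [t0 _] := andP tT.
    apply: sqrte_le_sqr; first by rewrite mulr_ge0 ?powR_ge0// addr_ge0.
    have := weighted_norm_le (powR_gt0 _ t0) (le_trans (Cle t tT) CM).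
    rewrite /L2_norm; under eq_integral do rewrite normc_mul_dx.
    rewrite -powRN => /le_trans; apply; rewrite lee_fin.
    by apply: ler_wpM2r; [exact: powR_ge0|rewrite lerDl].
have sge1 : 1 <= s.
  by move: sg1; rewrite ler_normr => /orP[//|]; lra.
pose p : R := (0 + 1) / 4.
have p0 : 0 <= p by rewrite /p; lra.
have Tp : 0 < T `^ p by exact: powR_gt0.
exists 0, ((M0 + 1) * (1 + T `^ p)).
have M1 : 0 < M0 + 1 by rewrite ltr_wpDl.
have MT : 0 < (M0 + 1) * (1 + T `^ p) by rewrite mulr_gt0// addr_gt0.
have MM : M0 <= (M0 + 1) * (1 + T `^ p).
  apply: (@le_trans _ _ ((M0 + 1) * 1)); first lra.
  by rewrite ler_pM2l// lerDl ltW.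
have W x : 1 <= (1 + x ^+ 2) `^ s /\ x ^+ 2 <= (1 + x ^+ 2) `^ s.
  have Y1 : 1 <= 1 + x ^+ 2 by rewrite lerDl sqr_ge0.
  have Ys : 1 + x ^+ 2 <= (1 + x ^+ 2) `^ s by exact: le1r_powR.
  by split; [exact: le_trans Ys|apply: le_trans Ys; rewrite lerDr].
have HM t (w : R -> R) : 0 < t <= T -> measurable_fun setT w ->
    (forall x, 0 <= w x <= (1 + x ^+ 2) `^ s) ->
    (\int[mu]_x (w x * normc (v t x) ^+ 2)%:E <= (M0 ^+ 2)%:E)%E.
  move=> /andP[t0 tT] mw wW; have tT' : 0 <= t <= T by rewrite ltW.
  have mn : measurable_fun setT (fun x => normc (v t x)) by apply: measurable_normc; exact: mv.
  apply: le_trans (sqrte_le_sqr M00 (le_trans (Ale t tT') AM)).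
  apply: ge0_le_integral => //.
  - move=> x _; rewrite lee_fin; apply: mulr_ge0; last exact: sqr_ge0.
    by case/andP: (wW x).
  - by apply/measurable_EFinP; apply: measurable_funM => //; exact: measurable_funX.
  - apply/measurable_EFinP; apply: measurable_funM; last exact: measurable_funX.
    apply: (measurableT_comp (measurable_powR s)).
    by apply: measurable_funD => //; exact: measurable_funX.
  - move=> x _; rewrite lee_fin; apply: ler_wpM2r; first exact: sqr_ge0.
    by case/andP: (wW x).
split => //; first by rewrite lexx ltr01.
- move=> t tT; rewrite mul0r oppr0 powRr0 mulr1.
  have := HM t (fun=> 1) tT; under eq_integral do rewrite mul1r.
  move=> h; apply: (le_trans (h _ _)); first exact: measurable_cst.
    by move=> x; rewrite ler01/=; case: (W x).
  by rewrite lee_fin lerXn2r ?nnegrE// ltW.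
- move=> t tT; have [t0 tT'] := andP tT.
  have := HM t (fun x => x ^+ 2) tT.
  under eq_integral => x _ do rewrite -(real_normK (num_real x)) -exprMn.
  move=> h; apply: (le_trans (h _ _)); first exact: measurable_funX.
    by move=> x; rewrite sqr_ge0/=; case: (W x).
  have tp : T `^ (- p) <= t `^ (- p).
    rewrite !powRN lef_pV2 ?posrE ?powR_gt0//.
    by apply: ge0_ler_powR; rewrite ?nnegrE ?(ltW t0) ?(ltW T0).
  have M2 : M0 <= (M0 + 1) * (1 + T `^ p) * t `^ (- p).
    apply: (@le_trans _ _ ((M0 + 1) * (1 + T `^ p) * T `^ (- p))); last by rewrite ler_pM2l.
    rewrite -mulrA [(1 + _) * _]mulrDl powRN mulfV ?gt_eqF// mul1r.
    apply: (@le_trans _ _ ((M0 + 1) * 1)); first lra.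
    by rewrite ler_pM2l// lerDr invr_ge0 ltW.
  by rewrite lee_fin lerXn2r ?nnegrE// (le_trans M00).
Qed.

Lemma ae_imp2 (P Q S : R -> Prop) : (forall x, P x -> Q x -> S x) ->
  {ae mu, forall x, P x} -> {ae mu, forall x, Q x} -> {ae mu, forall x, S x}.
Proof.
move=> PQS hP hQ; apply: (negligibleS _ (negligibleU hP hQ)) => x /= nS.
by apply/not_andP => -[Px Qx]; apply: nS; exact: PQS.
Qed.

(** For almost every [z], either both arguments [z] and [x - z] exceed 1, hence are at most [y], or
    one of the two factors vanishes for both functions. The conclusion holds at every [x], since
    integrals ignore null sets. *)
Lemma ae_eq_nonlin (g1 g2 : R) (w w' : R -> R[i]) (x y : R) :
  measurable_fun_C setT w -> measurable_fun_C setT w' ->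
  {ae mu, forall z, z <= 1 -> w z = 0} -> (forall z, z <= 1 -> w' z = 0) ->
  {ae mu, forall z, z <= y -> w z = w' z} -> x <= y + 1 ->
  nonlin g1 g2 w x = nonlin g1 g2 w' x.
Proof.
move=> mw mw' w0 w'0 ww' xy.
have key : {ae mu, forall z, (w z = w' z /\ w (x - z) = w' (x - z)) \/
    ((w z = 0 /\ w' z = 0) \/ (w (x - z) = 0 /\ w' (x - z) = 0))}.
  have E : {ae mu, forall z, (z <= 1 -> w z = 0) /\ (z <= y -> w z = w' z)}.
    exact: ae_imp2 w0 ww'.
  apply: ae_imp2 E (ae_reflect x E) => z [h1 h2] [h3 h4].
  have [z1|z1] := leP z 1; first by right; left; rewrite h1// w'0.
  have [xz1|xz1] := leP (x - z) 1; first by right; right; rewrite h3// w'0.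
  by left; split; [apply: h2|apply: h4]; lra.
have mabs u : measurable_fun_C setT u -> measurable_fun_C setT (mul_abs u).
  by move=> mu'; apply: measurable_CM => //; apply: measurable_C_real; exact: normr_measurable.
have msq u : measurable_fun_C setT u -> measurable_fun_C setT (mul_sq u).
  by move=> mu'; apply: measurable_CM => //; apply: measurable_C_real; exact: measurable_funX.
rewrite /nonlin; congr (_ * _ - _ * _).
  apply: ae_eq_integral_C => //.
  - by apply: measurable_CM; [apply: measurable_C_reflect|]; exact: mabs.
  - by apply: measurable_CM; [apply: measurable_C_reflect|]; exact: mabs.
  - apply: ae_imp key => z + _; rewrite /mul_abs.
    by move=> [[-> ->]//|[[-> ->]|[-> ->]]]; rewrite !(mulr0, mul0r).
apply: ae_eq_integral_C => //.
- by apply: measurable_CM; [exact: measurable_C_reflect|exact: msq].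
- by apply: measurable_CM; [exact: measurable_C_reflect|exact: msq].
- apply: ae_imp key => z + _; rewrite /mul_sq.
  by move=> [[-> ->]//|[[-> ->]|[-> ->]]]; rewrite !(mulr0, mul0r).
Qed.

Lemma eq_integral_C (D : set R) (u w : R -> R[i]) :
  (forall x, D x -> u x = w x) -> integral_C D u = integral_C D w.
Proof.
move=> uw; rewrite /integral_C; congr (_ +i* _); apply: eq_Rintegral => x /set_mem Dx.
  by rewrite uw.
by rewrite uw.
Qed.

Lemma eq_duhamel (alpha g1 g2 : R) (u0 : R -> R[i]) (u u' : R -> R -> R[i]) t x :
  (forall tau, 0 <= tau <= t -> nonlin g1 g2 (u tau) x = nonlin g1 g2 (u' tau) x) ->
  duhamel alpha g1 g2 u0 u t x = duhamel alpha g1 g2 u0 u' t x.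
Proof.
move=> uu'; rewrite /duhamel.
suff -> : integral_C `[0, t] (duhamel_integrand alpha g1 g2 u t x) =
  integral_C `[0, t] (duhamel_integrand alpha g1 g2 u' t x) by [].
apply: eq_integral_C => tau; rewrite /= in_itv/= => taut.
by rewrite /duhamel_integrand uu'.
Qed.

Lemma mild_unique (alpha g1 g2 s T : R) (d : R -> R) (f : R -> R -> R) (v : R -> R -> R[i]) :
  0 <= alpha -> 0 < g1 -> g2 < 0 -> (forall x, x <= 1 -> d x = 0) -> -1 < s ->
  adm f -> (forall t x, f t x = rduhamel alpha g1 g2 d f t x) ->
  X_solution alpha g1 g2 s (fun x => (d x)%:C) T v ->
  forall t, 0 <= t <= T -> {ae mu, forall x, v t x = (f t x)%:C}.
Proof.
move=> a0 g10 g20 d0 s1 af ff [T0 [mv _ Xv] vm].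
have mvt t : 0 <= t <= T -> measurable_fun_C setT (v t).
  by move=> tT; exact: measurable_C_slice mv.
have [sigma [M [s01 M0 v2 vdx]]] := X_norm_bounds s1 T0 mvt Xv.
have v0 t : 0 <= t <= T -> {ae mu, forall x, x <= 1 -> v t x = 0}.
  move=> /(vlow_eq0 a0 g10 g20 d0 s01 M0 mvt v2 vdx vm); apply: ae_imp => x.
  by rewrite /vlow /low => h x1; rewrite x1 in h; exact: normc_eq0.
have [_ _ f1 _] := af.
have mf t : 0 <= t -> measurable_fun_C setT (fun x => (f t x)%:C).
  by move=> t0; apply: measurable_C_real; have [] := adm_slice af t0.
have freq n t : 0 <= t <= T -> {ae mu, forall x, x <= n.+1%:R -> v t x = (f t x)%:C}.
  elim: n t => [|n IH] t tT.
    by apply: ae_imp (v0 t tT) => x h x1; rewrite h// f1.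
  (* The only exceptional set is that of the Duhamel formula at time [t]. The null sets of the
     induction hypothesis, one for each [tau], do not accumulate, because [ae_eq_nonlin] gives
     equality at every frequency. *)
  apply: ae_imp (vm t tT) => x [_ _ vE] xn.
  rewrite vE ff -duhamel_real; apply: eq_duhamel => tau /andP[tau0 taut].
  have tauT : 0 <= tau <= T by rewrite tau0 (le_trans taut)//; case/andP: tT.
  apply: (@ae_eq_nonlin g1 g2 (v tau) (fun y => (f tau y)%:C) x n.+1%:R).
  - exact: mvt.
  - exact: mf.
  - exact: v0.
  - by move=> z z1; rewrite f1.
  - exact: IH.
  - by rewrite natr1.
move=> t tT.
have H : {ae mu, forall x, forall n, x <= n.+1%:R -> v t x = (f t x)%:C}.
  by apply/ae_foralln => n; exact: freq.
apply: ae_imp H => x h; apply: (h (Num.bound x)).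
by apply: (le_trans (le_archi_bound x)); rewrite ler_nat.
Qed.

End Uniqueness.

(** * The solution arising from the datum *)

Section Datum.
Variable R : realType.
Notation mu := (@lebesgue_measure R).
Implicit Types (t x : R).

Definition rdatum (eta x : R) : R := if `|x - 3 / 2| < 1 / 2 then eta else 0.

Lemma datum_real eta : datum eta = fun x => (rdatum eta x)%:C%C.
Proof. by apply/funext => x; rewrite /datum /rdatum; case: ifP. Qed.

Lemma measurable_rdatum eta : measurable_fun setT (rdatum eta).
Proof.
apply: measurable_fun_if => //; try exact: measurable_cst.
apply: measurable_fun_ltr; last exact: measurable_cst.
apply: measurableT_comp; first exact: normr_measurable.
exact: measurable_funB.
Qed.

Lemma rdatum_ge0 eta x : 0 <= eta -> 0 <= rdatum eta x.
Proof. by rewrite /rdatum; case: ifP. Qed.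

Lemma rdatum_le eta x : 0 <= eta -> rdatum eta x <= eta.
Proof. by rewrite /rdatum; case: ifP. Qed.

Lemma rdatum_eq0 eta x : x <= 1 \/ 2 <= x -> rdatum eta x = 0.
Proof.
rewrite /rdatum ltr_norml => h; case: ifP => // /andP[? ?]; exfalso.
by case: h; lra.
Qed.

(** Equivalently exp (1/2) <= 2, which follows from exp (-1/2) >= 1 - 1/2. *)
Lemma ln2_ge : 1 / 2 <= ln 2 :> R.
Proof.
rewrite -ler_expR lnK ?posrE//.
have h := expR_ge1Dx (- (1 / 2) : R).
have e0 := expR_gt0 (1 / 2 : R).
have : expR (1 / 2) * expR (- (1 / 2)) = 1 :> R by rewrite expRN mulfV// gt_eqF.
have h2 : 1 / 2 <= expR (- (1 / 2)) :> R by lra.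
have := ler_wpM2l (ltW e0) h2; lra.
Qed.

Lemma Tstar16_ge1 : 1 <= 16 * Tstar R.
Proof. by rewrite /Tstar; have := ln2_ge; lra. Qed.

Lemma C0_ge1 : 1 <= C0 R.
Proof.
have T0 : 0 <= Tstar R by have := Tstar16_ge1; lra.
have e0 : 0 < expR (- (3 / 2 * Tstar R * 2 ^+ 5)) by exact: expR_gt0.
have e1 : expR (- (3 / 2 * Tstar R * 2 ^+ 5)) <= 1.
  rewrite -expR0 ler_expR oppr_le0; apply: mulr_ge0; last exact: exprn_ge0.
  by rewrite mulr_ge0//; lra.
have p0 : 0 < 2 ^- 10 :> R by rewrite invr_gt0 exprn_gt0.
have p1 : 2 ^- 10 <= 1 :> R by rewrite invf_le1 ?exprn_gt0// exprn_ege1// ler1n.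
rewrite /C0 invf_ge1 ?mulr_gt0//.
by rewrite -[leRHS]mulr1; apply: ler_pM => //; exact: ltW.
Qed.

(** The factors [1 *] are [Lambda], instantiated by 1 in the theorem. Both thresholds are at least
    1, since [C0 R] is and the exponent [1 - 2 * s] is positive for [s < 1 / 2]. *)
Lemma eta_ge1 (s eta : R) : 0 < eta ->
  (s < 1 / 2 -> 1 * 2 `^ (1 - 2 * s) * C0 R <= eta ^+ 2) ->
  (1 / 2 <= s -> 1 * C0 R <= eta ^+ 2) -> 1 <= eta.
Proof.
move=> eta0 h1 h2; have c1 := C0_ge1.
suff : 1 <= eta ^+ 2 by rewrite expr_ge1// ltW.
have [s2|s2] := ltP s (1 / 2); last by apply: le_trans (h2 s2); rewrite mul1r.
apply: le_trans (h1 s2); rewrite mul1r.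
have p1 : 1 <= 2 `^ (1 - 2 * s) by rewrite -[leLHS](powRr0 2) ler_powR ?ler1n//; lra.
by apply: (le_trans c1); rewrite ler_peMl//; lra.
Qed.

End Datum.

Section Solution.
Variable R : realType.
Variables (alpha g1 g2 eta : R).
Hypothesis (alpha_ge0 : 0 <= alpha) (g1_gt0 : 0 < g1) (g2_lt0 : g2 < 0) (eta_gt0 : 0 < eta).

Let d := rdatum eta.
Let md : measurable_fun setT d. Proof. exact: measurable_rdatum. Qed.
Let d_ge0 x : 0 <= d x. Proof. by apply: rdatum_ge0; exact: ltW. Qed.
Let d_le x : d x <= eta. Proof. by apply: rdatum_le; exact: ltW. Qed.
Let d_eq0 x : x <= 1 -> d x = 0. Proof. by move=> x1; apply: rdatum_eq0; left. Qed.
Let d_eq0' x : 2 <= x -> d x = 0. Proof. by move=> x2; apply: rdatum_eq0; right. Qed.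

Let f := rsol alpha g1 g2 d.
Let af : adm f. Proof. exact: adm_rsol. Qed.
Let ff t x : f t x = rduhamel alpha g1 g2 d f t x. Proof. exact: rsol_fixpoint. Qed.

Lemma X_solution_rsol (s : R) :
  X_solution alpha g1 g2 s (datum eta) (decay_time g1 g2 eta) (fun t x => (f t x)%:C%C).
Proof.
have T0 := decay_time_gt0 g1_gt0 g2_lt0 d_ge0 d_le.
have T1 := decay_time_le1 g1_gt0 g2_lt0 d_ge0 d_le.
have fd := decaying_rsol alpha_ge0 g1_gt0 g2_lt0 md d_ge0 d_le d_eq0 d_eq0'.
have A0 := decay_amp_gt0 d_ge0 d_le.
have G0 := coupling_gt0 g1_gt0 g2_lt0.
have [_ f0 f1 _] := af.
(* One constant serves both the size bound and the Lipschitz bound in time. *)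
pose C := decay_amp eta + lipschitz_cst alpha g1 g2 eta.
have L0 : 0 <= lipschitz_cst alpha g1 g2 eta.
  apply: addr_ge0; first by apply: mulr_ge0; [exact: addr_ge0|exact: ltW].
  by apply: mulr_ge0; [exact: ltW|exact: sqr_ge0].
have C_ge0 : 0 <= C by apply: addr_ge0 => //; exact: ltW.
have mf t : 0 <= t <= decay_time g1 g2 eta -> measurable_fun setT (f t).
  by case/andP => t0 _; have [] := adm_slice af t0.
have E0 x : 1 < x -> 0 <= (1 + x) ^+ 4 * expR (- x).
  by move=> x1; rewrite mulr_ge0 ?expR_ge0// exprn_ge0//; lra.
have fC t x : 0 <= t <= decay_time g1 g2 eta -> 1 < x ->
    `|f t x| <= C * ((1 + x) ^+ 4 * expR (- x)).
  move=> tT x1; rewrite ger0_norm//; apply: (le_trans (fd t x tT)).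
  have h : expR (- x) <= (1 + x) ^+ 4 * expR (- x).
    by rewrite ler_peMl ?expR_ge0// exprn_ege1//; lra.
  apply: (@le_trans _ _ (C * expR (- x))); last exact: ler_wpM2l.
  by apply: ler_wpM2r; [exact: expR_ge0|rewrite lerDl].
have fL t t' x : 0 <= t -> t <= t' -> t' <= decay_time g1 g2 eta -> 1 < x ->
    `|f t' x - f t x| <= (t' - t) * (C * ((1 + x) ^+ 4 * expR (- x))).
  move=> t0 tt' t'T x1.
  apply: (le_trans (decaying_lipschitz alpha_ge0 g1_gt0 g2_lt0 d_ge0 d_le af fd ff t0 tt' t'T (ltW x1))).
  apply: ler_wpM2l; first by rewrite subr_ge0.
  by apply: ler_wpM2r; [exact: E0|rewrite lerDr ltW].
split => //; last by rewrite datum_real; exact: mild_real.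
split.
- have [mj _ _ _] := af.
  by apply: measurable_C_real; exact: measurable_funTS.
- exact: cont_Hs_real fL.
- exact: X_norm_real_lty fC.
Qed.

Lemma is_the_solution_rsol (s : R) : -1 < s ->
  is_the_solution alpha g1 g2 s (datum eta) (fun t x => (f t x)%:C%C).
Proof.
move=> s1; split.
- move=> t x _; apply: cvg_near_cst; exists (Num.bound x) => // n /= xn.
  have fn : f t x = rpicard alpha g1 g2 d n t x.
    apply: rsolE => //; apply: (le_trans (le_archi_bound x)); by rewrite ler_nat.
  by rewrite datum_real picard_real -/d -fn subrr ComplexField.Normc.normc0.
- by move=> T _; rewrite datum_real; exact: mild_real.
- by exists (decay_time g1 g2 eta); exact: X_solution_rsol.
- move=> T v; rewrite datum_real => vX t tT.
  exact: (mild_unique alpha_ge0 g1_gt0 g2_lt0 d_eq0 s1 af ff vX tT).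
Qed.

End Solution.

Theorem theorem1p1 (R : realType) (alpha : R) (halpha : 0 <= alpha) :
  exists Lambda C1 : R, [/\ 1 <= Lambda, 0 < C1 &
    forall (s eta : R),
      -1 < s -> 0 < eta ->
      (s < 1 / 2 -> Lambda * 2 `^ (1 - 2 * s) * C0 R <= eta ^+ 2) ->
      (1 / 2 <= s -> Lambda * C0 R <= eta ^+ 2) ->
    forall gamma1 gamma2 : R,
      gamma2 != gamma1 / 2 -> gamma2 != 0 ->
      gamma2 < 0 -> 0 < gamma1 -> C1 / 2 <= gamma1 - gamma2 ->
    exists u : R -> R -> complex R,
      is_the_solution alpha gamma1 gamma2 s (datum eta) u /\
      Hdot_norm s (u (Tstar R)) = +oo%E].
Proof.
pose E := expR (- (Tstar R * (16 * (1 + alpha)))).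
pose K := expR (- 1) / (4 ^+ 5 * (1 + alpha)).
have E0 : 0 < E by exact: expR_gt0.
have K0 : 0 < K by rewrite divr_gt0 ?expR_gt0// mulr_gt0 ?exprn_gt0// ltr_wpDr.
(* [8 <= eta * E * (g1 - g2) * K] must hold as soon as [1 <= eta]. *)
exists 1, (2 * (8 / (E * K))); split => //.
  by rewrite mulr_gt0// divr_gt0// mulr_gt0.
move=> s eta s1 eta0 h1 h2 g1 g2 _ _ g20 g10 hg.
exists (fun t x => (rsol alpha g1 g2 (rdatum eta) t x)%:C%C); split.
  exact: is_the_solution_rsol.
have eta1 := eta_ge1 eta0 h1 h2.
have d_ge0 x : 0 <= rdatum eta x by apply: rdatum_ge0; exact: ltW.
have d_le x : rdatum eta x <= eta by apply: rdatum_le; exact: ltW.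
have d_eq0 x : x <= 1 -> rdatum eta x = 0 by move=> x1; apply: rdatum_eq0; left.
have md : measurable_fun setT (rdatum eta) by exact: measurable_rdatum.
have d_eta x : `|x - 3 / 2| < 1 / 2 -> rdatum eta x = eta by move=> xI; rewrite /rdatum xI.
have af : adm (rsol alpha g1 g2 (rdatum eta)) by exact: adm_rsol.
have f_fix t x : rsol alpha g1 g2 (rdatum eta) t x =
    rduhamel alpha g1 g2 (rdatum eta) (rsol alpha g1 g2 (rdatum eta)) t x.
  exact: rsol_fixpoint.
apply: (Hdot_norm_eqy halpha g10 g20 d_ge0 d_eta af f_fix _ _ s1).
- exact: Tstar16_ge1.
- have -> : growth_cst alpha g1 g2 = (g1 - g2) * K by rewrite /growth_cst /K mulrA.
  rewrite -/E (_ : 8 = 1 * E * (8 / (E * K) * K)); last first.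
    by field; rewrite !gt_eqF.
  apply: ler_pM.
  + by rewrite mul1r ltW.
  + apply: mulr_ge0; [apply: divr_ge0 => //; apply: mulr_ge0; exact: ltW|exact: ltW].
  + by rewrite ler_pM2r.
  + rewrite ler_pM2r//; move: hg; set z := 8 / (E * K); lra.
Qed.
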